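(* Fix $n\ge 2$ and let $\Bbbk=\mathbb Z[\delta]$. For all objects $\underline w,\underline z$ of $\mathbf{Fund}^+$, the double ladders $\mathbb{LL}^\lambda_{\mathbf e,\mathbf f}\in\mathrm{Hom}_{\mathbf{Fund}^+}(\underline w,\underline z)$, for all dominant weights $\lambda$, all $\mathbf e\in E(\underline w,\lambda)$ and all $\mathbf f\in E(\underline z,\lambda)$, are linearly independent.
   Context: **Webs.** Fix $n\ge2$ and a commutative $\mathbb Z[\delta]$-algebra $\Bbbk$. Quantum numbers in $\Bbbk$: $[0]=0$, $[1]=1$, $[m]\delta=[m+1]+[m-1]$ for $m\in\mathbb Z$; for $k\ge0$, $\begin{bmatrix}m\\k\end{bmatrix}=\frac{[m][m-1]\cdots[m-k+1]}{[k]\cdots[1]}$ (a polynomial in $\delta$, defined also for $m<0$), and it is $0$ for $k<0$. Let $I_n=\{1,\dots,n-1\}$, $\hat I_n=\{0,\dots,n\}$. An extended $\mathfrak{sl}_n$-web is an oriented planar graph in the strip $\mathbb R\times[0,1]$ (up to isotopy, read from bottom to top), with edges labelled by integers, edges possibly ending on the boundary lines, and vertices of two kinds: trivalent vertices (merges $M_{k,l}:k\otimes l\to k+l$ and splits $S_{k,l}:k+l\to k\otimes l$), and tags (bivalent vertices at which an edge labelled $k$ and an edge labelled $n-k$ are both incoming or both outgoing, with a marked side). A (non-extended) web has all labels in $I_n$. An extended web is read as a linear combination of webs: it is $0$ if some label is outside $\hat I_n$; otherwise edges labelled $0$ are erased, and edges labelled $n$ are erased, a trivalent vertex with edges $k,n-k,n$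 becoming a tag marked on the side where the $n$-edge was. Rungs: for labels in $\hat I_n$, the northeast-tilting rung $F^{(s)}:(a,b)\to(a-s,b+s)$ is $(1_{a-s}\otimes M_{s,b})(S_{a-s,s}\otimes1_b)$, and the northwest-tilting rung $E^{(s)}:(a,b)\to(a+s,b-s)$ is $(M_{a,s}\otimes1_{b-s})(1_a\otimes S_{s,b-s})$; $s\ge0$ is the crossbar label. $\mathbf{Fund}$ is the $\Bbbk$-linear monoidal category whose objects are finite sequences of elements of $I_n^+\sqcup I_n^-$ (upward and downward oriented labels), with concatenation as tensor product, and whose morphisms are $\Bbbk$-combinations of webs with the given bottom and top, modulo the following relations (and their reflections and orientation reversals): switching the side of a tag multiplies by $(-1)^{k(n-k)}$; two consecutive tags on a strand marked on opposite sides cancel; $M_{k,l}S_{k,l}=\begin{bmatrix}k+l\\l\end{bmatrix}1$; closing off the $l$-strand of $S_{k,l}M_{k,l}$ by an arc gives $\begin{bmatrix}n-k\\l\end{bmatrix}1_k$; a circle labelled $k$ equals $\begin{bmatrix}n\\k\end{bmatrix}$; associativity $M_{k+l,m}(M_{k,l}\otimes1)=M_{k,l+m}(1\otimes M_{l,m})$ (when $k+l+m=n$, read as extended webs, this is the tag slide); rung squash $F^{(r)}F^{(s)}=\begin{bmatrix}r+s\\ r\end{bmatrix}F^{(r+s)}$; rung swap $E^{(r)}F^{(s)}1_{(k,l)}=\sum_t\begin{bmatrix}k-l+r-s\\t\end{bmatrix}F^{(s-t)}E^{(r-t)}1_{(k,l)}$. $\mathbf{Fund}^+$ is the full subcategory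 whose objects are sequences of upward oriented labels, i.e. finite sequences in $I_n$. **Ladders.** A ladder with $m$ uprights is a composition of rungs, each placed between two adjacent uprights of a sequence in $\hat I_n^m$; it is interpreted as a morphism of $\mathbf{Fund}^+$ by reading it as an extended web and deleting all $0$ and $n$ from the source and target. A rung $(a,b)\to(c,d)$ is neutral if $\{a,b\}=\{c,d\}$ as multisets. A neutral ladder is a composition of neutral rungs (identities allowed). The duality involution $\phi\mapsto\overline\phi$ flips a web upside-down and reverses orientations; on ladders it reverses composition and exchanges $E^{(s)}$ and $F^{(s)}$. **Weights.** Label $i\in I_n$ stands for the fundamental weight $\omega_i$ of $\mathfrak{sl}_n$. For $\underline w$ in $\mathbf{Fund}^+$, $\mathrm{wt}(\underline w)$ is the sum of its fundamental weights; $\underline w\in P(\lambda)$ means $\mathrm{wt}(\underline w)=\lambda$. $\Omega(a)$ is the set of 01-sequences $\mu=(\mu_1,\dots,\mu_n)$ with exactly $a$ ones, identified with the weights $\sum_{i=1}^{n-1}(\mu_i-\mu_{i+1})\omega_i$ of $V_{\omega_a}=\Lambda^a(\mathbb C^n)$. For $\underline w=(w_1,\dots,w_d)$, a dominant weight subsequence of $\underline w$ is a sequence $\mathbf e=(e_0=0,e_1,\dots,e_d)$ of dominant weights with $e_k-e_{k-1}\in\Omega(w_k)$; $E(\underline w,\lambda)$ is the set of those with $e_d=\lambda$. If $\underline w\in P(\lambda)$ then $E(\underline w,\lambda)$ has one element, the full weight subsequence. **Light ladders.** For $\mu\in\Omega(a)$, decompose $\mu$ into alternating maximal strings of ones and zeros,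 starting with a (possibly empty) string of ones and ending with a (possibly empty) string of zeros. Let $0\le y_1<x_1<y_2<\dots<x_k<y_{k+1}\le n$ where $y_i$ (resp. $x_i$) is the last index of the $i$-th string of ones (resp. zeros; the last zero-string is not counted; $y_1=0$ if the first one-string is empty). Let $\beta_i$ be the number of zeros among the first $x_i$ entries. The elementary light ladder is $E_\mu=F_1^{(\beta_1)}\circ\cdots\circ F_k^{(\beta_k)}:(x_1,\dots,x_k,a)\to(y_1,\dots,y_{k+1})$, where $F_i^{(s)}$ is the rung between uprights $i$ and $i+1$ (labels $0,n$ of the target are deleted; $E_{\omega_a}=1_a$). A light ladder for $\mathbf e$ is any morphism built inductively: start with the identity of the empty sequence; given a light ladder $L_d:(w_1,\dots,w_d)\to\underline x$ for $(e_0,\dots,e_d)$ with $\underline x\in P(e_d)$, and $w_{d+1}=a$, $\mu=e_{d+1}-e_d$, set $L_{d+1}=N'\circ(1_{\underline u}\otimes E_\mu)\circ(N\otimes1_a)\circ(L_d\otimes1_a)$ where $N:\underline x\to\underline u\,x_1\cdots x_k$ and $N'$ are arbitrary neutral ladders. Fix one sequence $\underline x_\lambda\in P(\lambda)$ for each dominant $\lambda$, and for each $\mathbf e\in E(\underline w,\lambda)$ one light ladder $LL_{\mathbf e}:\underline w\to\underline x_\lambda$ (the identity if $\underline w=\underline x_\lambda$ and $\mathbf e$ is full). For $\mathbf e\in E(\underline w,\lambda)$, $\mathbf f\in E(\underline z,\lambda)$ the double ladder is $\mathbb{LL}^\lambda_{\mathbf e,\mathbf f}=\overline{LL_{\mathbf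 f}}\circ LL_{\mathbf e}:\underline w\to\underline z$.
   Formalization: Consecutive tags are taken to cancel when marked on the same side of the straightened strand, not opposite sides: for even n the opposite-side relation, with rung squash and tag switching, forces 2[n choose k]=0 on the empty web for odd k; for odd n both agree. *)

(* Defs.v *)
From HB Require Import structures.
From mathcomp Require Import all_boot all_order all_algebra.

Set Implicit Arguments.
Unset Strict Implicit.
Unset Printing Implicit Defensive.

Import Order.TTheory GRing.Theory Num.Theory.
Local Open Scope ring_scope.

(* Z[delta] is {poly int}, with delta the variable 'X. *)
Fixpoint qnat (m : nat) : {poly int} :=
  match m with
  | 0%N => 0
  | 1%N => 1
  | (m''.+1 as m').+1 => qnat m' * 'X - qnat m''
  end.

Definition qint (m : int) : {poly int} :=
  match m with Posz p => qnat p | Negz p => - qnat p.+1 end.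

Lemma qint_rec (m : int) : qint m * 'X = qint (m + 1) + qint (m - 1).
Proof.
have qS p : qnat p.+2 = qnat p.+1 * 'X - qnat p by [].
case: m => [[|p]|[|p]].
- by rewrite add0r sub0r /= mul0r subrr.
- have -> : p.+1%:Z + 1 = p.+2%:Z by rewrite -PoszD addn1.
  have -> : p.+1%:Z - 1 = p%:Z by rewrite -addn1 PoszD addrK.
  by rewrite /qint qS subrK.
- by rewrite /= subr0 mul1r add0r mulN1r.
- have -> : Negz p.+1 + 1 = Negz p.
    by rewrite !NegzE -[p.+2]addn1 PoszD opprD subrK.
  have -> : Negz p.+1 - 1 = Negz p.+2.
    by rewrite !NegzE -[p.+3]addn1 [in RHS]PoszD opprD.
  rewrite /qint (qS p.+1); move: (qnat p.+1) (qnat p.+2) => a b.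
  by rewrite opprB addKr mulNr.
Qed.

(* The divisor is monic and the division is exact, so that %/ is the quotient
   in Z[delta]. *)
Definition qbinom (m : int) (k : nat) : {poly int} :=
  (\prod_(i < k) qint (m - i%:Z)) %/ (\prod_(i < k) qint i.+1%:Z).

Definition in_I (n : nat) (k : int) : bool := 0 < k < n%:Z.
Definition in_hatI (n : nat) (k : int) : bool := 0 <= k <= n%:Z.

(* An oriented label: (true, k) is k upward, (false, k) is k downward. *)
Definition strand : Type := (bool * int)%type.
Definition up (k : int) : strand := (true, k).
Definition flip (x : strand) : strand := (~~ x.1, x.2).

Definition obj := seq strand.
Definition is_obj (n : nat) (w : obj) : bool := all (fun x => in_I n x.2) w.

Definition dual_obj (w : obj) : obj := rev (map flip w).

Definition is_upobj (n : nat) (w : seq int) : bool := all (in_I n) w.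
Definition upobj (w : seq int) : obj := map up w.

Definition strip (n : nat) (a : seq int) : seq int := filter (in_I n) a.
Definition vis (n : nat) (a : seq int) : obj := upobj (strip n a).

(* A web is a planar graph up to isotopy, that is, a morphism of the free
   strict pivotal category on its vertices.  A linear combination of webs is
   presented by a term, in which identities, vertices, caps and cups are glued
   by vertical composition and juxtaposition; planar isotopy is part of the
   congruence [weq] below. *)

(* Merge k l  : k l -> k+l        Split k l  : k+l -> k l
   TagIn k l  : k l -> 1          TagOut k l : 1 -> k l
   The tags have k + l = n; TagIn is marked on its upper side and TagOut on
   its lower side, where an n-edge would be. *)
Inductive vertex :=
  | Merge of int & int
  | Split of int & int
  | TagIn of int & int
  | TagOut of int & int.

Definition vdom (v : vertex) : obj :=
  match v with
  | Merge k l | TagIn k l => [:: up k; up l]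
  | Split k l => [:: up (k + l)]
  | TagOut _ _ => [::]
  end.

Definition vcod (v : vertex) : obj :=
  match v with
  | Split k l | TagOut k l => [:: up k; up l]
  | Merge k l => [:: up (k + l)]
  | TagIn _ _ => [::]
  end.

Definition is_vertex (n : nat) (v : vertex) : bool :=
  match v with
  | Merge k l | Split k l => [&& in_I n k, in_I n l & in_I n (k + l)]
  | TagIn k l | TagOut k l => [&& in_I n k, in_I n l & k + l == n%:Z]
  end.

(* Cap x : x x^* -> 1 and Cup x : 1 -> x x^*, where x^* = flip x.
   Comp u t is u after t; Tens t u has t on the left of u. *)
Inductive term :=
  | Id of obj
  | Vert of vertex
  | Cap of strand
  | Cup of strand
  | Comp of term & term
  | Tens of term & term
  | Zero of obj & obj
  | Add of term & term
  | Scale of {poly int} & term.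

Fixpoint dom (t : term) : obj :=
  match t with
  | Id w => w
  | Vert v => vdom v
  | Cap x => [:: x; flip x]
  | Cup _ => [::]
  | Comp _ t => dom t
  | Tens t u => dom t ++ dom u
  | Zero w _ => w
  | Add t _ => dom t
  | Scale _ t => dom t
  end.

Fixpoint cod (t : term) : obj :=
  match t with
  | Id w => w
  | Vert v => vcod v
  | Cap _ => [::]
  | Cup x => [:: x; flip x]
  | Comp u _ => cod u
  | Tens t u => cod t ++ cod u
  | Zero _ z => z
  | Add t _ => cod t
  | Scale _ t => cod t
  end.

Fixpoint wf (n : nat) (t : term) : bool :=
  match t with
  | Id w => is_obj n w
  | Vert v => is_vertex n v
  | Cap x | Cup x => in_I n x.2
  | Comp u t => [&& wf n u, wf n t & cod t == dom u]
  | Tens t u => wf n t && wf n u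
  | Zero w z => is_obj n w && is_obj n z
  | Add t u => [&& wf n t, wf n u, dom t == dom u & cod t == cod u]
  | Scale _ t => wf n t
  end.

Definition is_hom (n : nat) (w z : obj) (t : term) : bool :=
  [&& wf n t, dom t == w & cod t == z].

Definition lsum (w z : obj) (ts : seq term) : term := foldr Add (Zero w z) ts.

(* The duality involution: upside-down flip and orientation reversal. *)
Fixpoint bar (t : term) : term :=
  match t with
  | Id w => Id w
  | Vert (Merge k l) => Vert (Split k l)
  | Vert (Split k l) => Vert (Merge k l)
  | Vert (TagIn k l) => Vert (TagOut k l)
  | Vert (TagOut k l) => Vert (TagIn k l)
  | Cap x => Cup x
  | Cup x => Cap x
  | Comp u t => Comp (bar t) (bar u)
  | Tens t u => Tens (bar t) (bar u)
  | Zero w z => Zero z w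
  | Add t u => Add (bar t) (bar u)
  | Scale c t => Scale c (bar t)
  end.

Fixpoint mirror (t : term) : term :=
  match t with
  | Id w => Id (rev w)
  | Vert (Merge k l) => Vert (Merge l k)
  | Vert (Split k l) => Vert (Split l k)
  | Vert (TagIn k l) => Vert (TagIn l k)
  | Vert (TagOut k l) => Vert (TagOut l k)
  | Cap x => Cap (flip x)
  | Cup x => Cup (flip x)
  | Comp u t => Comp (mirror u) (mirror t)
  | Tens t u => Tens (mirror u) (mirror t)
  | Zero w z => Zero (rev w) (rev z)
  | Add t u => Add (mirror t) (mirror u)
  | Scale c t => Scale c (mirror t)
  end.

Fixpoint caps (w : obj) : term :=
  if w is x :: w' then
    Comp (Cap x) (Tens (Id [:: x]) (Tens (caps w') (Id [:: flip x])))
  else Id [::].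

Fixpoint cups (w : obj) : term :=
  if w is x :: w' then
    Comp (Tens (Id [:: x]) (Tens (cups w') (Id [:: flip x]))) (Cup x)
  else Id [::].

(* The two half-turn rotations z^* -> w^* of t : w -> z. *)
Definition rmate (t : term) : term :=
  let w' := dual_obj (dom t) in let z' := dual_obj (cod t) in
  Comp (Tens (Id w') (caps (cod t)))
    (Comp (Tens (Id w') (Tens t (Id z'))) (Tens (cups w') (Id z'))).

Definition lmate (t : term) : term :=
  let w' := dual_obj (dom t) in let z' := dual_obj (cod t) in
  Comp (Tens (caps z') (Id w'))
    (Comp (Tens (Id z') (Tens t (Id w'))) (Tens (Id z') (cups (dom t)))).

(* For t : w x -> z x, close off the rightmost strand x by an arc. *)
Definition close_right (w z : obj) (x : strand) (t : term) : term :=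
  Comp (Tens (Id z) (Cap x))
    (Comp (Tens t (Id [:: flip x])) (Tens (Id w) (Cup x))).

(* Vertices of extended webs, whose labels are arbitrary integers.  [vis]
   erases every label outside I_n, and not only 0 and n, in order that the zero
   morphism standing for a vertex with a label outside {0, ..., n} can still be
   composed with the rest of the web. *)

Definition xmerge (n : nat) (k l : int) : term :=
  if [&& in_hatI n k, in_hatI n l & in_hatI n (k + l)] then
    if k == 0 then Id (vis n [:: l])
    else if l == 0 then Id (vis n [:: k])
    else if k + l == n%:Z then Vert (TagIn k l)
    else Vert (Merge k l)
  else Zero (vis n [:: k; l]) (vis n [:: k + l]).

Definition xsplit (n : nat) (k l : int) : term :=
  if [&& in_hatI n k, in_hatI n l & in_hatI n (k + l)] then
    if k == 0 then Id (vis n [:: l])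
    else if l == 0 then Id (vis n [:: k])
    else if k + l == n%:Z then Vert (TagOut k l)
    else Vert (Split k l)
  else Zero (vis n [:: k + l]) (vis n [:: k; l]).

Definition rungF (n : nat) (s : nat) (a b : int) : term :=
  Comp (Tens (Id (vis n [:: a - s%:Z])) (xmerge n s%:Z b))
       (Tens (xsplit n (a - s%:Z) s%:Z) (Id (vis n [:: b]))).

Definition rungE (n : nat) (s : nat) (a b : int) : term :=
  Comp (Tens (xmerge n a s%:Z) (Id (vis n [:: b - s%:Z])))
       (Tens (Id (vis n [:: a])) (xsplit n s%:Z (b - s%:Z))).

(* The defining relations, closed under [mirror] and [bar].  Together with
   rotations, under which [weq] is closed because strands can be bent, these
   generate all reflections and orientation reversals. *)
Inductive web_rel (n : nat) : obj -> obj -> term -> term -> Prop :=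
  (* On the right, TagIn l k is rotated by a half turn: this is the tag on
     k l marked on its lower side. *)
  | rel_tag_switch k l : is_vertex n (TagIn k l) ->
      web_rel n [:: up k; up l] [::]
        (Vert (TagIn k l))
        (Scale ((-1) ^+ absz (k * l))
          (Comp (Cap (up k))
            (Comp (Tens (Id [:: up k])
                     (Tens (Vert (TagIn l k)) (Id [:: flip (up k)])))
                  (Tens (Id [:: up k; up l]) (Cup (up k))))))
  (* A strand k which bends over to the right into a tag marked on its upper
     side, and comes back into a tag marked on its lower side.  (When the
     strand is pulled straight both marks lie on its left.  A pair with one
     mark on the left and one on the right is equal to (-1)^(k(n-k)).) *)
  | rel_tag_cancel k l : is_vertex n (TagIn k l) ->
      web_rel n [:: up k] [:: up k]
        (close_right [:: up k] [:: up k] (up l)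
           (Comp (Vert (TagOut k l)) (Vert (TagIn k l))))
        (Id [:: up k])
  | rel_bigon k l : is_vertex n (Merge k l) ->
      web_rel n [:: up (k + l)] [:: up (k + l)]
        (Comp (Vert (Merge k l)) (Vert (Split k l)))
        (Scale (qbinom (k + l) (absz l)) (Id [:: up (k + l)]))
  | rel_close k l : is_vertex n (Merge k l) ->
      web_rel n [:: up k] [:: up k]
        (close_right [:: up k] [:: up k] (up l)
           (Comp (Vert (Split k l)) (Vert (Merge k l))))
        (Scale (qbinom (n%:Z - k) (absz l)) (Id [:: up k]))
  | rel_circle k : in_I n k ->
      web_rel n [::] [::]
        (Comp (Cap (up k)) (Cup (up k)))
        (Scale (qbinom n%:Z (absz k)) (Id [::]))
  | rel_assoc k l m :
      in_I n k -> in_I n l -> in_I n m -> in_hatI n (k + l + m) ->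
      web_rel n (vis n [:: k; l; m]) (vis n [:: k + l + m])
        (Comp (xmerge n (k + l) m)
              (Tens (xmerge n k l) (Id (vis n [:: m]))))
        (Comp (xmerge n k (l + m))
              (Tens (Id (vis n [:: k])) (xmerge n l m)))
  | rel_rung_squash (r s : nat) k l :
      in_hatI n k -> in_hatI n l ->
      in_hatI n (k - s%:Z - r%:Z) -> in_hatI n (l + s%:Z + r%:Z) ->
      web_rel n (vis n [:: k; l]) (vis n [:: k - s%:Z - r%:Z; l + s%:Z + r%:Z])
        (Comp (rungF n r (k - s%:Z) (l + s%:Z)) (rungF n s k l))
        (Scale (qbinom (r + s)%N%:Z r) (rungF n (r + s) k l))
  | rel_rung_swap (r s : nat) k l :
      in_hatI n k -> in_hatI n l ->
      in_hatI n (k - s%:Z + r%:Z) -> in_hatI n (l + s%:Z - r%:Z) ->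
      web_rel n (vis n [:: k; l]) (vis n [:: k - s%:Z + r%:Z; l + s%:Z - r%:Z])
        (Comp (rungE n r (k - s%:Z) (l + s%:Z)) (rungF n s k l))
        (lsum (vis n [:: k; l])
              (vis n [:: k - s%:Z + r%:Z; l + s%:Z - r%:Z])
           [seq Scale (qbinom (k - l + r%:Z - s%:Z) t)
                  (Comp (rungF n (s - t) (k + (r - t)%N%:Z) (l - (r - t)%N%:Z))
                        (rungE n (r - t) k l))
           | t <- iota 0 (minn r s).+1])
  | rel_mirror w z t u : web_rel n w z t u ->
      web_rel n (rev w) (rev z) (mirror t) (mirror u)
  | rel_bar w z t u : web_rel n w z t u -> web_rel n z w (bar t) (bar u).

(* [weq n w z t u] : t and u are equal in Hom_Fund(w, z). *)
Inductive weq (n : nat) : obj -> obj -> term -> term -> Prop :=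
  | weq_rel w z t u : web_rel n w z t u -> weq n w z t u
  | weq_refl w z t : is_hom n w z t -> weq n w z t t
  | weq_sym w z t u : weq n w z t u -> weq n w z u t
  | weq_trans w z t u v : weq n w z t u -> weq n w z u v -> weq n w z t v
  | weq_comp w x z t t' u u' : weq n w x t t' -> weq n x z u u' ->
      weq n w z (Comp u t) (Comp u' t')
  | weq_tens w z t t' w' z' u u' : weq n w z t t' -> weq n w' z' u u' ->
      weq n (w ++ w') (z ++ z') (Tens t u) (Tens t' u')
  | weq_add w z t t' u u' : weq n w z t t' -> weq n w z u u' ->
      weq n w z (Add t u) (Add t' u')
  | weq_scale w z c t t' : weq n w z t t' ->
      weq n w z (Scale c t) (Scale c t')
  | weq_comp_idl w z t : is_hom n w z t -> weq n w z (Comp (Id z) t) t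
  | weq_comp_idr w z t : is_hom n w z t -> weq n w z (Comp t (Id w)) t
  | weq_compA w x y z t u v : is_hom n w x t -> is_hom n x y u ->
      is_hom n y z v ->
      weq n w z (Comp v (Comp u t)) (Comp (Comp v u) t)
  | weq_tens_idl w z t : is_hom n w z t -> weq n w z (Tens (Id [::]) t) t
  | weq_tens_idr w z t : is_hom n w z t -> weq n w z (Tens t (Id [::])) t
  | weq_tensA w z t w' z' u w'' z'' v :
      is_hom n w z t -> is_hom n w' z' u -> is_hom n w'' z'' v ->
      weq n (w ++ w' ++ w'') (z ++ z' ++ z'')
        (Tens t (Tens u v)) (Tens (Tens t u) v)
  | weq_tens_id w w' : is_obj n w -> is_obj n w' ->
      weq n (w ++ w') (w ++ w') (Tens (Id w) (Id w')) (Id (w ++ w'))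
  | weq_interchange w x z t u w' x' z' t' u' :
      is_hom n w x t -> is_hom n x z u ->
      is_hom n w' x' t' -> is_hom n x' z' u' ->
      weq n (w ++ w') (z ++ z')
        (Comp (Tens u u') (Tens t t')) (Tens (Comp u t) (Comp u' t'))
  | weq_addA w z t u v :
      is_hom n w z t -> is_hom n w z u -> is_hom n w z v ->
      weq n w z (Add t (Add u v)) (Add (Add t u) v)
  | weq_addC w z t u : is_hom n w z t -> is_hom n w z u ->
      weq n w z (Add t u) (Add u t)
  | weq_add0 w z t : is_hom n w z t -> weq n w z (Add (Zero w z) t) t
  | weq_addN w z t : is_hom n w z t ->
      weq n w z (Add (Scale (-1) t) t) (Zero w z)
  | weq_scale1 w z t : is_hom n w z t -> weq n w z (Scale 1 t) t
  | weq_scaleA w z b c t : is_hom n w z t ->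
      weq n w z (Scale b (Scale c t)) (Scale (b * c) t)
  | weq_scaleDl w z b c t : is_hom n w z t ->
      weq n w z (Scale (b + c) t) (Add (Scale b t) (Scale c t))
  | weq_scaleDr w z c t u : is_hom n w z t -> is_hom n w z u ->
      weq n w z (Scale c (Add t u)) (Add (Scale c t) (Scale c u))
  | weq_comp_addl w x z t u v :
      is_hom n w x t -> is_hom n x z u -> is_hom n x z v ->
      weq n w z (Comp (Add u v) t) (Add (Comp u t) (Comp v t))
  | weq_comp_addr w x z t u v :
      is_hom n w x t -> is_hom n w x u -> is_hom n x z v ->
      weq n w z (Comp v (Add t u)) (Add (Comp v t) (Comp v u))
  | weq_comp_scalel w x z c t u :
      is_hom n w x t -> is_hom n x z u ->
      weq n w z (Comp (Scale c u) t) (Scale c (Comp u t))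
  | weq_comp_scaler w x z c t u : is_hom n w x t -> is_hom n x z u ->
      weq n w z (Comp u (Scale c t)) (Scale c (Comp u t))
  | weq_tens_addl w z t u w' z' v :
      is_hom n w z t -> is_hom n w z u -> is_hom n w' z' v ->
      weq n (w ++ w') (z ++ z')
        (Tens (Add t u) v) (Add (Tens t v) (Tens u v))
  | weq_tens_addr w z t w' z' u v :
      is_hom n w z t -> is_hom n w' z' u -> is_hom n w' z' v ->
      weq n (w ++ w') (z ++ z')
        (Tens t (Add u v)) (Add (Tens t u) (Tens t v))
  | weq_tens_scalel w z c t w' z' u : is_hom n w z t -> is_hom n w' z' u ->
      weq n (w ++ w') (z ++ z') (Tens (Scale c t) u) (Scale c (Tens t u))
  | weq_tens_scaler w z c t w' z' u : is_hom n w z t -> is_hom n w' z' u ->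
      weq n (w ++ w') (z ++ z') (Tens t (Scale c u)) (Scale c (Tens t u))
  (* planar isotopy: strands can be straightened, vertices can be rotated *)
  | weq_zigzag_right x : in_I n x.2 ->
      weq n [:: x] [:: x]
        (Comp (Tens (Id [:: x]) (Cap (flip x))) (Tens (Cup x) (Id [:: x])))
        (Id [:: x])
  | weq_zigzag_left x : in_I n x.2 ->
      weq n [:: x] [:: x]
        (Comp (Tens (Cap x) (Id [:: x])) (Tens (Id [:: x]) (Cup (flip x))))
        (Id [:: x])
  | weq_rotate v : is_vertex n v ->
      weq n (dual_obj (vcod v)) (dual_obj (vdom v))
        (rmate (Vert v)) (lmate (Vert v)).

(* The family F, indexed by the i such that P i, is linearly independent over
   Z[delta] in Hom_Fund(w, z). *)
Definition lin_indep (n : nat) (w z : obj) (I : eqType)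
    (P : I -> Prop) (F : I -> term) : Prop :=
  forall (s : seq I) (c : I -> {poly int}),
    uniq s -> (forall i, i \in s -> P i) ->
    weq n w z (lsum w z [seq Scale (c i) (F i) | i <- s]) (Zero w z) ->
    forall i, i \in s -> c i = 0.

(* The rung F^(crossbar) (if [northeast]) or E^(crossbar) between the uprights
   number pos and pos + 1, the leftmost upright being number 0. *)
Record rung := Rung { northeast : bool; pos : nat; crossbar : nat }.

Definition rung_left (r : rung) (a : seq int) : int :=
  if northeast r then a`_(pos r) - (crossbar r)%:Z
  else a`_(pos r) + (crossbar r)%:Z.

Definition rung_right (r : rung) (a : seq int) : int :=
  if northeast r then a`_(pos r).+1 + (crossbar r)%:Z
  else a`_(pos r).+1 - (crossbar r)%:Z.

Definition rung_top (r : rung) (a : seq int) : seq int :=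
  take (pos r) a ++ [:: rung_left r a; rung_right r a] ++ drop (pos r).+2 a.

Definition rung_web (n : nat) (r : rung) (a : seq int) : term :=
  Tens (Id (vis n (take (pos r) a)))
    (Tens ((if northeast r then rungF else rungE) n (crossbar r)
             a`_(pos r) a`_(pos r).+1)
          (Id (vis n (drop (pos r).+2 a)))).

Definition neutral_rung (r : rung) (a : seq int) : bool :=
  perm_eq [:: a`_(pos r); a`_(pos r).+1] [:: rung_left r a; rung_right r a].

(* The sequence of rungs, from bottom to top; it is read on a sequence a of
   bottom labels. *)
Definition ladder := seq rung.

Fixpoint is_ladder (n : nat) (L : ladder) (a : seq int) : bool :=
  all (in_hatI n) a &&
  if L is r :: L' then
    ((pos r).+1 < size a)%N && is_ladder n L' (rung_top r a)
  else true.

Fixpoint ladder_top (L : ladder) (a : seq int) : seq int :=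
  if L is r :: L' then ladder_top L' (rung_top r a) else a.

Fixpoint ladder_web (n : nat) (L : ladder) (a : seq int) : term :=
  if L is r :: L' then Comp (ladder_web n L' (rung_top r a)) (rung_web n r a)
  else Id (vis n a).

Fixpoint neutral (L : ladder) (a : seq int) : bool :=
  if L is r :: L' then neutral_rung r a && neutral L' (rung_top r a) else true.

(* The uprights of the ladder may carry 0 and n in addition to the labels of
   w and z. *)
Definition neutral_ladder (n : nat) (w z : seq int) (N : term) : Prop :=
  exists (a : seq int) (L : ladder),
    [/\ is_ladder n L a, neutral L a, strip n a = w,
        strip n (ladder_top L a) = z & N = ladder_web n L a].

(* lam i is the coefficient of omega_(i+1) in lam. *)
Definition weight (n : nat) : Type := {ffun 'I_n.-1 -> int}.
HB.instance Definition _ n := GRing.Zmodule.on (weight n).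

Definition dominant (n : nat) (lam : weight n) : bool := [forall i, 0 <= lam i].

Definition wt (n : nat) (w : seq int) : weight n :=
  [ffun i : 'I_n.-1 => (count_mem i.+1%:Z w)%:Z].

Definition in_P (n : nat) (lam : weight n) (w : seq int) : bool :=
  is_upobj n w && (wt n w == lam).

(* The 01-sequence mu = (mu_1, ..., mu_n) has mu_i = nth false mu (i-1). *)
Definition Omega (n : nat) (a : int) : pred (n.-tuple bool) :=
  fun mu => (count id mu)%:Z == a.

Definition wt01 (n : nat) (mu : n.-tuple bool) : weight n :=
  [ffun i : 'I_n.-1 =>
     (nth false mu i : nat)%:Z - (nth false mu i.+1 : nat)%:Z].

Definition dom_subseq (n : nat) (w : seq int) (e : seq (weight n)) : bool :=
  [&& size e == (size w).+1, e`_0 == 0, all (@dominant n) e &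
      [forall k : 'I_(size w), [exists mu : n.-tuple bool,
         Omega w`_k mu && (e`_k.+1 - e`_k == wt01 mu)]]].

Definition in_E (n : nat) (w : seq int) (lam : weight n) (e : seq (weight n)) :=
  dom_subseq w e && (last 0 e == lam).

Definition full_subseq (n : nat) (w : seq int) : seq (weight n) :=
  [seq wt n (take k w) | k <- iota 0 (size w).+1].

(* x_1 < ... < x_k : the positions of the zeros followed by a one. *)
Definition zero_ends (mu : seq bool) : seq nat :=
  [seq x <- iota 1 (size mu).-1 | ~~ nth false mu x.-1 && nth false mu x].

(* y_1 < ... < y_(k+1) : the positions of the ones which are followed by a
   zero or are at the end, preceded by y_1 = 0 if mu_1 = 0. *)
Definition one_ends (mu : seq bool) : seq nat :=
  (if nth false mu 0 then [::] else [:: 0%N]) ++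
  [seq y <- iota 1 (size mu) | nth false mu y.-1 && ~~ nth false mu y].

Definition beta (mu : seq bool) (x : nat) : nat := count negb (take x mu).

Definition E_source (mu : seq bool) : seq int :=
  rcons (map Posz (zero_ends mu)) (count id mu)%:Z.

(* The rung F_k^(beta_k) is the bottom one. *)
Definition E_ladder (mu : seq bool) : ladder :=
  rev [seq Rung true i (beta mu (nth 0%N (zero_ends mu) i))
      | i <- iota 0 (size (zero_ends mu))].

Definition E_web (n : nat) (mu : seq bool) : term :=
  ladder_web n (E_ladder mu) (E_source mu).

(* light_ladder w e x L : L : w -> x is a light ladder for e. *)
Inductive light_ladder (n : nat) :
    seq int -> seq (weight n) -> seq int -> term -> Prop :=
  | light_ladder_nil : light_ladder [::] [:: 0] [::] (Id [::])
  | light_ladder_rcons w e x L a (mu : n.-tuple bool) u N x' N' :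
      light_ladder w e x L ->
      in_P (last 0 e) x ->
      in_I n a ->
      Omega a mu ->
      dominant (last 0 e + wt01 mu) ->
      neutral_ladder n x (u ++ map Posz (zero_ends mu)) N ->
      neutral_ladder n (u ++ strip n (map Posz (one_ends mu))) x' N' ->
      light_ladder (rcons w a) (rcons e (last 0 e + wt01 mu)) x'
        (Comp N' (Comp (Tens (Id (upobj u)) (E_web n mu))
          (Comp (Tens N (Id [:: up a])) (Tens L (Id [:: up a]))))).

Definition double_ladder (n : nat) (w z : seq int)
    (LL : seq int -> seq (weight n) -> term) (e f : seq (weight n)) : term :=
  Comp (bar (LL z f)) (LL w e).

(* Main.v *)
Require Import Defs.
From mathcomp Require Import all_boot all_order all_algebra.
From mathcomp Require Import zify ring.

Set Implicit Arguments.
Unset Strict Implicit.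
Unset Printing Implicit Defensive.

Import Order.TTheory GRing.Theory Num.Theory.
Local Open Scope ring_scope.

(** The webs act on tensor products of quantum exterior powers of C^n, and the
    double ladders are already independent there, because light ladders are
    unitriangular with respect to highest weight vectors.

    For a real number a > 1 put q = a^2 and delta = q + 1/q.  The label k stands
    for the k-th exterior power, whose basis vectors x_S are indexed by the
    subsets S of k elements of {1, ..., n}, written as bit strings of length n.
    A merge sends x_S (x) x_T to a signed power of a times x_U if U is the
    disjoint union of S and T, and to 0 otherwise; the power is normalised in
    such a way that the split is the transposed matrix.  Tags are merges into
    the full subset, and caps and cups are weighted by q to half the height of
    S, the height being the pairing of the weight with 2 rho.  In this
    normalisation the duality involution is transposition and the mirror image
    reverses the order of {1, ..., n} ([ev_bar], [ev_mirror]), so that only the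
    basic relations remain.  Each of them is a sum over subsets which factors
    over the n coordinates up to powers of a, and is proved by induction on
    the number of coordinates, with the q-Pascal rule as the inductive step
    ([merge_coef_bigon], [merge_coef_close], [rung_squash], [rung_swap]).  This
    gives a functor from webs to matrices ([weq_sound]).

    All the webs here preserve the height.  The tensor product of the highest
    weight vectors is the only basis vector of maximal height, so a neutral
    ladder sends it to a multiple of the highest vector at the other end, which
    turns out to be nonzero ([ladder_coef_neutral]).  An
    elementary light ladder E_mu sends (highest) (x) x_T to a nonzero multiple
    of the highest vector if T = mu, and otherwise has no component there
    ([E_webP]).  Let now s be the basis vector whose successive weights are the
    differences of the entries of e.  By induction on the length, the light
    ladder of e has a nonzero coefficient from s to the highest vector, and
    every other t with such a coefficient is smaller than s when the heights of
    the initial parts are compared, starting from the whole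
    ([light_ladder_rcons_spec]): either its last factor is mu, and the claim is
    known for the initial part, or the initial part is not sent to a highest
    vector, hence has a smaller height.

    Given a linear relation, take a term (e, f) with nonzero coefficient at
    delta = q + 1/q for which the pair (s, t) attached to e and f is maximal.
    The matrix coefficient from s to t vanishes for all the other terms
    ([coef_zero]), so there is no such term.  Hence all the coefficients vanish
    at infinitely many values of delta, and they are 0. *)

(** * Quantum integers and binomials *)

Definition qfall (m : int) (k : nat) : {poly int} :=
  \prod_(i < k) qint (m - i%:Z).

Definition qfact (k : nat) : {poly int} := \prod_(i < k) qint i.+1%:Z.

Lemma qfallS m k : qfall m k.+1 = qint m * qfall (m - 1) k.
Proof.
rewrite /qfall big_ord_recl subr0; congr (_ * _).
by apply: eq_bigr => i _; congr qint; rewrite /= /bump; lia.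
Qed.

Lemma qfallSr m k : qfall m k.+1 = qfall m k * qint (m - k%:Z).
Proof. by rewrite /qfall big_ord_recr. Qed.

Lemma qfactS k : qfact k.+1 = qfact k * qint k.+1%:Z.
Proof. by rewrite /qfact big_ord_recr. Qed.

Lemma qint_succ (m : int) : qint (m + 1) = qint m * 'X - qint (m - 1).
Proof. by rewrite qint_rec addrK. Qed.

Lemma qint_add (m : int) (k : nat) :
  qint (m + k%:Z) = qint k.+1%:Z * qint m - qint k%:Z * qint (m - 1).
Proof.
elim/ltn_ind: k => -[|[|k]] IH.
- by rewrite addr0 /=; ring.
- by rewrite qint_succ /=; ring.
have -> : m + k.+2%:Z = (m + k.+1%:Z) + 1 by lia.
rewrite qint_succ.
have -> : m + k.+1%:Z - 1 = m + k%:Z by lia.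
rewrite !IH //.
have -> : k.+3%:Z = k.+2%:Z + 1 by lia.
have -> : k.+2%:Z = k.+1%:Z + 1 by lia.
rewrite (qint_succ (k.+1%:Z + 1)) (qint_succ k.+1%:Z) addrK.
have -> : k.+1%:Z - 1 = k%:Z by lia.
ring.
Qed.

Lemma qint_sub (m : int) (k : nat) :
  qint (m - k%:Z) = qint k%:Z * qint (m - 1) - qint (k%:Z - 1) * qint m.
Proof.
elim/ltn_ind: k => -[|[|k]] IH.
- by rewrite subr0 /=; ring.
- by rewrite /=; ring.
have -> : m - k.+2%:Z = (m - k.+1%:Z) - 1 by lia.
have H := qint_rec (m - k.+1%:Z).
have -> : qint (m - k.+1%:Z - 1) = qint (m - k.+1%:Z) * 'X - qint (m - k%:Z).
  rewrite H; have -> : m - k.+1%:Z + 1 = m - k%:Z by lia.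
  by ring.
rewrite (IH k.+1) // (IH k) //.
have -> : k.+2%:Z = k.+1%:Z + 1 by lia.
rewrite addrK (qint_succ k.+1%:Z).
have -> : k.+1%:Z - 1 = k%:Z by lia.
have : qint k.+1%:Z = qint k%:Z * 'X - qint (k%:Z - 1).
  by rewrite -qint_succ; congr qint; lia.
move=> ->; ring.
Qed.

(** The recursions [m] = [k+2][m-k-1] - [k+1][m-k-2] and
    [m-k-1] = [k+1][m-1] - [k][m] carry divisibility of falling factorials by
    factorials up and down from [m = 0], inside Z[delta]. *)
Lemma qfall_div (m : int) (k : nat) : exists c, qfall m k = c * qfact k.
Proof.
elim: k m => [|k IHk] m; first by exists 1; rewrite mul1r /qfall /qfact !big_ord0.
elim/int_rect: m => [|m [c Hc]|m [c Hc]].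
- by exists 0; rewrite qfallS mul0r mul0r.
- have [d Hd] := IHk m%:Z.
  exists (c * qint k.+2%:Z - d * qint (m%:Z - k%:Z - 1)).
  rewrite qfallS.
  have -> : m.+1%:Z - 1 = m%:Z by lia.
  have -> : m.+1%:Z = (m%:Z - k%:Z) + k.+1%:Z by lia.
  rewrite qint_add mulrBl -[in X in X - _]mulrA -mulrA [qint (_ - _) * qfall _ _]mulrC.
  rewrite -qfallSr Hc [qint (m%:Z - k%:Z - 1) * _]mulrC Hd qfactS.
  ring.
have [d Hd] := IHk (- m.+1%:Z).
exists (d * qint (- m.+1%:Z) - c * qint k%:Z).
rewrite qfallSr.
have -> : - m.+1%:Z - k%:Z = - m%:Z - k.+1%:Z by lia.
rewrite qint_sub.
have -> : - m%:Z - 1 = - m.+1%:Z by lia.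
have -> : k.+1%:Z - 1 = k%:Z by lia.
have E : qint (- m%:Z) * qfall (- m.+1%:Z) k = qfall (- m%:Z) k.+1.
  by rewrite qfallS; congr (_ * qfall _ _); lia.
transitivity (qfall (- m.+1%:Z) k * (qint (- m.+1%:Z) * qint k.+1%:Z)
              - qint k%:Z * (qint (- m%:Z) * qfall (- m.+1%:Z) k)); first by ring.
by rewrite E Hc Hd qfactS; ring.
Qed.

Lemma qnat_monic m : (size (qnat m.+1) == m.+1) && (qnat m.+1 \is monic).
Proof.
elim/ltn_ind: m => -[|[|m]] IH.
- by rewrite /= size_poly1 eqxx monic1.
- by rewrite /= mul1r subr0 size_polyX monicX eqxx.
have /andP[/eqP s1 m1] := IH m.+1 (ltnSn _).
have /andP[/eqP s0 _] := IH m (ltnW (ltnSn _)).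
have -> : qnat m.+3 = qnat m.+2 * 'X - qnat m.+1 by [].
have sX : size (qnat m.+2 * 'X) = m.+3 by rewrite size_mulX ?monic_neq0 // s1.
have lt : (size (- qnat m.+1)%R < size (qnat m.+2 * 'X)%R)%N.
  by rewrite sX size_polyN s0.
by rewrite size_polyDl // sX eqxx monicE lead_coefDl // lead_coefMX.
Qed.

Lemma qfact_monic k : qfact k \is monic.
Proof.
by rewrite /qfact monic_prod // => i _; have /andP[] := qnat_monic i.
Qed.

Lemma qbinomK m k : qbinom m k * qfact k = qfall m k.
Proof.
have [c Hc] := qfall_div m k.
by rewrite /qbinom -/(qfall m k) -/(qfact k) Hc Pdiv.IdomainMonic.mulpK ?qfact_monic.
Qed.

(** A value of delta is given by the square root a of q, which is what makes
    merges and splits transposes of each other; as a > 1, no quantum integer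
    other than [0] vanishes. *)
Record param (R : realFieldType) := Param {
  sqrt_q : R;
  sqrt_q_gt1 : 1 < sqrt_q }.

Section Evaluation.

Variables (R : realFieldType) (th : param R).

Local Notation a := (sqrt_q th).

Definition qeval (c : {poly int}) : R :=
  (map_poly intr c).[a ^ 2 + a ^ (-2)].

Let a_gt1 : 1 < a := sqrt_q_gt1 th.

Lemma qevalD c d : qeval (c + d) = qeval c + qeval d.
Proof. by rewrite /qeval rmorphD hornerD. Qed.
Lemma qevalB c d : qeval (c - d) = qeval c - qeval d.
Proof. by rewrite /qeval rmorphB hornerD hornerN. Qed.
Lemma qevalN c : qeval (- c) = - qeval c.
Proof. by rewrite /qeval rmorphN hornerN. Qed.
Lemma qevalM c d : qeval (c * d) = qeval c * qeval d.
Proof. by rewrite /qeval rmorphM hornerM. Qed.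
Lemma qeval1 : qeval 1 = 1.
Proof. by rewrite /qeval rmorph1 hornerE. Qed.
Lemma qeval0 : qeval 0 = 0.
Proof. by rewrite /qeval rmorph0 hornerE. Qed.
Lemma qevalX : qeval 'X = a ^ 2 + a ^ (-2).
Proof. by rewrite /qeval map_polyX hornerX. Qed.
Lemma qeval_prod k (G : 'I_k -> {poly int}) : qeval (\prod_i G i) = \prod_i qeval (G i).
Proof. exact: (big_morph qeval qevalM qeval1). Qed.

Lemma a_neq0 : a != 0.
Proof. by rewrite gt_eqF // (lt_trans ltr01). Qed.

Lemma aD (m k : int) : a ^ (m + k) = a ^ m * a ^ k.
Proof. by rewrite expfzDr // a_neq0. Qed.

Lemma aX_neq0 (m : int) : a ^ m != 0.
Proof. by rewrite expfz_neq0 // a_neq0. Qed.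

Lemma qeval_qint (m : int) : qeval (qint m) * (a ^ 2 - a ^ (-2)) = a ^ (2 * m) - a ^ (- 2 * m).
Proof.
have pos (p : nat) : qeval (qnat p) * (a ^ 2 - a ^ (-2)) = a ^ (2 * p%:Z) - a ^ (- 2 * p%:Z).
  elim/ltn_ind: p => -[|[|p]] IH.
  - by rewrite qeval0 mul0r !mulr0 subrr.
  - by rewrite qeval1 mul1r !mulr1.
  have -> : qnat p.+2 = qnat p.+1 * 'X - qnat p by [].
  rewrite qevalB qevalM qevalX mulrBl mulrAC !IH //.
  have -> : 2 * p.+2%:Z = 2 * p.+1%:Z + 2 by lia.
  have -> : 2 * p%:Z = 2 * p.+1%:Z + (-2) by lia.
  have -> : - 2 * p.+2%:Z = - 2 * p.+1%:Z + (-2) by lia.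
  have -> : - 2 * p%:Z = - 2 * p.+1%:Z + 2 by lia.
  by rewrite !aD; ring.
case: m => p; first exact: pos.
have -> : qint (Negz p) = - qnat p.+1 by [].
rewrite qevalN [LHS]mulNr pos opprB NegzE.
by congr (_ ^ _ - _ ^ _); lia.
Qed.

Lemma qdiff_gt0 (m : nat) : 0 < a ^ (2 * m.+1%:Z) - a ^ (- 2 * m.+1%:Z).
Proof.
have -> : - 2 * m.+1%:Z = - (2 * m.+1)%N%:Z by lia.
have -> : 2 * m.+1%:Z = (2 * m.+1)%N%:Z by lia.
rewrite subr_gt0 -invr_expz -exprnP.
have lt1 : 1 < a ^+ (2 * m.+1) by rewrite exprn_egt1.
by rewrite (lt_trans _ lt1) // invf_lt1 // (lt_trans ltr01).
Qed.

Lemma qeval_qint_neq0 (m : nat) : qeval (qint m.+1%:Z) != 0.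
Proof.
have := qdiff_gt0 m; rewrite -qeval_qint; apply: contraTneq => ->.
by rewrite mul0r ltxx.
Qed.

Definition qbin (m : int) (k : nat) : R := qeval (qbinom m k).

Lemma qfact_neq0 k : qeval (qfact k) != 0.
Proof. by rewrite qeval_prod; apply/prodf_neq0 => i _; exact: qeval_qint_neq0. Qed.

Lemma qbinE m k : qbin m k * qeval (qfact k) = qeval (qfall m k).
Proof. by rewrite -qevalM qbinomK. Qed.

Lemma qbin0 m : qbin m 0 = 1.
Proof.
apply: (mulIf (qfact_neq0 0)); rewrite qbinE /qfall /qfact !big_ord0 qeval1 mulr1 //.
Qed.

Lemma qbin_small (m k : nat) : (m < k)%N -> qbin m%:Z k = 0.
Proof.
move=> lt; apply: (mulIf (qfact_neq0 k)); rewrite qbinE mul0r qeval_prod.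
by rewrite (bigD1 (Ordinal lt)) //= subrr qeval0 mul0r.
Qed.

(** Every way of splitting [m+1] into multiples of [m-k] and [k+1] gives a
    Pascal rule, with the same factors. *)
Lemma qbin_pascal_split (m : int) (k : nat) (u v : R) :
  a ^ (2 * (m + 1)) - a ^ (- 2 * (m + 1)) =
    u * (a ^ (2 * (m - k%:Z)) - a ^ (- 2 * (m - k%:Z)))
    + v * (a ^ (2 * k.+1%:Z) - a ^ (- 2 * k.+1%:Z)) ->
  qbin (m + 1) k.+1 = u * qbin m k.+1 + v * qbin m k.
Proof.
move=> e; apply: (mulIf (qfact_neq0 k.+1)); rewrite qbinE mulrDl -[_ * qbin m k.+1 * _]mulrA qbinE.
rewrite qfactS qevalM -mulrA (mulrA (qbin m k)) qbinE qfallS addrK qfallSr !qevalM.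
apply: (@mulIf _ (a ^ 2 - a ^ (-2))).
  by have := qdiff_gt0 0; rewrite mulr1 => /gt_eqF ->.
by rewrite mulrAC qeval_qint e -!qeval_qint; ring.
Qed.

(** The range of the q-Pascal rule includes negative upper entries, which occur
    in the rung swap relation. *)
Lemma qbin_pascal (m : int) (k : nat) :
  qbin (m + 1) k.+1 = a ^ (2 * k.+1%:Z) * qbin m k.+1 + a ^ (2 * (k%:Z - m)) * qbin m k.
Proof.
apply: qbin_pascal_split.
have -> : 2 * (m + 1) = 2 * k.+1%:Z + 2 * (m - k%:Z) by lia.
have -> : - 2 * (m + 1) = - 2 * k.+1%:Z + 2 * (k%:Z - m) by lia.
have -> : - 2 * (m - k%:Z) = 2 * (k%:Z - m) by lia.
by rewrite !aD; ring.
Qed.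

(** Replacing q by its inverse fixes delta, hence also the binomials, and turns
    one q-Pascal rule into the other. *)
Lemma qbin_pascalV (m : int) (k : nat) :
  qbin (m + 1) k.+1 = a ^ (- 2 * k.+1%:Z) * qbin m k.+1 + a ^ (2 * (m - k%:Z)) * qbin m k.
Proof.
apply: qbin_pascal_split.
have -> : 2 * (m + 1) = 2 * k.+1%:Z + 2 * (m - k%:Z) by lia.
have -> : - 2 * (m + 1) = - 2 * k.+1%:Z + - 2 * (m - k%:Z) by lia.
by rewrite !aD; ring.
Qed.

Lemma qbinnn (k : nat) : qbin k%:Z k = 1.
Proof.
elim: k => [|k IH]; first exact: qbin0.
have -> : k.+1%:Z = k%:Z + 1 by lia.
by rewrite qbin_pascal IH subrr mulr0 expr0z qbin_small // mulr0 add0r mulr1.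
Qed.

End Evaluation.

(** * Bit strings *)

Notation bits := (seq bool).

Definition ones (S : bits) : nat := count id S.
Arguments ones : simpl never.

Lemma ones_cons b S : ones (b :: S) = (b + ones S)%N.
Proof. by []. Qed.

Lemma ones_size S : (ones S <= size S)%N.
Proof. exact: count_size. Qed.

Fixpoint cube (m : nat) : seq bits :=
  if m is m'.+1 then map (cons true) (cube m') ++ map (cons false) (cube m')
  else [:: [::]].

Lemma mem_cube m S : (S \in cube m) = (size S == m).
Proof.
elim: m S => [|m IH] [|b S]; rewrite /= ?inE ?mem_cat //.
  by apply/norP; split; apply/mapP => -[].
rewrite eqSS -IH; case: b.
- rewrite mem_map => [|x y [] //]; rewrite orbC; case: mapP => // -[x _ e]; discriminate e.
by rewrite mem_map => [|x y [] //]; case: mapP => // -[x _ e]; discriminate e.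
Qed.

Lemma cube_uniq m : uniq (cube m).
Proof.
elim: m => //= m IH; rewrite cat_uniq !map_inj_uniq ?IH; try by move=> x y [].
rewrite andbT; apply/hasPn => _ /mapP[S _ ->]; by apply/mapP => -[].
Qed.

(** The sum of n + 1 - 2i over the elements i of S, where i runs from 1 to
    n = size S; this is the pairing of the weight of x_S with 2 rho.  It is also
    l(S,S') - l(S',S) for the complement S' of S, where l(S,T) counts the pairs
    i < j with i in S and j in T, and the recursion adds up the pairs that
    contain the first element. *)
Fixpoint height (S : bits) : int :=
  if S is b :: S' then
    height S' - (ones S')%:Z + (if b then (size S')%:Z else 0)
  else 0.

Lemma height_nseq b m : height (nseq m b) = 0.
Proof.
case: b; elim: m => //= m ->; rewrite /ones count_nseq /= ?mul0n ?mul1n ?size_nseq; lia.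
Qed.

Lemma height_rcons S b :
  height (rcons S b) = height S + (ones S)%:Z - (if b then (size S)%:Z else 0).
Proof.
elim: S => [|c S IH]; first by case: b.
rewrite /= {}IH /ones -cats1 count_cat size_cat /= -/(ones S).
by case: b; case: c => /=; lia.
Qed.

Lemma height_rev S : height (rev S) = - height S.
Proof.
elim: S => // b S IH; rewrite rev_cons height_rcons {}IH /= size_rev.
by rewrite /ones count_rev -/(ones S); case: b; lia.
Qed.

Definition top (m k : nat) : bits := nseq k true ++ nseq (m - k) false.

(** Moving a one to the left raises the height, so that the string with all its
    ones in front is the only one of maximal height. *)
Lemma height_top_le S : height S <= (ones S)%:Z * ((size S)%:Z - (ones S)%:Z).
Proof.
elim: S => //= b S; have := ones_size S.
by rewrite ones_cons; case: b => /=; nia.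
Qed.

Lemma height_top_eq S : height S = (ones S)%:Z * ((size S)%:Z - (ones S)%:Z) ->
  S = top (size S) (ones S).
Proof.
elim: S => //= b S IH; have := ones_size S; have := height_top_le S.
rewrite ones_cons; case: b => /= le sz e.
  rewrite /top /=; congr cons; apply: IH; nia.
have o0 : ones S = 0%N by nia.
rewrite /top o0 /=; congr cons.
by rewrite {1}IH ?o0 /top /= ?subn0 //; nia.
Qed.

Lemma ones_top m k : (k <= m)%N -> ones (top m k) = k.
Proof. by move=> le; rewrite /ones count_cat !count_nseq /=; lia. Qed.

Lemma size_top m k : (k <= m)%N -> size (top m k) = m.
Proof. by move=> le; rewrite size_cat !size_nseq; lia. Qed.

Lemma height_top m k : (k <= m)%N -> height (top m k) = k%:Z * (m%:Z - k%:Z).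
Proof.
elim: k m => [|k IH] [|m] // le; first by rewrite /top subn0 height_nseq mul0r.
rewrite /top subSS [nseq k.+1 true]/= cat_cons -/(top m k) /=.
by rewrite IH // ones_top // size_top //; nia.
Qed.

(** * Matrix coefficients of merges and rungs *)

Section Weights.

Variables (R : realFieldType) (th : param R).

Local Notation a := (sqrt_q th).

(** Monomials in -1 and a are kept as units, in order that a product of them is
    again one, and that two of them are compared by their exponents, the first
    one modulo 2. *)
Definition mon (e z : int) : R := locked ((-1) ^ e * a ^ z).

Lemma mon_def e z : mon e z = (-1) ^ e * a ^ z.
Proof. by rewrite /mon -lock. Qed.

Lemma mon_mul e z e' z' : mon e z * mon e' z' = mon (e + e') (z + z').
Proof.
by rewrite !mon_def aD expfzDr ?oppr_eq0 ?oner_eq0 //; ring.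
Qed.

Lemma mon_eq e z e' z' : (e = e' %[mod 2])%Z -> z = z' -> mon e z = mon e' z'.
Proof.
move=> ee ->; rewrite !mon_def; congr (_ * _).
have -> : e = e' + 2 * ((e - e') %/ 2)%Z by lia.
by rewrite expfzDr ?oppr_eq0 ?oner_eq0 // -exprz_exp -exprnP sqrrN expr1n exp1rz mulr1.
Qed.

Lemma mon_neq0 e z : mon e z != 0.
Proof. by rewrite mon_def mulf_neq0 ?aX_neq0 // expfz_neq0 // oppr_eq0 oner_eq0. Qed.

Lemma monE z : mon 0 z = a ^ z.
Proof. by rewrite mon_def expr0z mul1r. Qed.

Lemma mon00 : mon 0 0 = 1.
Proof. by rewrite monE expr0z. Qed.

Definition merge_bit (b c d : bool) (s t : int) : R :=
  match b, c, d with
  | false, false, false => 1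
  | true, false, true => mon t t
  | false, true, true => mon 0 (- s)
  | _, _, _ => 0
  end.

(** The coefficient of x_U in x_S /\ x_T: it is (-a)^l(S,T) a^(-l(T,S)) if U
    is the disjoint union of S and T, where l(S,T) counts the pairs i < j with
    i in S and j in T.  It is also the coefficient of x_S (x) x_T in the
    image of x_U under a split.  The pairs that contain the first coordinate
    contribute merge_bit. *)
Fixpoint merge_coef (S T U : bits) : R :=
  match S, T, U with
  | [::], [::], [::] => 1
  | b :: S', c :: T', d :: U' => merge_bit b c d (ones S')%:Z (ones T')%:Z * merge_coef S' T' U'
  | _, _, _ => 0
  end.

Lemma merge_coef_supp S T U : merge_coef S T U != 0 ->
  [/\ size S = size U, size T = size U & ones U = (ones S + ones T)%N].
Proof.
elim: U S T => [|d U IH] [|b S] [|c T] //=; rewrite ?eqxx //.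
rewrite mulf_eq0 => /norP[l /IH[-> -> e]]; split => //.
by move: l; rewrite /merge_bit !ones_cons e; case: b; case: c; case: d => //=; rewrite ?eqxx //; lia.
Qed.

Lemma merge_coef_height S T U : merge_coef S T U != 0 -> height U = height S + height T.
Proof.
elim: U S T => [|d U IH] [|b S] [|c T] //=; rewrite ?eqxx //.
rewrite mulf_eq0 => /norP[l nz]; rewrite (IH _ _ nz).
have [-> -> ->] := merge_coef_supp nz.
by move: l; rewrite /merge_bit; case: b; case: c; case: d => //=; rewrite ?eqxx //; lia.
Qed.

Lemma merge_coef_injr S T U V : merge_coef S T U != 0 -> merge_coef S T V != 0 -> U = V.
Proof.
elim: U S T V => [|d U IH] [|b S] [|c T] [|e V] //=; rewrite ?eqxx //.
rewrite !mulf_eq0 => /norP[l nz] /norP[l' nz']; rewrite (IH _ _ _ nz nz').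
congr (_ :: _); move: l l'.
by rewrite /merge_bit; case: b; case: c; case: d; case: e => //=; rewrite ?eqxx.
Qed.

Lemma merge_coef_injl S S' T U : merge_coef S T U != 0 -> merge_coef S' T U != 0 -> S = S'.
Proof.
elim: U S T S' => [|d U IH] [|b S] [|c T] [|e V] //=; rewrite ?eqxx //.
rewrite !mulf_eq0 => /norP[l nz] /norP[l' nz']; rewrite (IH _ _ _ nz nz').
congr (_ :: _); move: l l'.
by rewrite /merge_bit; case: b; case: c; case: d; case: e => //=; rewrite ?eqxx.
Qed.

Lemma merge_coef_rcons S T U b c d : size S = size U -> size T = size U ->
  merge_coef (rcons S b) (rcons T c) (rcons U d) = merge_bit c b d (ones T)%:Z (ones S)%:Z * merge_coef S T U.
Proof.
elim: U S T => [|d' U IH] [|b' S] [|c' T] //=.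
  by move=> _ _; case: b; case: c; case: d.
move=> [eS] [eT]; rewrite {}IH // !ones_cons /ones -!cats1 !count_cat -/(ones S) -/(ones T).
have [->|nz] := eqVneq (merge_coef S T U) 0; first by rewrite !mulr0.
rewrite mulrA [RHS]mulrA; congr (_ * _).
rewrite /merge_bit; case: b'; case: c'; case: d'; case: b; case: c; case: d => /=;
 rewrite ?mulr0 ?mul0r ?mul1r ?mulr1 ?mon_mul //; apply: mon_eq; lia.
Qed.

Lemma merge_coef_rev S T U : size S = size U -> size T = size U ->
  merge_coef (rev T) (rev S) (rev U) = merge_coef S T U.
Proof.
elim: U S T => [|d U IH] [|b S] [|c T] //= [eS] [eT].
rewrite !rev_cons merge_coef_rcons ?size_rev ?eS ?eT // IH //.
by rewrite /ones !count_rev.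
Qed.

Lemma merge_coef_0l T U : size T = size U ->
  merge_coef (nseq (size U) false) T U = (T == U)%:R.
Proof.
elim: U T => [|d U IH] [|c T] //= [e]; rewrite IH // /ones count_nseq /=.
rewrite eqseq_cons; case: c; case: d; rewrite /merge_bit ?mul0r //= ?mul1r //.
by rewrite mul0n oppr0 mon00 mul1r.
Qed.

Lemma merge_coef_0r S U : size S = size U ->
  merge_coef S (nseq (size U) false) U = (S == U)%:R.
Proof.
elim: U S => [|d U IH] [|c S] //= [e]; rewrite IH // /ones count_nseq /=.
rewrite eqseq_cons; case: c; case: d; rewrite /merge_bit ?mul0r //= ?mul1r //.
by rewrite mul0n mon00 mul1r.
Qed.

(** If T is the complement of S, then l(S,T) + l(T,S) = |S||T|, and
    l(S,T) - l(T,S) is the height of S.  Hence exchanging the two factors costs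
    the sign of the tag switch and the power of q which comes from bending the
    strand S around the tag. *)
Lemma merge_coef_full_swap S T : size S = size T ->
  merge_coef S T (nseq (size T) true) =
  mon (ones S * ones T)%N (2 * height S) * merge_coef T S (nseq (size T) true).
Proof.
elim: T S => [|c T IH] [|b S] //=; first by rewrite mulr1 mon00.
move=> [e]; rewrite IH //.
have [->|nz] := eqVneq (merge_coef T S (nseq (size T) true)) 0; first by rewrite !mulr0.
have [_ _ e2] := merge_coef_supp nz.
have {}e2 : size T = (ones T + ones S)%N.
  by rewrite -e2 /ones count_nseq mul1n.
rewrite mulrA [RHS]mulrA; congr (_ * _); rewrite !ones_cons e.
by rewrite /merge_bit; case: b; case: c; rewrite /= ?mulr0 ?mul0r // !mon_mul; apply: mon_eq; nia.
Qed.

Lemma big_cubeS m (G : bits -> R) :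
  \sum_(S <- cube m.+1) G S =
  \sum_(S <- cube m) G (true :: S) + \sum_(S <- cube m) G (false :: S).
Proof. by rewrite big_cat !big_map. Qed.

Lemma big_cube0 (G : bits -> R) : \sum_(S <- cube 0) G S = G [::].
Proof. by rewrite big_seq1. Qed.

Lemma big_scale (I : Type) (r : seq I) (G G' : I -> R) k :
  (forall i, G i = k * G' i) -> \sum_(i <- r) G i = k * \sum_(i <- r) G' i.
Proof. by move=> E; rewrite big_distrr; apply: eq_bigr => i _; rewrite E. Qed.

(** l(-,-) is additive for disjoint unions, so that both sides are given by the
    numbers l for each pair among S, T and V. *)
Lemma merge_coef_assoc m S T V U :
  size S = m -> size T = m -> size V = m -> size U = m ->
  \sum_(W <- cube m) merge_coef S T W * merge_coef W V U = \sum_(W <- cube m) merge_coef T V W * merge_coef S W U.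
Proof.
elim: m S T V U => [|m IH] [|b S] [|c T] [|d V] [|e U] //.
  by rewrite !big_cube0 /=.
move=> [eS] [eT] [eV] [eU].
have -> : \sum_(W <- cube m.+1) merge_coef (b :: S) (c :: T) W * merge_coef W (d :: V) (e :: U) =
    (\sum_(w : bool) merge_bit b c w (ones S) (ones T)
       * merge_bit w d e ((ones S)%:Z + ones T) (ones V)) *
    \sum_(W <- cube m) merge_coef S T W * merge_coef W V U.
  rewrite big_cubeS big_bool mulrDl; congr (_ + _); apply: big_scale => W /=;
  have [->|nz] := eqVneq (merge_coef S T W) 0; (try by ring);
  by have [_ _ ->] := merge_coef_supp nz; rewrite PoszD; ring.
have -> : \sum_(W <- cube m.+1) merge_coef (c :: T) (d :: V) W * merge_coef (b :: S) W (e :: U) =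
    (\sum_(w : bool) merge_bit c d w (ones T) (ones V)
       * merge_bit b w e (ones S) ((ones T)%:Z + ones V)) *
    \sum_(W <- cube m) merge_coef T V W * merge_coef S W U.
  rewrite big_cubeS big_bool mulrDl; congr (_ + _); apply: big_scale => W /=;
  have [->|nz] := eqVneq (merge_coef T V W) 0; (try by ring);
  by have [_ _ ->] := merge_coef_supp nz; rewrite PoszD; ring.
rewrite IH //; congr (_ * _); rewrite !big_bool /merge_bit.
by case: b; case: c; case: d; case: e; rewrite /= ?mulr0 ?mul0r ?addr0 ?add0r
  ?mul1r ?mulr1 ?mon_mul //; apply: mon_eq; lia.
Qed.

(** * Bigons, closures and rungs *)

(** The bigon is diagonal, with the sum of the squared coefficients over all the
    splittings of U as its entries.  If the first coordinate lies in U, it is in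
    S or in T, and these are the two terms of the q-Pascal rule. *)
Lemma merge_coef_bigon m (l : nat) U : size U = m ->
  \sum_(S <- cube m) \sum_(T <- cube m) (ones T == l)%:R * (merge_coef S T U * merge_coef S T U)
  = qbin th (ones U) l.
Proof.
elim: m l U => [|m IH] l [|d U] // eU.
  rewrite !big_cube0 /= mulr1 mulr1; case: l => [|l] /=; first by rewrite qbin0.
  by rewrite qbin_small.
case: eU => eU; rewrite big_cubeS.
have pt (x y : bool) (k : nat) : 
   \sum_(S <- cube m) \sum_(T <- cube m) (ones (y :: T) == (y + k)%N)%:R *
        (merge_coef (x :: S) (y :: T) (d :: U) * merge_coef (x :: S) (y :: T) (d :: U)) =
   merge_bit x y d ((ones U)%:Z - k%:Z) k%:Z ^+ 2 * qbin th (ones U) k.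
  rewrite -IH //; apply: big_scale => S; apply: big_scale => T.
  rewrite ones_cons eqn_add2l; case: eqP => [<-|_]; last by rewrite !mul0r mulr0.
  rewrite !mul1r /=; have [->|nz] := eqVneq (merge_coef S T U) 0; first by ring.
  by have [_ _ ->] := merge_coef_supp nz; rewrite PoszD addrK; ring.
have split2 x : \sum_(S <- cube m) \sum_(T <- cube m.+1) (ones T == l)%:R *
        (merge_coef (x :: S) T (d :: U) * merge_coef (x :: S) T (d :: U)) =
   (if l is k.+1 then merge_bit x true d ((ones U)%:Z - k%:Z) k%:Z ^+ 2 * qbin th (ones U) k
    else 0) + merge_bit x false d ((ones U)%:Z - l%:Z) l%:Z ^+ 2 * qbin th (ones U) l.
  rewrite (eq_bigr _ (fun S _ => big_cubeS _ _)) big_split /=; congr (_ + _).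
    case: l => [|k]; last by rewrite -pt.
    by rewrite big1 // => S _; rewrite big1 // => T _; rewrite ones_cons mul0r.
  by rewrite -pt.
rewrite !split2 /merge_bit ones_cons.
case: d {pt split2}; last first.
  by rewrite /= add0n expr1n mul1r; case: (l) => *; ring.
case: l => [|k].
  by rewrite /= !qbin0 -[mon _ _]/(mon 0 0) mon00; ring.
have -> : (true + ones U)%N%:Z = (ones U)%:Z + 1 by lia.
rewrite qbin_pascal /= !expr2 !mul0r add0r addr0 !mon_mul -!monE.
by congr (_ * _ + _ * _); apply: mon_eq; lia.
Qed.

(** The closing arc puts the weight q^height(T) on the sum over the subsets T
    disjoint from S.  If the first coordinate is not in S, it is in T or not,
    and these are the two terms of the q-Pascal rule. *)
Lemma merge_coef_close m (l : nat) S : size S = m ->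
  \sum_(T <- cube m) \sum_(U <- cube m)
     (ones T == l)%:R * (merge_coef S T U * merge_coef S T U * a ^ (2 * height T))
  = qbin th (m%:Z - (ones S)%:Z) l.
Proof.
elim: m l S => [|m IH] l [|b S] // eS.
  rewrite !big_cube0 /= mulr0 expr0z !mulr1 subrr; case: l => [|l] /=; first by rewrite qbin0.
  by rewrite qbin_small.
case: eS => eS; rewrite big_cubeS.
have pt (y z : bool) (k : nat) : 
   \sum_(T <- cube m) \sum_(U <- cube m) (ones (y :: T) == (y + k)%N)%:R *
     (merge_coef (b :: S) (y :: T) (z :: U) * merge_coef (b :: S) (y :: T) (z :: U) * a ^ (2 * height (y :: T)))
   = merge_bit b y z (ones S) k%:Z ^+ 2 * a ^ (2 * (- k%:Z + (if y then m%:Z else 0)))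
     * qbin th (m%:Z - (ones S)%:Z) k.
  rewrite -IH // big_seq [in RHS]big_seq big_distrr; apply: eq_bigr => T.
  rewrite mem_cube => /eqP eT; apply: big_scale => U.
  rewrite ones_cons eqn_add2l; case: eqP => [<-|_]; last by rewrite !mul0r mulr0.
  rewrite !mul1r /= eT -addrA [2 * (height T + _)]mulrDr aD; ring.
have split2 y k : 
   \sum_(T <- cube m) \sum_(U <- cube m.+1) (ones (y :: T) == (y + k)%N)%:R *
     (merge_coef (b :: S) (y :: T) U * merge_coef (b :: S) (y :: T) U * a ^ (2 * height (y :: T)))
   = (merge_bit b y true (ones S) k%:Z ^+ 2 + merge_bit b y false (ones S) k%:Z ^+ 2) *
     a ^ (2 * (- k%:Z + (if y then m%:Z else 0))) * qbin th (m%:Z - (ones S)%:Z) k.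
  rewrite (eq_bigr _ (fun S _ => big_cubeS _ _)) big_split /= !pt; ring.
rewrite -[l in X in _ + X]add0n [X in _ + X](split2 false l).
have -> : m.+1%:Z - (ones (b :: S))%:Z = (m%:Z - (ones S)%:Z) + (if b then 0 else 1).
  by rewrite ones_cons; case: (b) => /=; lia.
case: l => [|k].
  rewrite big1 => [|T _]; last by rewrite big1 // => U _; rewrite ones_cons mul0r.
  rewrite !qbin0 /merge_bit; case: b {pt split2} => /=;
    by rewrite -monE ?expr2 ?mul0r ?mulr0 ?addr0 ?add0r ?mulr1 ?mul1r ?mon_mul -mon00;
       apply: mon_eq.
rewrite [X in X + _](split2 true k) /merge_bit; case: b {pt split2} => /=.
  rewrite -!monE !expr2 !(mul0r, add0r, addr0, mon_mul) -[RHS]mul1r -mon00.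
  by congr (_ * _); apply: mon_eq; lia.
rewrite qbin_pascalV /= -!monE !expr2 !(mul0r, mul1r, add0r, addr0, mon_mul) addrC.
by congr (_ * _ + _ * _); apply: mon_eq; lia.
Qed.

End Weights.

Section Rungs.

Variables (R : realFieldType) (th : param R).

Local Notation a := (sqrt_q th).

Notation mon := (mon th).
Notation merge_coef := (merge_coef th).
Notation qbin := (qbin th).

(** The coefficient of F from x_S (x) x_T to x_S' (x) x_T': the subset C is moved
    along the crossbar. *)
Definition rung_coef (S T S' T' : bits) : R :=
  \sum_(C <- cube (size S)) merge_coef S' C S * merge_coef C T T'.

Lemma rung_coefE S T S' T' :
  rung_coef S T S' T' = \sum_(C <- cube (size S)) merge_coef S' C S * merge_coef C T T'.
Proof. by []. Qed.

(** The factor contributed by the first coordinate, whose values in S, T, S', T'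
    are b, c, b', c'; the integers s, t, s' are the numbers of elements of S, T,
    S' among the other coordinates. *)
Definition rung_bit (b c b' c' : bool) (s t s' : int) : R :=
  match b, c, b', c' with
  | false, false, false, false => 1
  | true, true, true, true => mon (s - s') 0
  | true, false, true, false => mon (s - s') (s - s')
  | false, true, false, true => mon 0 (s' - s)
  | true, false, false, true => mon t (t - s')
  | _, _, _, _ => 0
  end.

Lemma rung_coef_supp S T S' T' : rung_coef S T S' T' != 0 ->
  [/\ size S = size S', size T = size T', size S = size T,
      (ones S' <= ones S)%N & (ones S + ones T = ones S' + ones T')%N].
Proof.
move=> nz; have [C _ nzC] : exists2 C, C \in cube (size S) & merge_coef S' C S * merge_coef C T T' != 0.
  apply/hasP; apply: contraNT nz => /hasPn h; rewrite rung_coefE big_seq big1 // => C /h.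
  by rewrite negbK => /eqP.
move: nzC; rewrite mulf_eq0 => /norP[/merge_coef_supp[e1 e2 e3] /merge_coef_supp[e4 e5 e6]].
split; lia.
Qed.

(** C is forced to be the difference of S and S', hence the coefficient is a
    product over the coordinates, each of which is a rung for n = 1 up to sign
    and powers of a: this is skew Howe duality, in which the rungs generate the
    action of quantum gl_2 on a tensor product of n copies of the exterior
    algebra of C^2. *)
Lemma rung_coef_cons b c b' c' S T S' T' :
  rung_coef (b :: S) (c :: T) (b' :: S') (c' :: T') =
  rung_bit b c b' c' (ones S) (ones T) (ones S') * rung_coef S T S' T'.
Proof.
rewrite !rung_coefE /= big_cat !big_map /=.
have pt x : \sum_(C <- cube (size S))
     merge_bit th b' x b (ones S') (ones C) * merge_coef S' C S * (merge_bit th x c c' (ones C) (ones T) * merge_coef C T T')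
   = merge_bit th b' x b (ones S') ((ones S)%:Z - (ones S')%:Z)
     * merge_bit th x c c' ((ones S)%:Z - (ones S')%:Z) (ones T)
     * \sum_(C <- cube (size S)) merge_coef S' C S * merge_coef C T T'.
  apply: big_scale => C.
  have [->|nz] := eqVneq (merge_coef S' C S) 0; first by ring.
  have [_ _ ->] := merge_coef_supp nz.
  have -> : (ones S' + ones C)%N%:Z - (ones S')%:Z = (ones C)%:Z by lia.
  by ring.
rewrite !pt -mulrDl; congr (_ * _); rewrite /merge_bit /rung_bit.
by case: b {pt}; case: c; case: b'; case: c';
  rewrite /= ?(mul0r, mulr0, add0r, addr0, mul1r, mulr1, mon_mul) //; apply: mon_eq; lia.
Qed.

Lemma rung_coef_nil : rung_coef [::] [::] [::] [::] = 1.
Proof. by rewrite rung_coefE big_cube0 /= mulr1. Qed.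

(** A rung F can only move an element of S which is not in T. *)
Definition rung_ok (b c b' c' : bool) : bool :=
  if b == b' then c == c' else [&& b, ~~ c & c'].

Lemma rung_bit_neq0 b c b' c' s t s' : (rung_bit b c b' c' s t s' != 0) = rung_ok b c b' c'.
Proof.
by case: b; case: c; case: b'; case: c'; rewrite /= ?eqxx ?mon_neq0 ?oner_neq0.
Qed.

Lemma rung_coef_cons_neq0 b c b' c' S T S' T' :
  (rung_coef (b :: S) (c :: T) (b' :: S') (c' :: T') != 0) =
  rung_ok b c b' c' && (rung_coef S T S' T' != 0).
Proof. by rewrite rung_coef_cons mulf_eq0 negb_or rung_bit_neq0. Qed.

Lemma rung_coef_height S T S' T' : rung_coef S T S' T' != 0 -> height S + height T = height S' + height T'.
Proof.
elim: S T S' T' => [|b S IH] [|c T] [|b' S'] [|c' T'] // nz; have [] // := rung_coef_supp nz.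
move=> [e1] [e2] [e3] _ _.
move: nz; rewrite rung_coef_cons_neq0 => /andP[ok nz]; have e := IH _ _ _ nz.
have [_ _ _ _ e4] := rung_coef_supp nz.
by move: ok; rewrite /rung_ok /= -e1 -e2 e3; case: b; case: c; case: b'; case: c' => //=; lia.
Qed.

Lemma big_scale2 (I J : eqType) (r : seq I) (s : seq J) (G G' : I -> J -> R) k :
  (forall i j, i \in r -> j \in s -> G i j = k * G' i j) ->
  \sum_(i <- r) \sum_(j <- s) G i j = k * \sum_(i <- r) \sum_(j <- s) G' i j.
Proof.
move=> E; rewrite big_distrr; apply: eq_big_seq => i ri.
by rewrite big_distrr; apply: eq_big_seq => j sj; rewrite E.
Qed.

Lemma big_cube2S m (G : bits -> bits -> R) :
  \sum_(P <- cube m.+1) \sum_(Q <- cube m.+1) G P Q =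
  \sum_(p : bool) \sum_(q : bool)
    \sum_(P <- cube m) \sum_(Q <- cube m) G (p :: P) (q :: Q).
Proof.
rewrite big_cubeS !big_bool; congr (_ + _);
by rewrite -big_split; apply: eq_bigr => P _; rewrite big_cubeS.
Qed.

(** F^(r) after F^(s), where r is counted by the elements that leave the left
    strand in the second step. *)
Definition squash_sum (m : nat) (r : int) (S T S' T' : bits) : R :=
  \sum_(P <- cube m) \sum_(Q <- cube m)
    ((ones P)%:Z - (ones S')%:Z == r)%:R * (rung_coef S T P Q * rung_coef P Q S' T').

Lemma squash_cons m r b c b' c' S T S' T' :
  squash_sum m.+1 r (b :: S) (c :: T) (b' :: S') (c' :: T') =
  \sum_(p : bool) \sum_(q : bool)
    (let s1 := (ones S')%:Z + (r - p%:Z + b'%:Z) in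
     rung_bit b c p q (ones S) (ones T) s1 *
     rung_bit p q b' c' s1 ((ones S)%:Z + (ones T)%:Z - s1) (ones S')) *
    squash_sum m (r - p%:Z + b'%:Z) S T S' T'.
Proof.
rewrite /squash_sum big_cube2S; apply: eq_bigr => p _; apply: eq_bigr => q _.
apply: big_scale2 => P Q _ _; rewrite !ones_cons !rung_coef_cons.
have -> : ((p + ones P)%N%:Z - (b' + ones S')%N%:Z == r)
  = ((ones P)%:Z - (ones S')%:Z == r - p%:Z + b'%:Z).
  by apply/eqP/eqP; lia.
case: eqP => [<-|_]; last by rewrite !mul0r mulr0.
have [->|nz] := eqVneq (rung_coef S T P Q) 0; first by ring.
have [_ _ _ _ e] := rung_coef_supp nz.
rewrite [(ones S')%:Z + _]addrC subrK.
have -> : (ones S)%:Z + (ones T)%:Z - (ones P)%:Z = (ones Q)%:Z by lia.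
by ring.
Qed.

(** With integers as lower entries, the q-Pascal rule has no exception at 0. *)
Definition qbinz (m r : int) : R := if r is Posz k then qbin m k else 0.

Lemma qbinz_pascal (m r : int) :
  qbinz (m + 1) r = a ^ (2 * r) * qbinz m r + a ^ (2 * (r - 1 - m)) * qbinz m (r - 1).
Proof.
case: r => [[|k]|k].
- by rewrite /= !qbin0 mulr0 expr0z mulr0 addr0 mulr1.
- have -> : k.+1%:Z - 1 = k by lia.
  exact: qbin_pascal.
- have -> : Negz k - 1 = Negz k.+1 by lia.
  by rewrite /= !mulr0 addr0.
Qed.

Lemma qbinz_pascalV (m r : int) :
  qbinz (m + 1) r = a ^ (- 2 * r) * qbinz m r + a ^ (2 * (m - r + 1)) * qbinz m (r - 1).
Proof.
case: r => [[|k]|k].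
- by rewrite /= !qbin0 mulr0 expr0z mulr0 addr0 mulr1.
- have -> : k.+1%:Z - 1 = k by lia.
  have -> : m - k.+1%:Z + 1 = m - k%:Z by lia.
  exact: qbin_pascalV.
- have -> : Negz k - 1 = Negz k.+1 by lia.
  by rewrite /= !mulr0 addr0.
Qed.

(** Only a coordinate that moves has a choice: it moves in the first or in the
    second of the two rungs.  These are the two terms of the q-Pascal rule. *)
Lemma rung_squash m (r : int) S T S' T' :
  size S = m -> size T = m -> size S' = m -> size T' = m ->
  squash_sum m r S T S' T' = qbinz ((ones S)%:Z - (ones S')%:Z) r * rung_coef S T S' T'.
Proof.
elim: m r S T S' T' => [|m IH] r [|b S] [|c T] [|b' S'] [|c' T'] //.
  move=> *; rewrite /squash_sum !big_cube0 rung_coef_nil /= subrr !mulr1.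
  by case: r => [[|r]|r] /=; rewrite ?qbin0 ?qbin_small.
move=> [eS] [eT] [eS'] [eT'].
rewrite squash_cons rung_coef_cons.
under eq_bigr => p _ do under eq_bigr => q _ do rewrite IH //.
have [->|nz] := eqVneq (rung_coef S T S' T') 0.
  by rewrite !mulr0 big1 // => p _; rewrite big1 // => q _; rewrite !mulr0.
have [_ _ _ _ e] := rung_coef_supp nz.
rewrite [RHS]mulrA; move: (rung_coef S T S' T') => X.
under eq_bigr => p _ do under eq_bigr => q _ do rewrite mulrA.
rewrite !big_bool /= -!mulrDl; congr (_ * _); rewrite !ones_cons.
set d := (ones S)%:Z - (ones S')%:Z.
have -> : (b + ones S)%N%:Z - (b' + ones S')%N%:Z = d + b%:Z - b'%:Z by rewrite /d; lia.
case: b; case: c; case: b'; case: c' => /=; rewrite ?(mul0r, mulr0, add0r, addr0, subr0, addrK, subrK, mul1r, mulr1, mon_mul) //.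
- by rewrite mulrC; congr (_ * _); apply: mon_eq; lia.
- by rewrite mulrC; congr (_ * _); apply: mon_eq; lia.
- rewrite qbinz_pascalV mulrDl addrC -!monE ![mon _ _ * qbinz _ _]mulrC -!mulrA !mon_mul.
  by congr (_ * _ + _ * _); apply: mon_eq; lia.
- by rewrite mulrC; congr (_ * _); apply: mon_eq; lia.
Qed.

Arguments qbinz : simpl never.

(** E after F^(s).  The second factor has its arguments exchanged because the
    rung E is the transpose of F; the crossbar of E is determined by the
    ends. *)
Definition EF_sum (m : nat) (s : int) (S T S' T' : bits) : R :=
  \sum_(P <- cube m) \sum_(Q <- cube m)
    ((ones S)%:Z - (ones P)%:Z == s)%:R * (rung_coef S T P Q * rung_coef S' T' P Q).

(** F after E^(j), from x_S (x) x_T to x_S' (x) x_T'. *)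
Definition FE_sum (m : nat) (j : int) (S T S' T' : bits) : R :=
  \sum_(P <- cube m) \sum_(Q <- cube m)
    ((ones P)%:Z - (ones S)%:Z == j)%:R * (rung_coef P Q S T * rung_coef P Q S' T').

Lemma EF_sum0 m s S T S' T' :
  (ones S + ones T != ones S' + ones T')%N -> EF_sum m s S T S' T' = 0.
Proof.
move=> ne; rewrite /EF_sum big1 // => P _; rewrite big1 // => Q _.
have [->|/rung_coef_supp[_ _ _ _ e]] := eqVneq (rung_coef S T P Q) 0; first by ring.
have [->|/rung_coef_supp[_ _ _ _ e']] := eqVneq (rung_coef S' T' P Q) 0; first by ring.
by rewrite e e' eqxx in ne.
Qed.

Lemma FE_sum0 m s S T S' T' :
  (ones S + ones T != ones S' + ones T')%N -> FE_sum m s S T S' T' = 0.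
Proof.
move=> ne; rewrite /FE_sum big1 // => P _; rewrite big1 // => Q _.
have [->|/rung_coef_supp[_ _ _ _ e]] := eqVneq (rung_coef P Q S T) 0; first by ring.
have [->|/rung_coef_supp[_ _ _ _ e']] := eqVneq (rung_coef P Q S' T') 0; first by ring.
by rewrite -e -e' eqxx in ne.
Qed.

Lemma FE_sum_neg m j S T S' T' : j < 0 -> FE_sum m j S T S' T' = 0.
Proof.
move=> j0; rewrite /FE_sum big1 // => P _; rewrite big1 // => Q _.
have [->|/rung_coef_supp[_ _ _ le _]] := eqVneq (rung_coef P Q S T) 0; first by ring.
by case: eqP => [E|_]; [lia | rewrite mul0r].
Qed.

Lemma EF_cons m s b c b' c' S T S' T' :
  EF_sum m.+1 s (b :: S) (c :: T) (b' :: S') (c' :: T') =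
  \sum_(p : bool) \sum_(q : bool)
    (let k := (ones S)%:Z - (s - b%:Z + p%:Z) in
     rung_bit b c p q (ones S) (ones T) k * rung_bit b' c' p q (ones S') (ones T') k) *
    EF_sum m (s - b%:Z + p%:Z) S T S' T'.
Proof.
rewrite /EF_sum big_cube2S; apply: eq_bigr => p _; apply: eq_bigr => q _.
apply: big_scale2 => P Q _ _; rewrite !ones_cons !rung_coef_cons.
have -> : ((b + ones S)%N%:Z - (p + ones P)%N%:Z == s)
  = ((ones S)%:Z - (ones P)%:Z == s - b%:Z + p%:Z).
  by apply/eqP/eqP; lia.
case: eqP => [<-|_]; last by rewrite !mul0r mulr0.
have -> : (ones S)%:Z - ((ones S)%:Z - (ones P)%:Z) = ones P by lia.
by ring.
Qed.

Lemma FE_cons m j b c b' c' S T S' T' :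
  FE_sum m.+1 j (b :: S) (c :: T) (b' :: S') (c' :: T') =
  \sum_(p : bool) \sum_(q : bool)
    (let k := (ones S)%:Z + (j - p%:Z + b%:Z) in
     let l := (ones S)%:Z + (ones T)%:Z - k in
     rung_bit p q b c k l (ones S) * rung_bit p q b' c' k l (ones S')) *
    FE_sum m (j - p%:Z + b%:Z) S T S' T'.
Proof.
rewrite /FE_sum big_cube2S; apply: eq_bigr => p _; apply: eq_bigr => q _.
apply: big_scale2 => P Q _ _; rewrite !ones_cons !rung_coef_cons.
have -> : ((p + ones P)%N%:Z - (b + ones S)%N%:Z == j)
  = ((ones P)%:Z - (ones S)%:Z == j - p%:Z + b%:Z).
  by apply/eqP/eqP; lia.
case: eqP => [<-|_]; last by rewrite !mul0r mulr0.
have [->|nz] := eqVneq (rung_coef P Q S T) 0; first by ring.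
have [_ _ _ _ e] := rung_coef_supp nz.
have -> : (ones S)%:Z + ((ones P)%:Z - (ones S)%:Z) = ones P by lia.
have -> : (ones S)%:Z + (ones T)%:Z - (ones P)%:Z = (ones Q)%:Z by lia.
by ring.
Qed.

(** Only an element which is in S and S', and neither in T nor in T', has a
    choice: it stays, or it is moved to the right and back. *)
Lemma EF_cases m s b c b' c' S T S' T' :
  let: (s1, t1) := ((ones S)%:Z, (ones T)%:Z) in
  let: (s2, t2) := ((ones S')%:Z, (ones T')%:Z) in
  EF_sum m.+1 s (b :: S) (c :: T) (b' :: S') (c' :: T') =
  match b, c, b', c' with
  | false, false, false, false => EF_sum m s S T S' T'
  | true, true, true, true => mon (s2 - s1) 0 * EF_sum m s S T S' T'
  | true, false, true, false =>
      mon (s2 - s1) (s2 - s1 + 2 * s) * EF_sum m s S T S' T' +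
      mon (t1 + t2) (t1 + t2 - 2 * s1 + 2 * s - 2) * EF_sum m (s - 1) S T S' T'
  | false, true, false, true => mon 0 (s1 - s2 - 2 * s) * EF_sum m s S T S' T'
  | true, false, false, true => mon t1 (t1 - s2) * EF_sum m (s - 1) S T S' T'
  | false, true, true, false => mon t2 (t2 - s1) * EF_sum m s S T S' T'
  | _, _, _, _ => 0
  end.
Proof.
rewrite EF_cons !big_bool; case: b; case: c; case: b'; case: c'; rewrite /=
  ?(mul0r, mulr0, add0r, addr0, subr0, addrK, subrK, mul1r, mulr1, mon_mul) //;
by repeat (congr (_ + _) || congr (_ * _)); apply: mon_eq; lia.
Qed.

(** Only an element which is in T and T', and neither in S nor in S', has a
    choice: it stays, or it is moved to the left and back. *)
Lemma FE_cases m j b c b' c' S T S' T' :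
  let: (s1, t1) := ((ones S)%:Z, (ones T)%:Z) in
  let: (s2, t2) := ((ones S')%:Z, (ones T')%:Z) in
  FE_sum m.+1 j (b :: S) (c :: T) (b' :: S') (c' :: T') =
  match b, c, b', c' with
  | false, false, false, false => FE_sum m j S T S' T'
  | true, true, true, true => mon (s2 - s1) 0 * FE_sum m j S T S' T'
  | true, false, true, false => mon (s2 - s1) (s1 - s2 + 2 * j) * FE_sum m j S T S' T'
  | false, true, false, true =>
      mon 0 (s2 - s1 - 2 * j) * FE_sum m j S T S' T' +
      mon 0 (2 * (t1 - j + 1) - s1 - s2) * FE_sum m (j - 1) S T S' T'
  | true, false, false, true => mon t1 (t1 - s2) * FE_sum m j S T S' T'
  | false, true, true, false => mon (s1 + t1 - s2) (t1 - s2) * FE_sum m (j - 1) S T S' T'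
  | _, _, _, _ => 0
  end.
Proof.
rewrite FE_cons !big_bool; case: b; case: c; case: b'; case: c'; rewrite /=
  ?(mul0r, mulr0, add0r, addr0, subr0, addrK, subrK, mul1r, mulr1, mon_mul) //.
1-3: by congr (_ * _); apply: mon_eq; lia.
- by congr (_ * _); apply: mon_eq; lia.
- rewrite addrC; congr (_ * _ + _ * _); apply: mon_eq; lia.
Qed.

Lemma big_shift (N : nat) (g : int -> R) : g (-1) = 0 -> g (N%:Z - 1) = 0 ->
  \sum_(t < N) g (t%:Z - 1) = \sum_(t < N) g t%:Z.
Proof.
case: N => [|N] g0 gN; first by rewrite !big_ord0.
rewrite big_ord_recl big_ord_recr /= sub0r g0 add0r.
have -> : N%:Z = N.+1%:Z - 1 by lia.
by rewrite gN addr0; apply: eq_bigr => i _; congr g; rewrite /= /bump; lia.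
Qed.

(** Induction on the number of coordinates.  The exponent r of E is
    s + |S'| - |S|, and the upper entry k - l + r - s of the binomial is
    |S'| - |T|.  The first coordinate changes the upper entry by 1 exactly when
    it has a choice on one of the sides, which is compensated by the q-Pascal
    rule on the other side.  Any bound N on r can be taken for the number of
    terms, as E^(j) is 0 for negative j; the freedom is needed since r changes
    in the induction. *)
Lemma rung_swap m (N : nat) s S T S' T' :
  size S = m -> size T = m -> size S' = m -> size T' = m ->
  s + (ones S')%:Z - (ones S)%:Z < N ->
  EF_sum m s S T S' T' =
  \sum_(t < N) qbinz ((ones S')%:Z - (ones T)%:Z) t *
    FE_sum m (s + (ones S')%:Z - (ones S)%:Z - t%:Z) S T S' T'.
Proof.
elim: m s S T S' T' => [|m IH] s [|b S] [|c T] [|b' S'] [|c' T'] //.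
  move=> _ _ _ _; rewrite /EF_sum /FE_sum !big_cube0 rung_coef_nil -[ones [::]]/0%N subrr addrK !mulr1.
  case: N => [|N] sN; first by rewrite big_ord0; case: eqP => // s0; lia.
  under eq_bigr => t _ do rewrite !big_cube0.
  rewrite big_ord_recl big1 => [|t _]; last by rewrite /qbinz /= qbin_small // mul0r.
  by rewrite rung_coef_nil /qbinz /= qbin0 mul1r addr0 !mulr1 -[ones [::]]/0%N !subr0.
move=> [eS] [eT] [eS'] [eT'].
have [e|ne] := eqVneq (ones S + ones T)%N (ones S' + ones T')%N; last first.
  rewrite EF_cons; under [RHS]eq_bigr => t _ do rewrite FE_cons.
  rewrite big1 => [|p _]; last by rewrite big1 // => q _; rewrite EF_sum0 ?mulr0.
  rewrite big1 // => t _; rewrite big1 ?mulr0 // => p _.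
  by rewrite big1 // => q _; rewrite FE_sum0 ?mulr0.
have eo : (ones T')%:Z = (ones S)%:Z + (ones T)%:Z - (ones S')%:Z by lia.
rewrite !ones_cons (EF_cases m s b c b' c') => sN.
under [RHS]eq_bigr => t _ do rewrite (FE_cases m _ b c b' c').
set mm := (ones S')%:Z - (ones T)%:Z; set r := s + (ones S')%:Z - (ones S)%:Z.
have zero (G : 'I_N -> int) : 0 = \sum_(t < N) qbinz (G t) t * 0 :> R.
  by rewrite big1 // => t _; rewrite mulr0.
move: sN; case: b; case: c; case: b'; case: c' => sN //.
- rewrite IH //; last by lia.
  rewrite big_distrr /=; apply: eq_bigr => t _; rewrite mulrCA.
  by congr (qbinz _ _ * (_ * FE_sum _ _ _ _ _ _)); rewrite ?/mm ?/r; lia.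
- rewrite IH // -/mm -/r; last by lia.
  rewrite IH // -/mm; last by lia.
  have -> : s - 1 + (ones S')%:Z - (ones S)%:Z = r - 1 by rewrite /r; lia.
  have -> : (true + ones S')%N%:Z - (false + ones T)%N%:Z = mm + 1 by rewrite /mm; lia.
  have -> : s + (true + ones S')%N%:Z - (true + ones S)%N%:Z = r by rewrite /r; lia.
  under [RHS]eq_bigr => t _ do rewrite qbinz_pascal mulrDl.
  rewrite big_split /= !big_distrr /=; congr (_ + _).
    apply: eq_bigr => t _; rewrite -monE [mon 0 _ * qbinz _ _]mulrC -mulrA.
    rewrite [mon 0 _ * (mon _ _ * _)]mulrA mulrCA mon_mul.
    by congr (_ * (_ * _)); apply: mon_eq; rewrite /r; lia.
  rewrite -(big_shift (g := fun t => mon _ _ * (qbinz mm t * FE_sum m (r - 1 - t) S T S' T'))).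
  + apply: eq_bigr => t _.
    have -> : r - 1 - (t%:Z - 1) = r - t%:Z by lia.
    rewrite -monE [mon 0 _ * qbinz _ _]mulrC -mulrA.
    rewrite [mon 0 _ * (mon _ _ * _)]mulrA mulrCA mon_mul.
    by congr (_ * (_ * _)); apply: mon_eq; rewrite /r /mm; lia.
  + by rewrite mul0r mulr0.
  + by rewrite FE_sum_neg ?mulr0 //; lia.
- rewrite IH // -/mm; last by lia.
  rewrite big_distrr /=; apply: eq_bigr => t _; rewrite mulrCA.
  by congr (qbinz _ _ * (_ * FE_sum _ _ _ _ _ _)); rewrite ?/mm ?/r; lia.
- rewrite IH // -/mm; last by lia.
  rewrite big_distrr /=; apply: eq_bigr => t _; rewrite mulrCA.
  congr (qbinz _ _ * (_ * FE_sum _ _ _ _ _ _)); rewrite ?/mm ?/r; try lia.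
  by apply: mon_eq; lia.
- rewrite IH // -/mm.
  have -> : (false + ones S')%N%:Z - (true + ones T)%N%:Z = mm - 1 by rewrite /mm; lia.
  have -> : s + (false + ones S')%N%:Z - (false + ones S)%N%:Z = r by rewrite /r; lia.
  under [RHS]eq_bigr => t _ do rewrite mulrDr.
  rewrite big_split /= -(big_shift (g := fun t => qbinz (mm - 1) t *
    (mon 0 (2 * ((ones T)%:Z - (r - t) + 1) - (ones S)%:Z - (ones S')%:Z) *
      FE_sum m (r - t - 1) S T S' T'))).
  + rewrite -big_split big_distrr /=; apply: eq_bigr => t _.
    have -> : r - (t%:Z - 1) - 1 = r - t%:Z by lia.
    rewrite -{1}[mm](subrK 1) qbinz_pascal -!monE !mulrA -mulrDl; congr (_ * _).
    rewrite mulrDr ![qbinz _ _ * _]mulrC !mulrA !mon_mul.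
    by congr (_ * _ + _ * _); apply: mon_eq; rewrite /r /mm; lia.
  + by rewrite mul0r.
  + by rewrite FE_sum_neg ?mulr0 //; lia.
- by rewrite IH.
Qed.

End Rungs.

(** * States of an object *)

Section States.

Variable n : nat.

Definition slice (k : int) : seq bits := [seq T <- cube n | (ones T)%:Z == k].

Fixpoint states (w : obj) : seq (seq bits) :=
  if w is x :: w' then [seq T :: i | T <- slice x.2, i <- states w'] else [:: [::]].

Lemma mem_slice k S : (S \in slice k) = (size S == n) && ((ones S)%:Z == k).
Proof. by rewrite mem_filter mem_cube andbC. Qed.

Lemma slice_uniq k : uniq (slice k).
Proof. exact/filter_uniq/cube_uniq. Qed.

Lemma mem_states_cons x w i : (i \in states (x :: w)) =
  if i is T :: i' then (T \in slice x.2) && (i' \in states w) else false.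
Proof.
apply/allpairsP/idP => [[[S j] [hS hj ->]]|]; first by apply/andP.
by case: i => // S i /andP[hS hi]; exists (S, i).
Qed.

Lemma mem_states0 i : (i \in states [::]) = (i == [::]).
Proof. by rewrite inE. Qed.

Lemma states_uniq w : uniq (states w).
Proof.
elim: w => // x w IH; apply: allpairs_uniq => //; first exact: slice_uniq.
by move=> [S i] [T j] _ _ [-> ->].
Qed.

Lemma size_states w i : i \in states w -> size i = size w.
Proof.
elim: w i => [|x w IH] i; first by rewrite mem_states0 => /eqP ->.
by rewrite mem_states_cons; case: i => // S i /andP[_ /IH] /= ->.
Qed.

Lemma mem_states_cat w w' i j : size i = size w ->
  (i ++ j \in states (w ++ w')) = (i \in states w) && (j \in states w').
Proof.
elim: w i => [|x w IH] [|S i] // [e].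
by rewrite !cat_cons !mem_states_cons IH // andbA.
Qed.

Variant split_states_spec w w' : seq bits -> Prop :=
  SplitStates i j of i \in states w & j \in states w' : split_states_spec w w' (i ++ j).

Lemma split_states w w' i : i \in states (w ++ w') -> split_states_spec w w' i.
Proof.
move=> h; have sz := size_states h.
move: (h); rewrite -{1}(cat_take_drop (size w) i) mem_states_cat; last first.
  by rewrite size_take sz size_cat; case: ltnP => //; lia.
by move=> /andP[hi hj]; rewrite -(cat_take_drop (size w) i); constructor.
Qed.

End States.

Arguments states : simpl never.
Arguments slice : simpl never.

Lemma big_states1 (R : nmodType) n x w (G : seq bits -> R) :
  \sum_(i <- states n (x :: w)) G i =
  \sum_(S <- slice n x.2) \sum_(i <- states n w) G (S :: i).
Proof. exact: big_allpairs_dep. Qed.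

Lemma big_states0 (R : nmodType) n (G : seq bits -> R) :
  \sum_(i <- states n [::]) G i = G [::].
Proof. exact: big_seq1. Qed.

Lemma big_states_cat (R : nmodType) n w w' (G : seq bits -> R) :
  \sum_(i <- states n (w ++ w')) G i =
  \sum_(i <- states n w) \sum_(j <- states n w') G (i ++ j).
Proof.
elim: w G => [|x w IH] G; first by rewrite big_states0.
by rewrite !big_states1; apply: eq_bigr => S _; rewrite IH.
Qed.

Lemma big_delta (R : pzSemiRingType) (I : eqType) (s : seq I) (i : I) (G : I -> R) :
  uniq s -> i \in s -> \sum_(j <- s) (i == j)%:R * G j = G i.
Proof.
move=> us si; rewrite (bigD1_seq i) //= eqxx mul1r big1 ?addr0 // => j /negPf ne.
by rewrite eq_sym ne mul0r.
Qed.

(** * Evaluation of webs *)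

Section Evaluation.

Variables (R : realFieldType) (th : param R) (n : nat).
Local Notation a := (sqrt_q th).
Notation merge_coef := (merge_coef th).
Notation states := (states n).
Notation slice := (slice n).

(** Closing a strand k to the right applies a cup and a cap, and has to weight
    x_S by q^height(S).  Half of this is put on each of them, in order that they
    are transposes; straightening a strand forces the inverse for the opposite
    orientation. *)
Definition cap_coef (x : strand) (S : bits) : R := if x.1 then a ^ height S else a ^ (- height S).

(** An n-edge would carry the one-dimensional top exterior power, so a tag is a
    merge into the full subset. *)
Definition vertex_coef (v : vertex) (i j : seq bits) : R :=
  match v, i, j with
  | Merge _ _, [:: T; V], [:: U] => merge_coef T V U
  | Defs.Split _ _, [:: U], [:: T; V] => merge_coef T V U
  | TagIn _ _, [:: T; V], [::] => merge_coef T V (nseq n true)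
  | TagOut _ _, [::], [:: T; V] => merge_coef T V (nseq n true)
  | _, _, _ => 0
  end.

(** Sums over the states of the middle object only make sense when the ends
    agree; the explicit tests make transposition hold for all terms. *)
Fixpoint ev (t : term) (i j : seq bits) : R :=
  match t with
  | Id _ => (i == j)%:R
  | Vert v => vertex_coef v i j
  | Cap x => match i, j with
             | [:: T; V], [::] => (T == V)%:R * cap_coef x T
             | _, _ => 0
             end
  | Cup x => match i, j with
             | [::], [:: T; V] => (T == V)%:R * cap_coef x T
             | _, _ => 0
             end
  | Comp u t => if cod t == dom u
                then \sum_(k <- states (cod t)) ev t i k * ev u k j else 0
  | Tens t u => ev t (take (size (dom t)) i) (take (size (cod t)) j)
                * ev u (drop (size (dom t)) i) (drop (size (cod t)) j)
  | Zero _ _ => 0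
  | Add t u => ev t i j +
               (if (dom t == dom u) && (cod t == cod u) then ev u i j else 0)
  | Scale c t => qeval th c * ev t i j
  end.

Lemma ev_comp t u i j : cod t = dom u ->
  ev (Comp u t) i j = \sum_(k <- states (cod t)) ev t i k * ev u k j.
Proof. by move=> /= ->; rewrite eqxx. Qed.

Lemma ev_tens t u i j i' j' : size i = size (dom t) -> size j = size (cod t) ->
  ev (Tens t u) (i ++ i') (j ++ j') = ev t i j * ev u i' j'.
Proof. by move=> /= <- <-; rewrite !take_size_cat ?drop_size_cat. Qed.

Arguments ev_tens {t u i j i' j'}.

Record same_ev (w z : obj) (t u : term) : Prop := SameEv {
  same_dom1 : dom t = w;
  same_cod1 : cod t = z;
  same_dom2 : dom u = w;
  same_cod2 : cod u = z;
  same_evE : forall i j, i \in states w -> j \in states z -> ev t i j = ev u i j }.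

Lemma is_homP w z t : is_hom n w z t -> dom t = w /\ cod t = z.
Proof. by case/and3P => _ /eqP -> /eqP ->. Qed.

Lemma dom_bar t : dom (bar t) = cod t.
Proof.
by elim: t => [w|[k l|k l|k l|k l]|x|x|u IHu t IHt|t IHt u IHu|w z|t IHt u IHu|c t IHt] //=; congruence.
Qed.

Lemma cod_bar t : cod (bar t) = dom t.
Proof.
by elim: t => [w|[k l|k l|k l|k l]|x|x|u IHu t IHt|t IHt u IHu|w z|t IHt u IHu|c t IHt] //=; congruence.
Qed.

(** Holds on the generators by the choice of the normalisation, which is the
    purpose of the square root of q. *)
Lemma ev_bar t i j : ev (bar t) j i = ev t i j.
Proof.
elim: t i j => [w|v|x|x|u IHu t IHt|t IHt u IHu|w z|t IHt u IHu|c t IHt] i j //=.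
- by rewrite eq_sym.
- by case: v => k l; case: i => [|S [|T []]]; case: j => [|U [|V []]].
- by case: i => [|S [|T []]]; case: j => [|U [|V []]].
- by case: i => [|S [|T []]]; case: j => [|U [|V []]].
- rewrite dom_bar cod_bar eq_sym; case: eqP => // ->.
  by apply: eq_bigr => k _; rewrite IHt IHu mulrC.
- by rewrite !dom_bar !cod_bar IHt IHu.
- by rewrite !dom_bar !cod_bar IHt IHu andbC.
- by rewrite IHt.
Qed.

Definition flip_state (i : seq bits) : seq bits := rev (map rev i).

Lemma flip_stateK : involutive flip_state.
Proof.
by move=> i; rewrite /flip_state map_rev revK -map_comp map_id_in // => S _ /=; rewrite revK.
Qed.

Lemma mem_flip_state w i : (flip_state i \in states (rev w)) = (i \in states w).
Proof.
elim: w i => [|x w IH] i.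
  by rewrite !mem_states0 /flip_state -!size_eq0 size_rev size_map.
case: i => [|S i]; rewrite !mem_states_cons.
  by apply/negP => /size_states; rewrite size_rev.
rewrite rev_cons /flip_state map_cons rev_cons -/(flip_state i) -!cats1.
have slS : (rev S \in slice x.2) = (S \in slice x.2).
  by rewrite !mem_slice size_rev /ones count_rev.
have [e|ne] := eqVneq (size i) (size w).
  rewrite mem_states_cat ?size_rev ?size_map // IH andbC mem_states_cons slS.
  by rewrite mem_states0 andbT.
transitivity false.
  by apply: contra_neqF ne => /size_states; rewrite !size_cat !size_rev size_map !addn1 => -[].
by apply/esym; apply: contra_neqF ne => /andP[_ /size_states].
Qed.

Lemma big_flip_state w (G : seq bits -> R) :
  \sum_(i <- states (rev w)) G i = \sum_(i <- states w) G (flip_state i).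
Proof.
rewrite -(big_map flip_state xpredT G); apply: perm_big; apply: uniq_perm.
- exact: states_uniq.
- rewrite map_inj_uniq ?states_uniq //; exact: inv_inj flip_stateK.
by move=> i; rewrite -[i]flip_stateK mem_flip_state (mem_map (inv_inj flip_stateK)).
Qed.

Lemma flipK x : flip (flip x) = x.
Proof. by case: x => o k; rewrite /flip /= negbK. Qed.

Lemma dom_mirror t : dom (mirror t) = rev (dom t).
Proof.
elim: t => [w|[k l|k l|k l|k l]|x|x|u IHu t IHt|t IHt u IHu|w z|t IHt u IHu|c t IHt] //=; rewrite ?flipK ?rev_cat //.
- by rewrite addrC.
- by rewrite IHt IHu.
Qed.

Lemma cod_mirror t : cod (mirror t) = rev (cod t).
Proof.
elim: t => [w|[k l|k l|k l|k l]|x|x|u IHu t IHt|t IHt u IHu|w z|t IHt u IHu|c t IHt] //=; rewrite ?flipK ?rev_cat //.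
- by rewrite addrC.
- by rewrite IHt IHu.
Qed.

Lemma flip_state_cat i j : flip_state (i ++ j) = flip_state j ++ flip_state i.
Proof. by rewrite /flip_state map_cat rev_cat. Qed.

Lemma size_flip_state i : size (flip_state i) = size i.
Proof. by rewrite size_rev size_map. Qed.

Lemma slice_size k S : S \in slice k -> size S = n.
Proof. by rewrite mem_slice => /andP[/eqP]. Qed.

Lemma cap_coef_flip x S : cap_coef (flip x) (rev S) = cap_coef x S.
Proof. by rewrite /cap_coef /flip /= height_rev; case: x.1 => //=; rewrite opprK. Qed.

Lemma flip_state1 T : flip_state [:: T] = [:: rev T].
Proof. by []. Qed.

Lemma flip_state2 T V : flip_state [:: T; V] = [:: rev V; rev T].
Proof. by []. Qed.

Lemma states1P x i : i \in states [:: x] -> exists2 T, T \in slice x.2 & i = [:: T].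
Proof.
rewrite mem_states_cons; case: i => // T i /andP[h]; rewrite mem_states0 => /eqP ->.
by exists T.
Qed.

Lemma states2P x y i : i \in states [:: x; y] ->
  exists T V, [/\ T \in slice x.2, V \in slice y.2 & i = [:: T; V]].
Proof.
rewrite mem_states_cons; case: i => // T i /andP[h] /states1P[V hV ->].
by exists T, V.
Qed.

(** A reflection exchanges the factors of a merge, and l(S,T) is unchanged when
    the factors are exchanged and the order of {1, ..., n} is reversed; the
    reversal negates the height, which matches the opposite orientation of the
    reflected caps. *)
Lemma ev_mirror t i j : i \in states (dom t) -> j \in states (cod t) ->
  ev (mirror t) (flip_state i) (flip_state j) = ev t i j.
Proof.
elim: t i j => [w|v|x|x|u IHu t IHt|t IHt u IHu|w z|t IHt u IHu|c t IHt] i j.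
- by move=> _ _; rewrite /= (inj_eq (inv_inj flip_stateK)).
- have fullE : nseq n true = rev (nseq n true) by rewrite rev_nseq.
  case: v => k l /=.
  + move=> /states2P[T [V [/slice_size sT /slice_size sV ->]]] /states1P[U /slice_size sU ->].
    by rewrite flip_state1 flip_state2 merge_coef_rev // sU.
  + move=> /states1P[U /slice_size sU ->] /states2P[T [V [/slice_size sT /slice_size sV ->]]].
    by rewrite flip_state1 flip_state2 merge_coef_rev // sU.
  + move=> /states2P[T [V [/slice_size sT /slice_size sV ->]]]; rewrite mem_states0 => /eqP ->.
    by rewrite flip_state2 {1}fullE merge_coef_rev // size_nseq.
  + rewrite mem_states0 => /eqP -> /states2P[T [V [/slice_size sT /slice_size sV ->]]].
    by rewrite flip_state2 {1}fullE merge_coef_rev // size_nseq.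
- move=> /states2P[T [V [_ _ ->]]]; rewrite mem_states0 => /eqP ->.
  rewrite flip_state2 /= cap_coef_flip eq_sym (inj_eq (can_inj revK)) eq_sym.
  by case: eqP => [->|_]; rewrite ?mul0r.
- rewrite mem_states0 => /eqP -> /states2P[T [V [_ _ ->]]].
  rewrite flip_state2 /= cap_coef_flip eq_sym (inj_eq (can_inj revK)) eq_sym.
  by case: eqP => [->|_]; rewrite ?mul0r.
- move=> hi hj; have [e|ne] := eqVneq (cod t) (dom u); last first.
    by rewrite /= cod_mirror dom_mirror (inj_eq (can_inj revK)) (negPf ne).
  rewrite ev_comp // [mirror _]/= ev_comp; last by rewrite cod_mirror dom_mirror e.
  rewrite cod_mirror big_flip_state; apply: eq_big_seq => k hk.
  by rewrite IHt // IHu // -e.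
- rewrite [dom _]/= [cod _]/= => /split_states[i1 i2 hi1 hi2] /split_states[j1 j2 hj1 hj2].
  rewrite ev_tens ?(size_states hi1) ?(size_states hj1) //.
  rewrite !flip_state_cat [mirror _]/= ev_tens ?IHt ?IHu 1?mulrC //.
    by rewrite size_flip_state dom_mirror size_rev (size_states hi2).
  by rewrite size_flip_state cod_mirror size_rev (size_states hj2).
- by [].
- move=> hi hj /=; rewrite IHt // !dom_mirror !cod_mirror !(inj_eq (can_inj revK)).
  by case: andP => // -[/eqP ed /eqP ec]; rewrite IHu // -?ed -?ec.
- by move=> hi hj /=; rewrite IHt.
Qed.

(** * The congruence generated by isotopy *)

Lemma ev_id w i j : ev (Id w) i j = (i == j)%:R.
Proof. by []. Qed.

Lemma ev_zero w z i j : ev (Zero w z) i j = 0.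
Proof. by []. Qed.

Lemma ev_cap x T V : ev (Cap x) [:: T; V] [::] = (T == V)%:R * cap_coef x T.
Proof. by []. Qed.

Lemma ev_cup x T V : ev (Cup x) [::] [:: T; V] = (T == V)%:R * cap_coef x T.
Proof. by []. Qed.

Lemma ev_tens_zerol w z t i j : ev (Tens (Zero w z) t) i j = 0.
Proof. exact: mul0r. Qed.

Lemma ev_tens_zeror w z t i j : ev (Tens t (Zero w z)) i j = 0.
Proof. exact: mulr0. Qed.

Lemma ev_scale c t i j : ev (Scale c t) i j = qeval th c * ev t i j.
Proof. by []. Qed.

Lemma ev_add t u i j : dom t = dom u -> cod t = cod u ->
  ev (Add t u) i j = ev t i j + ev u i j.
Proof. by move=> /= -> ->; rewrite !eqxx. Qed.

Arguments ev : simpl never.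

Lemma same_refl w z t : is_hom n w z t -> same_ev w z t t.
Proof. by move=> /is_homP[]. Qed.

Lemma same_sym w z t u : same_ev w z t u -> same_ev w z u t.
Proof. by case=> *; split => // i j hi hj; apply/esym; auto. Qed.

Lemma same_trans w z t u v : same_ev w z t u -> same_ev w z u v -> same_ev w z t v.
Proof.
by move=> [d1 c1 _ _ e1] [_ _ d2 c2 e2]; split => // i j hi hj; rewrite e1 // e2.
Qed.

Lemma same_comp w x z t t' u u' : same_ev w x t t' -> same_ev x z u u' ->
  same_ev w z (Comp u t) (Comp u' t').
Proof.
move=> [d1 c1 d2 c2 e1] [d3 c3 d4 c4 e2]; split => // i j hi hj.
rewrite !ev_comp ?c1 ?c2 //; apply: eq_big_seq => k hk; by rewrite e1 // e2.
Qed.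

Lemma same_tens w z t t' w' z' u u' : same_ev w z t t' -> same_ev w' z' u u' ->
  same_ev (w ++ w') (z ++ z') (Tens t u) (Tens t' u').
Proof.
move=> [d1 c1 d2 c2 e1] [d3 c3 d4 c4 e2]; split; rewrite /= ?d1 ?c1 ?d2 ?c2 ?d3 ?c3 ?d4 ?c4 //.
move=> i j /split_states[i1 i2 hi1 hi2] /split_states[j1 j2 hj1 hj2].
by rewrite !ev_tens ?e1 ?e2 ?d1 ?c1 ?d2 ?c2 ?(size_states hi1) ?(size_states hj1).
Qed.

Lemma same_compA w x y z t u v : is_hom n w x t -> is_hom n x y u -> is_hom n y z v ->
  same_ev w z (Comp v (Comp u t)) (Comp (Comp v u) t).
Proof.
move=> /is_homP[d1 c1] /is_homP[d2 c2] /is_homP[d3 c3]; split => // i j hi hj.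
rewrite ev_comp /= ?c2 // [RHS]ev_comp /= ?c1 ?d2 //.
under eq_bigr => k _ do rewrite ev_comp ?c1 ?d2 // big_distrl /=.
rewrite exchange_big; apply: eq_bigr => k _ /=.
rewrite ev_comp ?c2 ?d3 // big_distrr /=; apply: eq_bigr => l _; by rewrite mulrA.
Qed.

Lemma same_interchange w x z t u w' x' z' t' u' :
  is_hom n w x t -> is_hom n x z u -> is_hom n w' x' t' -> is_hom n x' z' u' ->
  same_ev (w ++ w') (z ++ z')
    (Comp (Tens u u') (Tens t t')) (Tens (Comp u t) (Comp u' t')).
Proof.
move=> /is_homP[d1 c1] /is_homP[d2 c2] /is_homP[d3 c3] /is_homP[d4 c4].
split; rewrite /= ?d1 ?c2 ?d3 ?c4 //.
move=> i j /split_states[i1 i2 hi1 hi2] /split_states[j1 j2 hj1 hj2].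
rewrite ev_comp /= ?c1 ?c3 ?d2 ?d4 //.
rewrite ev_tens /= ?d1 ?c2 ?(size_states hi1) ?(size_states hj1) //.
rewrite !ev_comp ?c1 ?d2 ?c3 ?d4 //.
rewrite big_states_cat big_distrl /=; apply: eq_big_seq => k1 hk1.
rewrite big_distrr /=; apply: eq_big_seq => k2 hk2.
rewrite !ev_tens ?d1 ?c1 ?d2 ?c2 ?(size_states hi1) ?(size_states hj1) ?(size_states hk1) //.
by ring.
Qed.

Lemma same_tensA w z t w' z' u w'' z'' v :
  is_hom n w z t -> is_hom n w' z' u -> is_hom n w'' z'' v ->
  same_ev (w ++ w' ++ w'') (z ++ z' ++ z'')
    (Tens t (Tens u v)) (Tens (Tens t u) v).
Proof.
move=> /is_homP[d1 c1] /is_homP[d2 c2] /is_homP[d3 c3].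
split; rewrite /= ?d1 ?c1 ?d2 ?c2 ?d3 ?c3 ?catA //.
move=> i j; rewrite -!catA.
move=> /split_states[i1 _ hi1 /split_states[i2 i3 hi2 hi3]].
move=> /split_states[j1 _ hj1 /split_states[j2 j3 hj2 hj3]].
have [si1 si2] := (size_states hi1, size_states hi2).
have [sj1 sj2] := (size_states hj1, size_states hj2).
rewrite ev_tens ?d1 ?c1 // ev_tens ?d2 ?c2 //.
rewrite [in RHS]catA [j1 ++ _]catA ev_tens /= ?d1 ?d2 ?c1 ?c2 ?size_cat ?si1 ?si2 ?sj1 ?sj2 //.
by rewrite ev_tens ?d1 ?c1 // mulrA.
Qed.

Lemma same_compl w z t : is_hom n w z t -> same_ev w z (Comp (Id z) t) t.
Proof.
move=> /is_homP[d c]; split => // i j hi hj; rewrite ev_comp c //.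
under eq_bigr => k _ do rewrite ev_id mulrC eq_sym.
by rewrite big_delta // states_uniq.
Qed.

Lemma same_compr w z t : is_hom n w z t -> same_ev w z (Comp t (Id w)) t.
Proof.
move=> /is_homP[d c]; split => // i j hi hj; rewrite ev_comp //=.
under eq_bigr => k _ do rewrite ev_id.
by rewrite big_delta // states_uniq.
Qed.

Lemma same_tensl w z t : is_hom n w z t -> same_ev w z (Tens (Id [::]) t) t.
Proof.
move=> /is_homP[d c]; split => // i j hi hj.
by rewrite -[i]cat0s -[j]cat0s ev_tens // ev_id mul1r.
Qed.

Lemma same_tensr w z t : is_hom n w z t -> same_ev w z (Tens t (Id [::])) t.
Proof.
move=> /is_homP[d c]; split => //=; rewrite ?d ?c ?cats0 // => i j hi hj.
rewrite -[i]cats0 -[j]cats0 ev_tens ?d ?c ?(size_states hi) ?(size_states hj) //.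
by rewrite ev_id mulr1 !cats0.
Qed.

Lemma same_tens_id w w' :
  same_ev (w ++ w') (w ++ w') (Tens (Id w) (Id w')) (Id (w ++ w')).
Proof.
split => //= i j /split_states[i1 i2 hi1 hi2] /split_states[j1 j2 hj1 hj2].
rewrite ev_tens /= ?(size_states hi1) ?(size_states hj1) // !ev_id.
by rewrite eqseq_cat ?(size_states hi1) ?(size_states hj1) // -natrM mulnb.
Qed.

Lemma cap_coef_flip_mul x T : cap_coef x T * cap_coef (flip x) T = 1.
Proof.
by rewrite /cap_coef /flip /=; case: x.1 => /=; rewrite -aD ?subrr ?addNr expr0z.
Qed.

Lemma same_zigzag_right x :
  same_ev [:: x] [:: x]
    (Comp (Tens (Id [:: x]) (Cap (flip x))) (Tens (Cup x) (Id [:: x])))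
    (Id [:: x]).
Proof.
split => // _ _ /states1P[T hT ->] /states1P[V hV ->].
rewrite ev_comp /= ?flipK // !big_states1.
transitivity (\sum_(A <- slice x.2) (V == A)%:R * \sum_(B <- slice x.2) (A == B)%:R *
  \sum_(C <- slice x.2) (T == C)%:R * ((C == B)%:R * (cap_coef x A * cap_coef (flip x) B))).
  apply: eq_bigr => A _; rewrite big_states1 big_distrr; apply: eq_bigr => B _.
  rewrite big_states1 !big_distrr; apply: eq_bigr => C _; rewrite big_states0.
  rewrite (ev_tens (i := [::]) (j := [:: A; B]) (i' := [:: T]) (j' := [:: C])) //.
  rewrite (ev_tens (i := [:: A]) (j := [:: V]) (i' := [:: B; C]) (j' := [::])) //.
  rewrite !ev_id !eqseq_cons !andbT /ev /= [V == A]eq_sym [C == B]eq_sym.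
  by ring.
rewrite big_delta ?slice_uniq // big_delta ?slice_uniq // big_delta ?slice_uniq //.
by rewrite cap_coef_flip_mul mulr1 ev_id eqseq_cons andbT.
Qed.

Lemma same_zigzag_left x :
  same_ev [:: x] [:: x]
    (Comp (Tens (Cap x) (Id [:: x])) (Tens (Id [:: x]) (Cup (flip x))))
    (Id [:: x]).
Proof.
split => // _ _ /states1P[T hT ->] /states1P[V hV ->].
rewrite ev_comp /= ?flipK // !big_states1.
transitivity (\sum_(A <- slice x.2) (T == A)%:R * \sum_(B <- slice x.2) (A == B)%:R *
  \sum_(C <- slice x.2) (B == C)%:R * ((V == C)%:R * (cap_coef x A * cap_coef (flip x) B))).
  apply: eq_bigr => A _; rewrite big_states1 big_distrr; apply: eq_bigr => B _.
  rewrite big_states1 !big_distrr; apply: eq_bigr => C _; rewrite big_states0.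
  rewrite (ev_tens (i := [:: T]) (j := [:: A]) (i' := [::]) (j' := [:: B; C])) //.
  rewrite (ev_tens (i := [:: A; B]) (j := [::]) (i' := [:: C]) (j' := [:: V])) //.
  rewrite !ev_id !eqseq_cons !andbT /ev /= [V == C]eq_sym.
  by ring.
rewrite big_delta ?slice_uniq // big_delta ?slice_uniq // big_delta ?slice_uniq //.
by rewrite cap_coef_flip_mul mulr1 ev_id eqseq_cons andbT eq_sym.
Qed.

(** * Rotation *)

Fixpoint caps_coef (w : obj) (i : seq bits) : R :=
  match w, i with
  | x :: w', T :: i' => cap_coef x T * caps_coef w' i'
  | _, _ => 1
  end.

Lemma caps_coef_cat w w' i j : size i = size w -> caps_coef (w ++ w') (i ++ j) = caps_coef w i * caps_coef w' j.
Proof.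
elim: w i => [|x w IH] [|T i] //=; rewrite ?mul1r // => -[e].
by rewrite IH // mulrA.
Qed.

Lemma dual_obj_cons x w : dual_obj (x :: w) = dual_obj w ++ [:: flip x].
Proof. by rewrite /dual_obj map_cons rev_cons cats1. Qed.

Lemma dual_objK w : dual_obj (dual_obj w) = w.
Proof.
rewrite /dual_obj map_rev revK -map_comp map_id_in // => x _ /=; exact: flipK.
Qed.

Lemma size_dual_obj w : size (dual_obj w) = size w.
Proof. by rewrite size_rev size_map. Qed.

Lemma mem_states_dual w i : (rev i \in states (dual_obj w)) = (i \in states w).
Proof.
have [e|ne] := eqVneq (size i) (size w); last first.
  have -> : (rev i \in states (dual_obj w)) = false.
    by apply: contra_neqF ne => /size_states; rewrite size_rev size_dual_obj.
  by apply/esym; apply: contra_neqF ne => /size_states.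
elim: w i e => [|x w IH] [|T i] // [e].
rewrite dual_obj_cons rev_cons -cats1 mem_states_cat ?size_dual_obj ?size_rev // IH //.
by rewrite !mem_states_cons mem_states0 andbT andbC.
Qed.

Lemma caps_coef_dual w i : size i = size w -> caps_coef (dual_obj w) (rev i) * caps_coef w i = 1.
Proof.
elim: w i => [|x w IH] [|T i] //=; first by rewrite mul1r.
move=> [e]; rewrite dual_obj_cons rev_cons -cats1 caps_coef_cat ?size_dual_obj ?size_rev //=.
rewrite mulr1 mulrACA [caps_coef (dual_obj w) _ * _]mulrC [cap_coef (flip x) _ * _]mulrC.
by rewrite -mulrA [caps_coef _ _ * (_ * _)]mulrA -[RHS](IH _ e) -[RHS]mul1r -(cap_coef_flip_mul x T); ring.
Qed.

Lemma dom_caps w : dom (caps w) = w ++ dual_obj w.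
Proof. by elim: w => //= x w ->; rewrite dual_obj_cons catA. Qed.

Lemma cod_caps w : cod (caps w) = [::].
Proof. by case: w. Qed.

Lemma bar_caps w : bar (caps w) = cups w.
Proof. by elim: w => //= x w ->. Qed.

Lemma dom_cups w : dom (cups w) = [::].
Proof. by rewrite -bar_caps dom_bar cod_caps. Qed.

Lemma cod_cups w : cod (cups w) = w ++ dual_obj w.
Proof. by rewrite -bar_caps cod_bar dom_caps. Qed.

Lemma ev_caps w i j : i \in states w -> j \in states (dual_obj w) ->
  ev (caps w) (i ++ j) [::] = (rev i == j)%:R * caps_coef w i.
Proof.
elim: w i j => [|x w IH] i j.
  by rewrite !mem_states0 => /eqP -> /eqP ->; rewrite ev_id mulr1.
rewrite mem_states_cons dual_obj_cons; case: i => // T i /andP[hT hi].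
move=> /split_states[{}j _ hj /states1P[V hV ->]].
have si := size_states hi; have sj := size_states hj.
rewrite [caps _]/= ev_comp; last by rewrite /= cod_caps.
rewrite /= cod_caps big_states1.
transitivity (\sum_(A <- slice x.2) (T == A)%:R * (\sum_(B <- slice x.2) (V == B)%:R *
  ((A == B)%:R * ((rev i == j)%:R * caps_coef w i * cap_coef x A)))).
  apply: eq_bigr => A _; rewrite big_states1 big_distrr; apply: eq_bigr => B _.
  rewrite big_states0 catA.
  rewrite (ev_tens (i := [:: T]) (j := [:: A]) (i' := (i ++ j) ++ [:: V]) (j' := [:: B])) //.
  rewrite (ev_tens (i := i ++ j) (j := [::]) (i' := [:: V]) (j' := [:: B])).
  - by rewrite IH // !ev_id !eqseq_cons !andbT /ev /=; ring.
  - by rewrite dom_caps !size_cat si sj.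
  - by rewrite cod_caps.
rewrite big_delta ?slice_uniq // big_delta ?slice_uniq //.
rewrite rev_cons -cats1 eqseq_cat ?size_dual_obj ?size_rev ?si ?sj ?size_dual_obj //.
rewrite eqseq_cons andbT [in RHS]andbC -mulnb natrM /=.
by ring.
Qed.

Lemma ev_cups w i j : i \in states w -> j \in states (dual_obj w) ->
  ev (cups w) [::] (i ++ j) = (rev i == j)%:R * caps_coef w i.
Proof. by move=> hi hj; rewrite -bar_caps ev_bar ev_caps. Qed.

(** Bending all the strands to one side transposes the matrix and rescales it by
    the weights of the arcs. *)
Lemma ev_rmate t i j :
  i \in states (dual_obj (cod t)) -> j \in states (dual_obj (dom t)) ->
  ev (rmate t) i j =
  caps_coef (dual_obj (dom t)) j * ev t (rev j) (rev i) * caps_coef (cod t) (rev i).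
Proof.
move=> hi hj.
have hi' : rev i \in states (cod t) by rewrite -[cod t]dual_objK mem_states_dual.
have hj' : rev j \in states (dom t) by rewrite -[dom t]dual_objK mem_states_dual.
rewrite /rmate.
set w := dom t in hj hj' *; set z := cod t in hi hi' *.
set w' := dual_obj w in hj *; set z' := dual_obj z in hi *.
have ww : dual_obj w' = w by rewrite dual_objK.
have cupsE : cod (Tens (cups w') (Id z')) = w' ++ w ++ z' by rewrite /= cod_cups ww catA.
have inner j1 j2 j3 : j1 \in states w' -> j2 \in states z -> j3 \in states z' ->
    ev (Comp (Tens (Id w') (Tens t (Id z'))) (Tens (cups w') (Id z'))) i (j1 ++ j2 ++ j3) =
    (i == j3)%:R * (caps_coef w' j1 * ev t (rev j1) j2).
  move=> h1 h2 h3; rewrite ev_comp ?cupsE // !big_states_cat.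
  transitivity (\sum_(i1 <- states w') (j1 == i1)%:R * \sum_(i2 <- states w)
    (rev i1 == i2)%:R * \sum_(i3 <- states z') (i == i3)%:R *
    ((i3 == j3)%:R * (caps_coef w' i1 * ev t i2 j2))).
    apply: eq_big_seq => i1 hi1; rewrite big_states_cat big_distrr; apply: eq_big_seq => i2 hi2.
    rewrite !big_distrr; apply: eq_big_seq => i3 hi3.
    rewrite {1}[i1 ++ _]catA (ev_tens (i := [::])) ?dom_cups //; last first.
      by rewrite cod_cups ww !size_cat (size_states hi1) (size_states hi2).
    rewrite ev_cups ?ww // ev_tens ?(size_states hi1) ?(size_states h1) //.
    rewrite ev_tens ?(size_states hi2) ?(size_states h2) // !ev_id [i1 == j1]eq_sym /=.
    by ring.
  rewrite big_delta ?states_uniq // big_delta ?states_uniq //; last first.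
    by rewrite -ww mem_states_dual.
  by rewrite big_delta ?states_uniq.
rewrite ev_comp; last by rewrite /= dom_caps.
rewrite [cod _]/= -/z big_states_cat.
transitivity (\sum_(j1 <- states w') (j == j1)%:R * \sum_(j3 <- states z') (i == j3)%:R *
   \sum_(j2 <- states z) (rev j3 == j2)%:R * (caps_coef w' j1 * ev t (rev j1) j2 * caps_coef z j2)).
  apply: eq_big_seq => j1 h1; rewrite big_states_cat exchange_big big_distrr /=.
  apply: eq_big_seq => j3 h3; rewrite !big_distrr; apply: eq_big_seq => j2 h2.
  rewrite inner // -{1}[j]cats0 ev_tens ?(size_states h1) ?(size_states hj) //.
  rewrite ev_caps // ev_id [j1 == j]eq_sym -[rev j2 == j3](inj_eq (can_inj revK)) revK [j2 == _]eq_sym /=.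
  by ring.
rewrite big_delta ?states_uniq // big_delta ?states_uniq //.
by rewrite big_delta ?states_uniq.
Qed.

Lemma ev_lmate t i j :
  i \in states (dual_obj (cod t)) -> j \in states (dual_obj (dom t)) ->
  ev (lmate t) i j =
  caps_coef (dual_obj (cod t)) i * ev t (rev j) (rev i) * caps_coef (dom t) (rev j).
Proof.
move=> hi hj.
have hi' : rev i \in states (cod t) by rewrite -[cod t]dual_objK mem_states_dual.
have hj' : rev j \in states (dom t) by rewrite -[dom t]dual_objK mem_states_dual.
rewrite /lmate.
set w := dom t in hj hj' *; set z := cod t in hi hi' *.
set w' := dual_obj w in hj *; set z' := dual_obj z in hi *.
have zz : dual_obj z' = z by rewrite dual_objK.
have cupsE : cod (Tens (Id z') (cups w)) = z' ++ w ++ w' by rewrite /= cod_cups.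
have inner j1 j2 j3 : j1 \in states z' -> j2 \in states z -> j3 \in states w' ->
    ev (Comp (Tens (Id z') (Tens t (Id w'))) (Tens (Id z') (cups w))) i (j1 ++ j2 ++ j3) =
    (i == j1)%:R * (caps_coef w (rev j3) * ev t (rev j3) j2).
  move=> h1 h2 h3; rewrite ev_comp ?cupsE // !big_states_cat.
  transitivity (\sum_(i1 <- states z') (i == i1)%:R * \sum_(i3 <- states w')
    (j3 == i3)%:R * \sum_(i2 <- states w) (rev i3 == i2)%:R *
    ((i1 == j1)%:R * (caps_coef w i2 * ev t i2 j2))).
    apply: eq_big_seq => i1 hi1; rewrite big_states_cat exchange_big big_distrr /=.
    apply: eq_big_seq => i3 hi3; rewrite !big_distrr; apply: eq_big_seq => i2 hi2.
    rewrite -{1}[i]cats0 (ev_tens (i := i)) ?(size_states hi1) ?(size_states hi) //.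
    rewrite ev_cups // ev_tens ?(size_states hi1) ?(size_states h1) //.
    rewrite ev_tens ?(size_states hi2) ?(size_states h2) // !ev_id.
    rewrite -[rev i2 == i3](inj_eq (can_inj revK)) revK [i2 == _]eq_sym [i3 == j3]eq_sym /=.
    by ring.
  rewrite big_delta ?states_uniq // big_delta ?states_uniq // big_delta ?states_uniq //.
  by rewrite -mem_states_dual revK.
rewrite ev_comp; last by rewrite /= dom_caps zz catA.
rewrite [cod _]/= -/z big_states_cat.
transitivity (\sum_(j1 <- states z') (i == j1)%:R * \sum_(j2 <- states z) (rev j1 == j2)%:R *
   \sum_(j3 <- states w') (j == j3)%:R * (caps_coef z' j1 * ev t (rev j3) j2 * caps_coef w (rev j3))).
  apply: eq_big_seq => j1 h1; rewrite big_states_cat big_distrr /=.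
  apply: eq_big_seq => j2 h2; rewrite !big_distrr; apply: eq_big_seq => j3 h3.
  rewrite inner // [j1 ++ _]catA (ev_tens (j := [::])) ?cod_caps //; last first.
    by rewrite dom_caps zz !size_cat (size_states h1) (size_states h2).
  by rewrite ev_caps ?zz // ev_id [j3 == j]eq_sym /=; ring.
rewrite big_delta ?states_uniq // big_delta ?states_uniq //.
by rewrite big_delta ?states_uniq.
Qed.

End Evaluation.

Arguments ev_tens {R th n t u i j i' j'}.
Arguments ev : simpl never.

Arguments rungF : simpl never.
Arguments rungE : simpl never.
Arguments xmerge : simpl never.
Arguments xsplit : simpl never.

(** * Extended webs *)

Section Vis.

Variable n : nat.
Notation states := (states n).
Notation slice := (slice n).

(** The factors with the labels 0 and n are one-dimensional, so that erasing
    them is a bijection on states; computations with extended webs are made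
    before the erasure. *)
Definition vis_state (i : seq bits) : seq bits := [seq T <- i | (0 < ones T < n)%N].

Lemma in_I_slice k T : T \in slice k -> in_I n k = (0 < ones T < n)%N.
Proof. by rewrite mem_slice /in_I => /andP[_ /eqP <-]; lia. Qed.

Lemma slice_hat k T : T \in slice k -> in_hatI n k.
Proof.
rewrite mem_slice /in_hatI => /andP[/eqP sT /eqP <-].
by have := ones_size T; rewrite sT; lia.
Qed.

Lemma vis_cons k a :
  vis n (k :: a) = (if in_I n k then [:: up k] else [::]) ++ vis n a.
Proof. by rewrite /vis /strip /=; case: ifP. Qed.

Lemma vis_cat a b : vis n (a ++ b) = vis n a ++ vis n b.
Proof. by rewrite /vis /strip filter_cat /upobj map_cat. Qed.

Lemma vis_state_cons T i : vis_state (T :: i) = (if (0 < ones T < n)%N then [:: T] else [::]) ++ vis_state i.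
Proof. by rewrite /vis_state /=; case: ifP. Qed.

Lemma vis_state_cat i j : vis_state (i ++ j) = vis_state i ++ vis_state j.
Proof. exact: filter_cat. Qed.

Lemma slice0 T : (T \in slice 0) = (T == nseq n false).
Proof.
rewrite mem_slice; apply/andP/eqP => [[/eqP <- /eqP e]|->].
  have {e} : ones T = 0%N by lia.
  by elim: T => //= b T IH; rewrite ones_cons; case: b => // e; congr cons; exact: IH.
by rewrite size_nseq /ones count_nseq mul0n.
Qed.

Lemma slicen T : (T \in slice n%:Z) = (T == nseq n true).
Proof.
rewrite mem_slice; apply/andP/eqP => [[/eqP <- /eqP e]|->].
  have {e} : ones T = size T by lia.
  elim: T => //= b T IH; rewrite ones_cons; have := ones_size T.
  by case: b => /= le e; [congr cons; apply: IH|]; lia.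
by rewrite size_nseq /ones count_nseq mul1n.
Qed.

Lemma mem_vis_state a i : i \in states (upobj a) -> vis_state i \in states (vis n a).
Proof.
elim: a i => [|k a IH] i; first by rewrite mem_states0 => /eqP ->.
rewrite mem_states_cons; case: i => // T i /andP[hT /IH hi].
rewrite vis_state_cons vis_cons -(in_I_slice hT); case: ifP => // _.
by rewrite mem_states_cons /= hT.
Qed.

Lemma hat_cases k : in_hatI n k -> ~~ in_I n k -> k = 0 \/ k = n%:Z.
Proof. by rewrite /in_hatI /in_I; lia. Qed.

Lemma vis_state_surj a j : all (in_hatI n) a -> j \in states (vis n a) ->
  exists2 i, i \in states (upobj a) & vis_state i = j.
Proof.
elim: a j => [|k a IH] j.
  by rewrite mem_states0 => _ /eqP ->; exists [::].
move=> /andP[hk ha]; rewrite vis_cons; case: (boolP (in_I n k)) => Ik.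
  rewrite mem_states_cons; case: j => // T j /andP[hT /(IH _ ha)[i hi <-]].
  exists (T :: i); first by rewrite mem_states_cons /= hT.
  by rewrite vis_state_cons -(in_I_slice hT) Ik.
move=> /(IH _ ha)[i hi <-].
have [T hT] : exists T, T \in slice k.
  have [->|->] := hat_cases hk Ik.
    by exists (nseq n false); rewrite slice0.
  by exists (nseq n true); rewrite slicen.
exists (T :: i); first by rewrite mem_states_cons /= hT.
by rewrite vis_state_cons -(in_I_slice hT) (negPf Ik).
Qed.

Lemma slice_inj k T V : in_hatI n k -> ~~ in_I n k ->
  T \in slice k -> V \in slice k -> T = V.
Proof.
move=> hk Ik; have [->|->] := hat_cases hk Ik; rewrite ?slice0 ?slicen;
by move=> /eqP -> /eqP ->.
Qed.

Lemma vis_state_inj a i j : i \in states (upobj a) -> j \in states (upobj a) ->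
  (vis_state i == vis_state j) = (i == j).
Proof.
elim: a i j => [|k a IH] i j.
  by rewrite !mem_states0 => /eqP -> /eqP ->.
rewrite !mem_states_cons; case: i => // T i /andP[hT hi].
case: j => // V j /andP[hV hj].
rewrite !vis_state_cons -(in_I_slice hT) -(in_I_slice hV) eqseq_cons -(IH i j) //.
case: ifPn => // Ik; rewrite ?eqseq_cons //.
by rewrite (slice_inj (slice_hat hT) Ik hT hV) eqxx.
Qed.

End Vis.

Arguments vis_state : simpl never.
Arguments vis : simpl never.

Lemma big_vis (R : nmodType) n a (G : seq bits -> R) : all (in_hatI n) a ->
  \sum_(i <- states n (vis n a)) G i = \sum_(i <- states n (upobj a)) G (vis_state n i).
Proof.
move=> ha; rewrite -(big_map (vis_state n) xpredT G); apply: perm_big; apply: uniq_perm.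
- exact: states_uniq.
- rewrite map_inj_in_uniq ?states_uniq // => i j hi hj /eqP.
  by rewrite (vis_state_inj hi hj) => /eqP.
move=> j; apply/idP/mapP => [/(vis_state_surj ha)[i hi <-]|[i hi ->]]; first by exists i.
exact: mem_vis_state.
Qed.

Lemma big_slice (R : pzSemiRingType) n k (G : bits -> R) :
  \sum_(T <- slice n k) G T = \sum_(T <- cube n) ((ones T)%:Z == k)%:R * G T.
Proof.
rewrite big_filter big_mkcond; apply: eq_bigr => T _.
by case: ifP; rewrite ?mul1r ?mul0r.
Qed.

Section Extended.

Variables (R : realFieldType) (th : param R) (n : nat).
Local Notation a := (sqrt_q th).
Notation merge_coef := (merge_coef th).
Notation rung_coef := (rung_coef th).
Notation ev := (ev th n).
Notation states := (states n).
Notation slice := (slice n).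
Notation vis_state := (vis_state n).

Lemma vis_nI k : ~~ in_I n k -> vis n [:: k] = [::].
Proof. by rewrite vis_cons => /negPf ->. Qed.

Lemma in_I0 : in_I n 0 = false.
Proof. by []. Qed.

Lemma in_In : in_I n n%:Z = false.
Proof. by rewrite /in_I ltxx andbF. Qed.

Lemma xmerge_ends k l :
  dom (xmerge n k l) = vis n [:: k; l] /\ cod (xmerge n k l) = vis n [:: k + l].
Proof.
rewrite /xmerge; case: ifP => // /and3P[hk hl hkl].
case: eqP => [->|k0]; first by rewrite add0r [vis n [:: 0; l]]vis_cons in_I0.
case: eqP => [->|l0].
  by rewrite addr0 -[[:: k; 0]]/([:: k] ++ [:: 0]) vis_cat [vis n [:: 0]]vis_nI ?cats0.
move: hk hl hkl; rewrite /in_hatI => hk hl hkl.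
have Ik : in_I n k by rewrite /in_I; lia.
have Il : in_I n l by rewrite /in_I; lia.
case: eqP => [e|ne]; rewrite /= !vis_cons Ik Il.
  by rewrite e in_In.
by have -> : in_I n (k + l) by rewrite /in_I; lia.
Qed.

Lemma dom_xmerge k l : dom (xmerge n k l) = vis n [:: k; l].
Proof. by have [] := xmerge_ends k l. Qed.

Lemma cod_xmerge k l : cod (xmerge n k l) = vis n [:: k + l].
Proof. by have [] := xmerge_ends k l. Qed.

Lemma bar_xmerge k l : bar (xmerge n k l) = xsplit n k l.
Proof. by rewrite /xmerge /xsplit; do 4!case: ifP => //. Qed.

Lemma bar_xsplit k l : bar (xsplit n k l) = xmerge n k l.
Proof. by rewrite /xmerge /xsplit; do 4!case: ifP => //. Qed.

Lemma dom_xsplit k l : dom (xsplit n k l) = vis n [:: k + l].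
Proof. by rewrite -bar_xmerge dom_bar cod_xmerge. Qed.

Lemma cod_xsplit k l : cod (xsplit n k l) = vis n [:: k; l].
Proof. by rewrite -bar_xmerge cod_bar dom_xmerge. Qed.

Lemma mem_states1 x T : T \in slice x.2 -> [:: T] \in states [:: x].
Proof. by move=> h; rewrite mem_states_cons h. Qed.

Lemma mem_states2 x y T V : T \in slice x.2 -> V \in slice y.2 ->
  [:: T; V] \in states [:: x; y].
Proof. by move=> h h'; rewrite !mem_states_cons h h'. Qed.

(** Labels 0 and n stand for the empty and the full subset, so that a vertex of
    an extended web has the same matrix coefficients whether or not it
    degenerates to an identity or to a tag. *)
Lemma ev_xmerge k l T V U : T \in slice k -> V \in slice l -> U \in slice (k + l) ->
  ev (xmerge n k l) (vis_state [:: T; V]) (vis_state [:: U]) = merge_coef T V U.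
Proof.
move=> hT hV hU; have [[sT sV] sU] := (slice_size hT, slice_size hV, slice_size hU).
rewrite /xmerge (slice_hat hT) (slice_hat hV) (slice_hat hU) /=.
case: eqP => [k0|k0].
  move: hT hU; rewrite k0 add0r => hT hU.
  rewrite ev_id vis_state_cons -(in_I_slice hT) in_I0 cat0s (@vis_state_inj _ [:: l]) ?mem_states1 //.
  move: hT; rewrite slice0 => /eqP ->; rewrite -sU merge_coef_0l ?sU //.
  by rewrite eqseq_cons andbT.
case: eqP => [l0|l0].
  move: hV hU; rewrite l0 addr0 => hV hU.
  rewrite ev_id -[[:: T; V]]/([:: T] ++ [:: V]) vis_state_cat [vis_state [:: V]]vis_state_cons -(in_I_slice hV).
  rewrite in_I0 cats0 (@vis_state_inj _ [:: k]) ?mem_states1 //.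
  move: hV; rewrite slice0 => /eqP ->; rewrite -sU merge_coef_0r ?sU //.
  by rewrite eqseq_cons andbT.
have := slice_hat hT; have := slice_hat hV; have := slice_hat hU.
rewrite /in_hatI => hkl hl hk.
have Ik : in_I n k by rewrite /in_I; lia.
have Il : in_I n l by rewrite /in_I; lia.
rewrite !vis_state_cons -(in_I_slice hT) -(in_I_slice hV) -(in_I_slice hU) Ik Il.
case: eqP => [e|ne].
  by move: hU; rewrite e slicen in_In => /eqP ->.
by have -> : in_I n (k + l) by rewrite /in_I; lia.
Qed.

Lemma ev_xsplit k l T V U : T \in slice k -> V \in slice l -> U \in slice (k + l) ->
  ev (xsplit n k l) (vis_state [:: U]) (vis_state [:: T; V]) = merge_coef T V U.
Proof. by move=> hT hV hU; rewrite -bar_xmerge ev_bar ev_xmerge. Qed.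

Lemma dom_rungF s k l : dom (rungF n s k l) = vis n [:: k; l].
Proof. by rewrite /= dom_xsplit subrK -vis_cat. Qed.

Lemma cod_rungF s k l : cod (rungF n s k l) = vis n [:: k - s%:Z; l + s%:Z].
Proof. by rewrite /= cod_xmerge -vis_cat [s%:Z + l]addrC. Qed.

(** Thus the coefficients of E are those of F, transposed. *)
Lemma rungE_bar s k l : rungE n s k l = bar (rungF n s (k + s%:Z) (l - s%:Z)).
Proof. by rewrite /rungE /rungF /= addrK bar_xmerge bar_xsplit. Qed.

Lemma dom_rungE s k l : dom (rungE n s k l) = vis n [:: k; l].
Proof. by rewrite rungE_bar dom_bar cod_rungF addrK subrK. Qed.

Lemma cod_rungE s k l : cod (rungE n s k l) = vis n [:: k + s%:Z; l - s%:Z].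
Proof. by rewrite rungE_bar cod_bar dom_rungF. Qed.

Lemma size_vis_state k i : i \in states (upobj k) -> size (vis_state i) = size (vis n k).
Proof. by move=> /mem_vis_state /size_states. Qed.

Lemma ev_rungF s k l T V T' V' : T \in slice k -> V \in slice l ->
  T' \in slice (k - s%:Z) -> V' \in slice (l + s%:Z) ->
  ev (rungF n s k l) (vis_state [:: T; V]) (vis_state [:: T'; V']) = rung_coef T V T' V'.
Proof.
move=> hT hV hT' hV'.
have h_s : in_hatI n s%:Z.
  by have := slice_hat hT; have := slice_hat hT'; rewrite /in_hatI; lia.
rewrite /rungF ev_comp; last first.
  by rewrite /= cod_xsplit dom_xmerge -!vis_cat.
have -> : cod (Tens (xsplit n (k - s%:Z) s%:Z) (Id (vis n [:: l]))) =
    vis n [:: k - s%:Z; s%:Z; l] by rewrite /= cod_xsplit -vis_cat.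
rewrite big_vis; last by rewrite /= (slice_hat hT') h_s (slice_hat hV).
transitivity (\sum_(A <- slice (k - s%:Z)) (T' == A)%:R * \sum_(C <- slice s%:Z)
  \sum_(B <- slice l) (V == B)%:R * (merge_coef A C T * merge_coef C B V')).
  rewrite big_states1; apply: eq_big_seq => A hA.
  rewrite big_states1 big_distrr; apply: eq_big_seq => C hC.
  rewrite big_states1 big_distrr; apply: eq_big_seq => B hB; rewrite big_states0 /=.
  rewrite -[[:: A; C; B]]/([:: A; C] ++ [:: B]) -[[:: T; V]]/([:: T] ++ [:: V]) !vis_state_cat.
  rewrite ev_tens; first last.
  - by rewrite cod_xsplit (@size_vis_state [:: k - s%:Z; s%:Z]) // mem_states2.
  - by rewrite dom_xsplit subrK (@size_vis_state [:: k]) // mem_states1.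
  rewrite -vis_state_cat -[[:: A; C] ++ [:: B]]/([:: A] ++ [:: C; B]) -[[:: T'; V']]/([:: T'] ++ [:: V']) !vis_state_cat.
  rewrite ev_tens /=; first last.
  - by rewrite (@size_vis_state [:: k - s%:Z]) // mem_states1.
  - by rewrite (@size_vis_state [:: k - s%:Z]) // mem_states1.
  rewrite ev_xsplit ?subrK // ev_xmerge ?[s%:Z + l]addrC // !ev_id.
  rewrite (@vis_state_inj _ [:: l]) ?mem_states1 // (@vis_state_inj _ [:: k - s%:Z]) ?mem_states1 //.
  by rewrite !eqseq_cons !andbT [A == T']eq_sym; ring.
rewrite big_delta ?slice_uniq //.
under eq_bigr => C _ do rewrite big_delta ?slice_uniq //.
rewrite big_slice rung_coefE (slice_size hT); apply: eq_bigr => C _.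
have [->|nz] := eqVneq (merge_coef T' C T) 0; first by rewrite !mul0r mulr0.
have [_ _ e] := merge_coef_supp nz.
move: hT hT'; rewrite !mem_slice => /andP[_ /eqP e1] /andP[_ /eqP e2].
have -> : ((ones C)%:Z == s%:Z) by apply/eqP; lia.
by rewrite mul1r.
Qed.

Lemma ev_rungE s k l T V T' V' : T \in slice k -> V \in slice l ->
  T' \in slice (k + s%:Z) -> V' \in slice (l - s%:Z) ->
  ev (rungE n s k l) (vis_state [:: T; V]) (vis_state [:: T'; V']) = rung_coef T' V' T V.
Proof.
by move=> *; rewrite rungE_bar ev_bar ev_rungF ?addrK ?subrK.
Qed.

Lemma ev_rungF_out s k l i j :
  ~~ [&& in_hatI n k, in_hatI n l, in_hatI n (k - s%:Z) & in_hatI n (l + s%:Z)] ->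
  ev (rungF n s k l) i j = 0.
Proof.
move=> out; rewrite /rungF ev_comp; last by rewrite /= cod_xsplit dom_xmerge -!vis_cat.
apply: big1 => u _.
have [h1|h1] := boolP [&& in_hatI n (k - s%:Z), in_hatI n s%:Z & in_hatI n (k - s%:Z + s%:Z)].
  have h2 : [&& in_hatI n s%:Z, in_hatI n l & in_hatI n (s%:Z + l)] = false.
    apply: contraNF out => /and3P[_ -> h]; move: h1; rewrite subrK => /and3P[-> _ ->].
    by rewrite addrC.
  by rewrite /xmerge h2 ev_tens_zeror mulr0.
by rewrite /xsplit (negPf h1) ev_tens_zerol mul0r.
Qed.

Lemma ev_rungE_out s k l i j :
  ~~ [&& in_hatI n k, in_hatI n l, in_hatI n (k + s%:Z) & in_hatI n (l - s%:Z)] ->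
  ev (rungE n s k l) i j = 0.
Proof.
move=> out; rewrite rungE_bar ev_bar ev_rungF_out // addrK subrK.
by apply: contra out => /and4P[-> -> -> ->].
Qed.

End Extended.

(** * The relations of the web category hold for the matrices *)

Section Soundness.

Variables (R : realFieldType) (th : param R) (n : nat).
Local Notation a := (sqrt_q th).
Notation merge_coef := (merge_coef th).
Notation ev := (ev th n).
Notation states := (states n).
Notation slice := (slice n).
Notation cap_coef := (cap_coef th).
Notation caps_coef := (caps_coef th).
Notation same_ev := (same_ev th n).
Notation full := (nseq n true).

Lemma cap_coef_up k T : cap_coef (up k) T = a ^ height T.
Proof. by []. Qed.

(** The height is additive for disjoint unions, and the full subset has height
    0. *)
Lemma vertex_coef_caps v i j : i \in states (vdom v) -> j \in states (vcod v) ->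
  ev (Vert v) i j != 0 -> caps_coef (vdom v) i = caps_coef (vcod v) j.
Proof.
case: v => k l.
- move=> /states2P[T [V [_ _ ->]]] /states1P[U _ ->] /merge_coef_height e.
  by rewrite /= !cap_coef_up e !mulr1 aD.
- move=> /states1P[U _ ->] /states2P[T [V [_ _ ->]]] /merge_coef_height e.
  by rewrite /= !cap_coef_up e !mulr1 aD.
- move=> /states2P[T [V [_ _ ->]]]; rewrite mem_states0 => /eqP -> /merge_coef_height.
  by rewrite height_nseq /= !cap_coef_up !mulr1 -aD => <-; rewrite expr0z.
- rewrite mem_states0 => /eqP -> /states2P[T [V [_ _ ->]]] /merge_coef_height.
  by rewrite height_nseq /= !cap_coef_up !mulr1 -aD => <-; rewrite expr0z.
Qed.

(** The two rotations differ by the ratio of the weights of the arcs at the top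
    and at the bottom, which is 1 since a vertex preserves the height. *)
Lemma same_rotate v : same_ev (dual_obj (vcod v)) (dual_obj (vdom v))
  (rmate (Vert v)) (lmate (Vert v)).
Proof.
split; rewrite /= ?dom_cups ?cod_caps ?cats0 //.
move=> i j hi hj; rewrite ev_rmate // ev_lmate //=.
have hi' : rev i \in states (vcod v) by rewrite -[vcod v]dual_objK mem_states_dual.
have hj' : rev j \in states (vdom v) by rewrite -[vdom v]dual_objK mem_states_dual.
have [->|nz] := eqVneq (ev (Vert v) (rev j) (rev i)) 0; first by rewrite !mulr0 !mul0r.
have e := vertex_coef_caps hj' hi' nz.
have := caps_coef_dual th (size_states hi'); have := caps_coef_dual th (size_states hj').
rewrite !revK -e => e1 e2.
by rewrite mulrAC e1 [RHS]mulrAC e2.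
Qed.

(** The cup and the cap contribute one factor each, hence the square. *)
Lemma ev_close_right w z x t i j : dom t = w ++ [:: x] -> cod t = z ++ [:: x] ->
  i \in states w -> j \in states z ->
  ev (close_right w z x t) i j =
  \sum_(T <- slice x.2) ev t (i ++ [:: T]) (j ++ [:: T]) * cap_coef x T ^+ 2.
Proof.
move=> dt ct hi hj.
have [si sj] := (size_states hi, size_states hj).
have inner k T V : k \in states z -> T \in slice x.2 -> V \in slice x.2 ->
    ev (Comp (Tens t (Id [:: flip x])) (Tens (Id w) (Cup x))) i (k ++ [:: T; V])
    = ev t (i ++ [:: V]) (k ++ [:: T]) * cap_coef x V.
  move=> hk hT hV; rewrite ev_comp; last by rewrite /= dt -catA.
  rewrite [cod _]/= big_states_cat.
  transitivity (\sum_(l <- states w) (i == l)%:R * \sum_(B <- slice x.2) (V == B)%:R *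
     \sum_(A <- slice x.2) (B == A)%:R * (cap_coef x A * ev t (l ++ [:: A]) (k ++ [:: T]))).
    apply: eq_big_seq => l hl; rewrite big_states1 exchange_big big_states1 big_distrr /=.
    rewrite exchange_big big_states0.
    apply: eq_big_seq => B hB; rewrite !big_distrr /=; apply: eq_big_seq => A hA.
    rewrite -{1}[i]cats0 (ev_tens (i := i) (j := l)) ?(size_states hl) //.
    have -> : l ++ [:: A; B] = (l ++ [:: A]) ++ [:: B] by rewrite -catA.
    have -> : k ++ [:: T; V] = (k ++ [:: T]) ++ [:: V] by rewrite -catA.
    rewrite ev_tens ?dt ?ct ?size_cat ?(size_states hl) ?(size_states hk) //.
    rewrite !ev_id ev_cup eqseq_cons andbT [B == V]eq_sym [B == A]eq_sym.
    by ring.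
  rewrite big_delta ?states_uniq // big_delta ?slice_uniq // big_delta ?slice_uniq //.
  by rewrite mulrC.
rewrite /close_right ev_comp; last by rewrite /= ct -catA.
rewrite [cod _]/= ct -catA big_states_cat.
transitivity (\sum_(k <- states z) (j == k)%:R * \sum_(T <- slice x.2)
  \sum_(V <- slice x.2) (T == V)%:R * (ev t (i ++ [:: V]) (k ++ [:: T]) * cap_coef x V * cap_coef x T)).
  apply: eq_big_seq => k hk; rewrite big_states1 big_distrr; apply: eq_big_seq => T hT.
  rewrite big_states1 big_distrr; apply: eq_big_seq => V hV; rewrite big_states0 inner //=.
  rewrite -{1}[j]cats0 ev_tens ?(size_states hk) // ev_id ev_cap [k == j]eq_sym /=.
  by ring.
rewrite big_delta ?states_uniq //; apply: eq_big_seq => T hT.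
by rewrite big_delta ?slice_uniq // expr2 mulrA.
Qed.

Lemma cap_coef_up_sqr k T : cap_coef (up k) T ^+ 2 = a ^ (2 * height T).
Proof. by rewrite cap_coef_up expr2 -aD; congr (_ ^ _); lia. Qed.

Lemma qeval_sign m : qeval th ((-1) ^+ m) = (-1) ^+ m.
Proof. by elim: m => [|m IH]; rewrite ?expr0 ?qeval1 // !exprS qevalM IH qevalN qeval1. Qed.

Lemma ones_slice k T : T \in slice k -> (ones T)%:Z = k.
Proof. by rewrite mem_slice => /andP[_ /eqP]. Qed.

Lemma slice_cube k T : T \in slice k -> T \in cube n.
Proof. by rewrite mem_slice mem_cube => /andP[]. Qed.

(** Both arcs act on the state T of the strand k, with the total weight
    q^height(T), which [merge_coef_full_swap] produces. *)
Lemma same_tag_switch k l : is_vertex n (TagIn k l) ->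
  same_ev [:: up k; up l] [::] (Vert (TagIn k l))
    (Scale ((-1) ^+ absz (k * l))
      (Comp (Cap (up k))
        (Comp (Tens (Id [:: up k])
                 (Tens (Vert (TagIn l k)) (Id [:: flip (up k)])))
              (Tens (Id [:: up k; up l]) (Cup (up k)))))).
Proof.
move=> vtx; split => // i j /states2P[T [V [hT hV ->]]]; rewrite mem_states0 => /eqP ->.
rewrite /= in hT hV; rewrite ev_scale ev_comp // [cod _]/= !big_states1.
transitivity (merge_coef T V full); first by [].
have inner A B : A \in slice k -> B \in slice k ->
    ev (Comp (Tens (Id [:: up k]) (Tens (Vert (TagIn l k)) (Id [:: flip (up k)])))
             (Tens (Id [:: up k; up l]) (Cup (up k)))) [:: T; V] [:: A; B]
    = (T == A)%:R * (merge_coef V B full * cap_coef (up k) B).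
  move=> hA hB; rewrite ev_comp // [cod _]/= !big_states1.
  transitivity (\sum_(C <- slice k) (T == C)%:R * \sum_(D <- slice l) (V == D)%:R *
     \sum_(E <- slice k) (B == E)%:R * ((C == A)%:R * (merge_coef D E full * cap_coef (up k) E))).
    apply: eq_bigr => C _; rewrite big_states1 big_distrr; apply: eq_bigr => D _.
    rewrite big_states1 !big_distrr; apply: eq_big_seq => E hE.
    rewrite big_states1 /=.
    transitivity (\sum_(G <- slice k) (E == G)%:R * (cap_coef (up k) E * ([:: T; V] == [:: C; D])%:R *
       ((C == A)%:R * (merge_coef D E full * (G == B)%:R)))).
      apply: eq_bigr => G _; rewrite big_states0.
      rewrite (ev_tens (i := [:: T; V]) (j := [:: C; D]) (i' := [::]) (j' := [:: E; G])) //.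
      rewrite (ev_tens (i := [:: C]) (j := [:: A]) (i' := [:: D; E; G]) (j' := [:: B])) //.
      rewrite (ev_tens (i := [:: D; E]) (j := [::]) (i' := [:: G]) (j' := [:: B])) //.
      rewrite -[ev (Vert _) _ _]/(merge_coef D E full).
      by rewrite !ev_id ev_cup !eqseq_cons !andbT; ring.
    rewrite big_delta ?slice_uniq // !eqseq_cons andbT -mulnb natrM [E == B]eq_sym; ring.
  rewrite big_delta ?slice_uniq // big_delta ?slice_uniq // big_delta ?slice_uniq //.
transitivity (qeval th ((-1) ^+ absz (k * l)) * \sum_(A <- slice k) (T == A)%:R *
   \sum_(B <- slice k) (A == B)%:R * (merge_coef V B full * cap_coef (up k) B * cap_coef (up k) A)); last first.
  congr (_ * _); apply: eq_big_seq => A hA; rewrite big_states1 big_distrr.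
  apply: eq_big_seq => B hB; rewrite big_states0 inner // ev_cap /=; ring.
rewrite big_delta ?slice_uniq // big_delta ?slice_uniq // qeval_sign.
rewrite -{1}(slice_size hV) merge_coef_full_swap ?(slice_size hT) ?(slice_size hV) //.
rewrite mon_def -mulrA -expr2 cap_coef_up_sqr -(ones_slice hT) -(ones_slice hV) -PoszM absz_nat -exprnP.
by rewrite -mulrA [a ^ _ * _]mulrC.
Qed.

Lemma same_bigon k l : is_vertex n (Merge k l) ->
  same_ev [:: up (k + l)] [:: up (k + l)]
    (Comp (Vert (Merge k l)) (Vert (Defs.Split k l)))
    (Scale (qbinom (k + l) (absz l)) (Id [:: up (k + l)])).
Proof.
move=> vtx; split => // _ _ /states1P[T hT ->] /states1P[V hV ->].
rewrite /= in hT hV; rewrite ev_scale ev_id ev_comp // [cod _]/= big_states1.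
have l0 : l = (absz l)%:Z by move: vtx; rewrite /= /in_I; lia.
transitivity (\sum_(A <- slice k) \sum_(B <- slice l) merge_coef A B T * merge_coef A B V).
  by apply: eq_bigr => A _; rewrite big_states1; apply: eq_bigr => B _; rewrite big_states0.
rewrite eqseq_cons andbT; case: eqP => [<-|ne]; last first.
  rewrite mulr0 big1 // => A _; rewrite big1 // => B _.
  have [->|nz] := eqVneq (merge_coef A B T) 0; first by rewrite mul0r.
  have [->|nz'] := eqVneq (merge_coef A B V) 0; first by rewrite mulr0.
  by case: ne; apply: merge_coef_injr nz nz'.
rewrite mulr1 -/(qbin th _ _) -{1}(ones_slice hT) -(merge_coef_bigon th (absz l) (slice_size hT)).
rewrite big_slice; apply: eq_bigr => A _; rewrite big_slice big_distrr; apply: eq_bigr => B _ /=.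
have [->|nz] := eqVneq (merge_coef A B T) 0; first by rewrite !(mul0r, mulr0).
have [_ _ e] := merge_coef_supp nz; have := ones_slice hT.
rewrite e => e'; rewrite {1}l0 eqz_nat.
case: (ones B =P absz l) => e2; last by rewrite !(mul0r, mulr0).
by have -> : ((ones A)%:Z == k); [apply/eqP; lia | rewrite !mul1r].
Qed.

(** T is determined by A and the disjoint union U, so that only diagonal terms
    are left. *)
Lemma close_sum (l : nat) T V : size T = n -> size V = n ->
  \sum_(A <- slice l) \sum_(U <- cube n) merge_coef T A U * merge_coef V A U * a ^ (2 * height A) =
  (T == V)%:R * qbin th (n%:Z - (ones T)%:Z) l.
Proof.
move=> sT sV; case: eqP => [<-|ne]; last first.
  rewrite mul0r big1 // => A _; rewrite big1 // => U _.
  have [->|nz] := eqVneq (merge_coef T A U) 0; first by rewrite !mul0r.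
  have [->|nz'] := eqVneq (merge_coef V A U) 0; first by rewrite mulr0 mul0r.
  by case: ne; apply: merge_coef_injl nz nz'.
rewrite mul1r -(merge_coef_close th l sT) big_slice; apply: eq_bigr => A _.
by rewrite big_distrr.
Qed.

Lemma same_close k l : is_vertex n (Merge k l) ->
  same_ev [:: up k] [:: up k]
    (close_right [:: up k] [:: up k] (up l)
       (Comp (Vert (Defs.Split k l)) (Vert (Merge k l))))
    (Scale (qbinom (n%:Z - k) (absz l)) (Id [:: up k])).
Proof.
move=> vtx; split => // i j hi hj.
rewrite ev_close_right //; move: hi hj => /states1P[T hT ->] /states1P[V hV ->].
rewrite /= in hT hV; have l0 : l = (absz l)%:Z by move: vtx; rewrite /= /in_I; lia.
rewrite ev_scale ev_id eqseq_cons andbT mulrC -/(qbin th _ _).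
have -> : n%:Z - k = n%:Z - (ones T)%:Z by rewrite (ones_slice hT).
rewrite -close_sum ?(slice_size hT) ?(slice_size hV) // -l0.
apply: eq_big_seq => A hA; rewrite cap_coef_up_sqr ev_comp // [cod _]/= big_states1 big_distrl.
rewrite big_slice; apply: eq_bigr => U _; rewrite big_states0 /=.
rewrite -[ev (Vert (Merge _ _)) _ _]/(merge_coef T A U) -[ev (Vert (Defs.Split _ _)) _ _]/(merge_coef V A U).
have [->|nz] := eqVneq (merge_coef T A U) 0; first by rewrite !(mul0r, mulr0).
have [_ _ e] := merge_coef_supp nz; have e1 : (ones A)%:Z = l := ones_slice hA.
have e2 : (ones T)%:Z = k := ones_slice hT.
by have -> : ((ones U)%:Z == k + l); [apply/eqP; lia | rewrite !mul1r].
Qed.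

Lemma full_cube : full \in cube n.
Proof. by rewrite mem_cube size_nseq. Qed.

(** This is a closure with l = n - k, in which the union is always the full
    subset, and the binomial is 1. *)
Lemma same_tag_cancel k l : is_vertex n (TagIn k l) ->
  same_ev [:: up k] [:: up k]
    (close_right [:: up k] [:: up k] (up l)
       (Comp (Vert (TagOut k l)) (Vert (TagIn k l))))
    (Id [:: up k]).
Proof.
move=> vtx; split => // i j hi hj.
rewrite ev_close_right //; move: hi hj => /states1P[T hT ->] /states1P[V hV ->].
rewrite /= in hT hV; have l0 : l = (absz l)%:Z by move: vtx; rewrite /= /in_I; lia.
have kl : k + l = n%:Z by move: vtx => /and3P[_ _ /eqP].
rewrite ev_id eqseq_cons andbT.
have q1 : qbin th (n%:Z - (ones T)%:Z) (absz l) = 1.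
  by rewrite -[RHS](qbinnn th (absz l)); congr (qbin _ _ _); rewrite (ones_slice hT); lia.
transitivity ((T == V)%:R * qbin th (n%:Z - (ones T)%:Z) (absz l)); last by rewrite q1 mulr1.
rewrite -close_sum ?(slice_size hT) ?(slice_size hV) // -l0.
apply: eq_big_seq => A hA; rewrite cap_coef_up_sqr ev_comp // [cod _]/= big_states0.
rewrite -[ev (Vert (TagIn _ _)) _ _]/(merge_coef T A full) -[ev (Vert (TagOut _ _)) _ _]/(merge_coef V A full).
rewrite (bigD1_seq full) ?full_cube ?cube_uniq //= [X in _ + X]big1_seq ?addr0 // => U.
rewrite mem_cube => /andP[ne /eqP sU].
have [->|nz] := eqVneq (merge_coef T A U) 0; first by rewrite !(mul0r, mulr0).
have [_ _ e] := merge_coef_supp nz; have e1 : (ones A)%:Z = l := ones_slice hA.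
have e2 : (ones T)%:Z = k := ones_slice hT.
by move: ne; rewrite -slicen mem_slice sU eqxx /=; case: eqP => //; lia.
Qed.

(** This is the closure of a strand l = k next to the strand 0, whose state is
    the empty subset. *)
Lemma same_circle k : in_I n k ->
  same_ev [::] [::] (Comp (Cap (up k)) (Cup (up k)))
    (Scale (qbinom n%:Z (absz k)) (Id [::])).
Proof.
move=> Ik; split => // i j; rewrite !mem_states0 => /eqP -> /eqP ->.
have k0 : k = (absz k)%:Z by move: Ik; rewrite /= /in_I; lia.
rewrite ev_scale ev_id mulr1 ev_comp // [cod _]/= big_states1 -/(qbin th _ _).
have o0 : ones (nseq n false) = 0%N by rewrite /ones count_nseq mul0n.
have := close_sum (absz k) (size_nseq n false) (size_nseq n false).
rewrite eqxx mul1r o0 subr0 -k0 => <-.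
apply: eq_big_seq => T hT; rewrite big_states1.
transitivity (\sum_(V <- slice k) (T == V)%:R * (cap_coef (up k) T * cap_coef (up k) V * (V == T)%:R)).
  apply: eq_bigr => V _; rewrite big_states0 ev_cap ev_cup.
  by case: eqP => [->|_]; rewrite ?eqxx ?mul0r //; ring.
rewrite big_delta ?slice_uniq // eqxx mulr1 -expr2 cap_coef_up_sqr.
rewrite (bigD1_seq T) ?(slice_cube hT) ?cube_uniq //= [X in _ + X]big1_seq => [|U].
  by rewrite -(slice_size hT) merge_coef_0l // eqxx addr0 !mul1r.
rewrite mem_cube => /andP[ne /eqP sU]; rewrite -sU merge_coef_0l ?(slice_size hT) ?sU //.
by rewrite eq_sym (negPf ne) !mul0r.
Qed.

End Soundness.

(** * Extended relations and soundness *)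

Section Functor.

Variables (R : realFieldType) (th : param R) (n : nat).
Local Notation a := (sqrt_q th).
Notation merge_coef := (merge_coef th).
Notation rung_coef := (rung_coef th).
Notation ev := (ev th n).
Notation states := (states n).
Notation slice := (slice n).
Notation vis_state := (vis_state n).
Notation same_ev := (same_ev th n).

Lemma vis1P k j : in_hatI n k -> j \in states (vis n [:: k]) ->
  exists2 T, T \in slice k & j = vis_state [:: T].
Proof.
move=> hk /vis_state_surj[|i /states1P[T hT ->] <-]; first by rewrite /= hk.
by exists T.
Qed.

Lemma vis2P k l j : in_hatI n k -> in_hatI n l -> j \in states (vis n [:: k; l]) ->
  exists T V, [/\ T \in slice k, V \in slice l & j = vis_state [:: T; V]].
Proof.
move=> hk hl /vis_state_surj[|i /states2P[T [V [hT hV ->]]] <-]; first by rewrite /= hk hl.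
by exists T, V.
Qed.

Lemma same_assoc k l m :
  in_I n k -> in_I n l -> in_I n m -> in_hatI n (k + l + m) ->
  same_ev (vis n [:: k; l; m]) (vis n [:: k + l + m])
    (Comp (xmerge n (k + l) m) (Tens (xmerge n k l) (Id (vis n [:: m]))))
    (Comp (xmerge n k (l + m)) (Tens (Id (vis n [:: k])) (xmerge n l m))).
Proof.
move=> Ik Il Im hklm.
have e1 : cod (Tens (xmerge n k l) (Id (vis n [:: m]))) = vis n [:: k + l; m].
  by rewrite /= cod_xmerge -vis_cat.
have e2 : cod (Tens (Id (vis n [:: k])) (xmerge n l m)) = vis n [:: k; l + m].
  by rewrite /= cod_xmerge -vis_cat.
have [hk hl hm] : [/\ in_hatI n k, in_hatI n l & in_hatI n m].
  by move: Ik Il Im hklm; rewrite /in_I /in_hatI; split; lia.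
have [hkl hlm] : in_hatI n (k + l) /\ in_hatI n (l + m).
  by move: Ik Il Im hklm; rewrite /in_I /in_hatI; split; lia.
split; rewrite /= ?dom_xmerge ?cod_xmerge -?vis_cat ?addrA //.
move=> i0 j /vis_state_surj[|i]; first by rewrite /= hk hl hm.
rewrite mem_states_cons; case: i => // T i /andP[hT /states2P[V [W [hV hW ->]]]] <-.
move=> /(vis1P hklm)[U hU ->]; rewrite /= in hT hV hW.
have hU' : U \in slice (k + (l + m)) by rewrite addrA.
have [sT sV sW] := And3 (slice_size hT) (slice_size hV) (slice_size hW).
rewrite ev_comp ?e1 ?dom_xmerge // [RHS]ev_comp ?e2 ?dom_xmerge //.
rewrite !big_vis ?big_states1; try by rewrite /= ?hk ?hm ?hkl ?hlm.
transitivity (\sum_(X <- slice (k + l)) \sum_(Y <- slice m) (W == Y)%:R * (merge_coef T V X * merge_coef X Y U)).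
  apply: eq_big_seq => X hX; rewrite big_states1; apply: eq_big_seq => Y hY; rewrite big_states0.
  have -> : vis_state [:: T; V; W] = vis_state [:: T; V] ++ vis_state [:: W] by rewrite -vis_state_cat.
  have -> : vis_state [:: X; Y] = vis_state [:: X] ++ vis_state [:: Y] by rewrite -vis_state_cat.
  rewrite ev_tens ?dom_xmerge ?cod_xmerge; first last.
  - by rewrite (@size_vis_state _ [:: k + l]) // mem_states1.
  - by rewrite (@size_vis_state _ [:: k; l]) // mem_states2.
  rewrite -vis_state_cat !ev_xmerge // ev_id (@vis_state_inj _ [:: m]) ?mem_states1 //.
  by rewrite eqseq_cons andbT; ring.
transitivity (\sum_(X <- slice k) (T == X)%:R * \sum_(Y <- slice (l + m)) (merge_coef V W Y * merge_coef X Y U)); last first.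
  apply: eq_big_seq => X hX; rewrite big_states1 big_distrr; apply: eq_big_seq => Y hY.
  rewrite big_states0 /=.
  have -> : vis_state [:: T; V; W] = vis_state [:: T] ++ vis_state [:: V; W] by rewrite -vis_state_cat.
  have -> : vis_state [:: X; Y] = vis_state [:: X] ++ vis_state [:: Y] by rewrite -vis_state_cat.
  rewrite ev_tens /=; first last.
  - by rewrite (@size_vis_state _ [:: k]) // mem_states1.
  - by rewrite (@size_vis_state _ [:: k]) // mem_states1.
  rewrite -vis_state_cat !ev_xmerge // ev_id (@vis_state_inj _ [:: k]) ?mem_states1 //.
  by rewrite eqseq_cons andbT; ring.
rewrite [RHS]big_delta ?slice_uniq //.
under eq_bigr => X _ do rewrite big_delta ?slice_uniq //.
rewrite !big_slice.
transitivity (\sum_(X <- cube n) merge_coef T V X * merge_coef X W U); last first.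
  rewrite (merge_coef_assoc th sT sV sW (slice_size hU)); apply: eq_bigr => X _.
  have [->|nz] := eqVneq (merge_coef V W X) 0; first by rewrite !mul0r mulr0.
  have [_ _ e] := merge_coef_supp nz.
  by rewrite e PoszD (ones_slice hV) (ones_slice hW) eqxx mul1r.
apply: eq_bigr => X _.
have [->|nz] := eqVneq (merge_coef T V X) 0; first by rewrite !mul0r mulr0.
have [_ _ e] := merge_coef_supp nz.
by rewrite e PoszD (ones_slice hT) (ones_slice hV) eqxx mul1r.
Qed.

Lemma rung_coef_hat S T S' T' : size S = n -> rung_coef S T S' T' != 0 ->
  in_hatI n (ones S')%:Z /\ in_hatI n (ones T')%:Z.
Proof.
move=> sS /rung_coef_supp[e1 e2 e3 _ _]; have := ones_size S'; have := ones_size T'.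
by rewrite /in_hatI => h1 h2; split; lia.
Qed.

Lemma ev_FF (r s : nat) k l T V T' V' :
  T \in slice k -> V \in slice l ->
  T' \in slice (k - s%:Z - r%:Z) -> V' \in slice (l + s%:Z + r%:Z) ->
  ev (Comp (rungF n r (k - s%:Z) (l + s%:Z)) (rungF n s k l)) (vis_state [:: T; V]) (vis_state [:: T'; V'])
  = squash_sum th n r T V T' V'.
Proof.
move=> hT hV hT' hV'.
have [hk hl] := (slice_hat hT, slice_hat hV).
have [hk' hl'] := (slice_hat hT', slice_hat hV').
have [hks hls] : in_hatI n (k - s%:Z) /\ in_hatI n (l + s%:Z).
  by move: hk hl hk' hl'; rewrite /in_hatI; split; lia.
rewrite ev_comp ?cod_rungF ?dom_rungF // big_vis ?big_states1; last by rewrite /= hks hls.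
rewrite big_slice /=; apply: eq_big_seq => P; rewrite mem_cube => /eqP sP.
have -> : ((ones P)%:Z - (ones T')%:Z == r) = ((ones P)%:Z == k - s%:Z).
  by rewrite (ones_slice hT'); apply/eqP/eqP; clear; lia.
case: eqP => eP; last first.
  by rewrite mul0r big1 // => Q _; rewrite mul0r.
have hP : P \in slice (k - s%:Z) by rewrite mem_slice sP eP !eqxx.
rewrite mul1r big_states1 big_slice /=; apply: eq_big_seq => Q; rewrite mem_cube => /eqP sQ.
rewrite mul1r big_states0.
case: eqP => eQ.
  have hQ : Q \in slice (l + s%:Z) by rewrite mem_slice sQ eQ !eqxx.
  by rewrite mul1r !ev_rungF.
rewrite mul0r; have [->|nz] := eqVneq (rung_coef T V P Q) 0; first by rewrite mul0r.
have [_ _ _ _ e] := rung_coef_supp nz; have e1 := ones_slice hT; have e2 := ones_slice hV.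
by case: eQ; clear -e e1 e2 eP; lia.
Qed.

Lemma same_rung_squash (r s : nat) k l :
  in_hatI n k -> in_hatI n l ->
  in_hatI n (k - s%:Z - r%:Z) -> in_hatI n (l + s%:Z + r%:Z) ->
  same_ev (vis n [:: k; l]) (vis n [:: k - s%:Z - r%:Z; l + s%:Z + r%:Z])
    (Comp (rungF n r (k - s%:Z) (l + s%:Z)) (rungF n s k l))
    (Scale (qbinom (r + s)%N%:Z r) (rungF n (r + s) k l)).
Proof.
move=> hk hl hk' hl'.
have ek : k - s%:Z - r%:Z = k - (r + s)%N%:Z by lia.
have el : l + s%:Z + r%:Z = l + (r + s)%N%:Z by lia.
split.
- exact: dom_rungF.
- exact: cod_rungF.
- exact: dom_rungF.
- by rewrite ek el; exact: cod_rungF.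
move=> i j /(vis2P hk hl)[T [V [hT hV ->]]] /(vis2P hk' hl')[T' [V' [hT' hV' ->]]].
rewrite ev_FF // ev_scale ev_rungF -?ek -?el // -/(qbin th _ _).
rewrite rung_squash ?(slice_size hT) ?(slice_size hV) ?(slice_size hT') ?(slice_size hV') //.
by congr (qbin _ _ _ * _); rewrite (ones_slice hT) (ones_slice hT'); lia.
Qed.

(** The labels between the two rungs may leave the range 0, ..., n even if those
    at the ends do not; both sides vanish then. *)
Lemma ev_EF (r s : nat) k l T V T' V' :
  T \in slice k -> V \in slice l ->
  T' \in slice (k - s%:Z + r%:Z) -> V' \in slice (l + s%:Z - r%:Z) ->
  ev (Comp (rungE n r (k - s%:Z) (l + s%:Z)) (rungF n s k l)) (vis_state [:: T; V]) (vis_state [:: T'; V'])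
  = EF_sum th n s T V T' V'.
Proof.
move=> hT hV hT' hV'.
have [e1 e2] := (ones_slice hT, ones_slice hV).
have [hk hl] := (slice_hat hT, slice_hat hV).
rewrite ev_comp ?cod_rungF ?dom_rungE //.
have [/andP[hks hls]|out] := boolP (in_hatI n (k - s%:Z) && in_hatI n (l + s%:Z)); last first.
  rewrite big1 => [|u _]; last first.
    by rewrite ev_rungF_out ?mul0r //; apply: contra out => /and4P[_ _ -> ->].
  rewrite /EF_sum big1 // => P _; rewrite big1 // => Q _.
  case: eqP => [eP|_]; last by rewrite mul0r.
  have [->|nz] := eqVneq (rung_coef T V P Q) 0; first by rewrite mul0r mulr0.
  have [h1 h2] := rung_coef_hat (slice_size hT) nz; have [_ _ _ _ e] := rung_coef_supp nz.
  by case/negP: out; move: h1 h2; rewrite /in_hatI; lia.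
rewrite big_vis ?big_states1; last by rewrite /= hks hls.
rewrite big_slice /=; apply: eq_big_seq => P; rewrite mem_cube => /eqP sP.
have -> : ((ones T)%:Z - (ones P)%:Z == s) = ((ones P)%:Z == k - s%:Z).
  by rewrite e1; apply/eqP/eqP; clear; lia.
case: eqP => eP; last first.
  by rewrite mul0r big1 // => Q _; rewrite mul0r.
have hP : P \in slice (k - s%:Z) by rewrite mem_slice sP eP !eqxx.
rewrite mul1r big_states1 big_slice /=; apply: eq_big_seq => Q; rewrite mem_cube => /eqP sQ.
rewrite mul1r big_states0.
case: eqP => eQ.
  have hQ : Q \in slice (l + s%:Z) by rewrite mem_slice sQ eQ !eqxx.
  by rewrite mul1r ev_rungF // ev_rungE.
rewrite mul0r; have [->|nz] := eqVneq (rung_coef T V P Q) 0; first by rewrite mul0r.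
have [_ _ _ _ e] := rung_coef_supp nz.
by case: eQ; clear -e e1 e2 eP; lia.
Qed.

Lemma ev_FE (r s : nat) k l T V T' V' :
  T \in slice k -> V \in slice l ->
  T' \in slice (k + r%:Z - s%:Z) -> V' \in slice (l - r%:Z + s%:Z) ->
  ev (Comp (rungF n s (k + r%:Z) (l - r%:Z)) (rungE n r k l)) (vis_state [:: T; V]) (vis_state [:: T'; V'])
  = FE_sum th n r T V T' V'.
Proof.
move=> hT hV hT' hV'.
have [e1 e2] := (ones_slice hT, ones_slice hV).
have [hk hl] := (slice_hat hT, slice_hat hV).
rewrite ev_comp ?cod_rungE ?dom_rungF //.
have [/andP[hks hls]|out] := boolP (in_hatI n (k + r%:Z) && in_hatI n (l - r%:Z)); last first.
  rewrite big1 => [|u _]; last first.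
    by rewrite ev_rungE_out ?mul0r //; apply: contra out => /and4P[_ _ -> ->].
  rewrite /FE_sum big_seq big1 // => P; rewrite mem_cube => /eqP sP; rewrite big1 // => Q _.
  case: eqP => [eP|_]; last by rewrite mul0r.
  have [->|nz] := eqVneq (rung_coef P Q T V) 0; first by rewrite mul0r mulr0.
  have [_ _ e3 _ e] := rung_coef_supp nz.
  have := ones_size P; have := ones_size Q; rewrite -e3 sP => h1 h2.
  by case/negP: out; rewrite /in_hatI; lia.
rewrite big_vis ?big_states1; last by rewrite /= hks hls.
rewrite big_slice /=; apply: eq_big_seq => P; rewrite mem_cube => /eqP sP.
have -> : ((ones P)%:Z - (ones T)%:Z == r) = ((ones P)%:Z == k + r%:Z).
  by rewrite e1; apply/eqP/eqP; clear; lia.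
case: eqP => eP; last first.
  by rewrite mul0r big1 // => Q _; rewrite mul0r.
have hP : P \in slice (k + r%:Z) by rewrite mem_slice sP eP !eqxx.
rewrite mul1r big_states1 big_slice /=; apply: eq_big_seq => Q; rewrite mem_cube => /eqP sQ.
rewrite mul1r big_states0.
case: eqP => eQ.
  have hQ : Q \in slice (l - r%:Z) by rewrite mem_slice sQ eQ !eqxx.
  by rewrite mul1r ev_rungF // ev_rungE.
rewrite mul0r; have [->|nz] := eqVneq (rung_coef P Q T V) 0; first by rewrite mul0r.
have [_ _ _ _ e] := rung_coef_supp nz.
by case: eQ; clear -e e1 e2 eP; lia.
Qed.

(** The rung F after E^(j) would have a negative crossbar. *)
Lemma FE_sum_small j T V T' V' :
  j < (ones T')%:Z - (ones T)%:Z -> FE_sum th n j T V T' V' = 0.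
Proof.
move=> lt; rewrite /FE_sum big1 // => P _; rewrite big1 // => Q _.
have [->|/rung_coef_supp[_ _ _ le _]] := eqVneq (rung_coef P Q T' V') 0; first by rewrite !mulr0.
by case: eqP => [E|_]; [lia | rewrite mul0r].
Qed.

Lemma lsum_ends w z ts : (forall t, List.In t ts -> dom t = w /\ cod t = z) ->
  dom (lsum w z ts) = w /\ cod (lsum w z ts) = z.
Proof. by case: ts => //= t ts h; apply: h; left. Qed.

Lemma ev_lsum w z ts i j : (forall t, List.In t ts -> dom t = w /\ cod t = z) ->
  ev (lsum w z ts) i j = \sum_(t <- ts) ev t i j.
Proof.
elim: ts => [|t ts IH] h; first by rewrite big_nil.
have h' u : List.In u ts -> dom u = w /\ cod u = z by move=> hu; apply: h; right.
have [d c] := lsum_ends h'; have [d' c'] : dom t = w /\ cod t = z by apply: h; left.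
by rewrite big_cons -IH // [lsum _ _ _]/= ev_add // ?d ?c.
Qed.

Lemma same_rung_swap (r s : nat) k l :
  in_hatI n k -> in_hatI n l ->
  in_hatI n (k - s%:Z + r%:Z) -> in_hatI n (l + s%:Z - r%:Z) ->
  same_ev (vis n [:: k; l]) (vis n [:: k - s%:Z + r%:Z; l + s%:Z - r%:Z])
    (Comp (rungE n r (k - s%:Z) (l + s%:Z)) (rungF n s k l))
    (lsum (vis n [:: k; l])
          (vis n [:: k - s%:Z + r%:Z; l + s%:Z - r%:Z])
       [seq Scale (qbinom (k - l + r%:Z - s%:Z) t)
              (Comp (rungF n (s - t) (k + (r - t)%N%:Z) (l - (r - t)%N%:Z))
                    (rungE n (r - t) k l))
       | t <- iota 0 (minn r s).+1]).
Proof.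
move=> hk hl hk' hl'.
set w := vis n [:: k; l]; set z := vis n _.
have lab t : t \in iota 0 (minn r s).+1 ->
    k + (r - t)%N%:Z - (s - t)%N%:Z = k - s%:Z + r%:Z /\
    l - (r - t)%N%:Z + (s - t)%N%:Z = l + s%:Z - r%:Z.
  by rewrite mem_iota; split; lia.
have ends t : List.In t [seq Scale (qbinom (k - l + r%:Z - s%:Z) t)
              (Comp (rungF n (s - t) (k + (r - t)%N%:Z) (l - (r - t)%N%:Z))
                    (rungE n (r - t) k l)) | t <- iota 0 (minn r s).+1] ->
    dom t = w /\ cod t = z.
  elim: (iota _ _) lab => //= u us IH lab' [<-|].
    have [ek el] := lab' u (mem_head _ _).
    by rewrite /z -ek -el; split; [exact: dom_rungE | exact: cod_rungF].
  by apply: IH => v hv; apply: lab'; rewrite inE hv orbT.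
have [dl cl] := lsum_ends ends.
split; rewrite ?dl ?cl //; [exact: dom_rungF | exact: cod_rungE | ].
move=> i j /(vis2P hk hl)[T [V [hT hV ->]]] /(vis2P hk' hl')[T' [V' [hT' hV' ->]]].
have [[e1 e2] e3] := (ones_slice hT, ones_slice hV, ones_slice hT').
rewrite ev_EF // ev_lsum // big_map.
rewrite (@rung_swap _ _ n r.+1) ?(slice_size hT) ?(slice_size hV) ?(slice_size hT') ?(slice_size hV') //; last by lia.
have -> : s%:Z + (ones T')%:Z - (ones T)%:Z = r by lia.
have -> : (ones T')%:Z - (ones V)%:Z = k - l + r%:Z - s%:Z by lia.
transitivity (\sum_(t < (minn r s).+1) qbin th (k - l + r%:Z - s%:Z) t * FE_sum th n (r%:Z - t%:Z) T V T' V').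
  have le : ((minn r s).+1 <= r.+1)%N by lia.
  rewrite (big_ord_widen _ (fun t : nat => qbin th (k - l + r%:Z - s%:Z) t * FE_sum th n (r%:Z - t%:Z) T V T' V') le).
  rewrite [RHS]big_mkcond; apply: eq_bigr => t _; case: ifP => // /negbT nt.
  by rewrite FE_sum_small ?mulr0 //; have := ltn_ord t; lia.
rewrite -(big_mkord xpredT (fun t : nat => qbin th (k - l + r%:Z - s%:Z) t * FE_sum th n (r%:Z - t%:Z) T V T' V')).
rewrite /index_iota subn0; apply: eq_big_seq => t ht.
have [ek el] := lab t ht.
rewrite ev_scale -/(qbin th _ _) ev_FE ?ek ?el //.
by congr (_ * FE_sum _ _ _ _ _ _ _); move: ht; rewrite mem_iota; lia.
Qed.

Lemma same_bar w z t u : same_ev w z t u -> same_ev z w (bar t) (bar u).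
Proof.
move=> [d1 c1 d2 c2 e]; split; rewrite ?dom_bar ?cod_bar // => i j hi hj.
by rewrite !ev_bar e.
Qed.

Lemma same_mirror w z t u : same_ev w z t u -> same_ev (rev w) (rev z) (mirror t) (mirror u).
Proof.
move=> [d1 c1 d2 c2 e]; split; rewrite ?dom_mirror ?cod_mirror ?d1 ?c1 ?d2 ?c2 // => i j hi hj.
rewrite -[i]flip_stateK -[j]flip_stateK.
have hi' : flip_state i \in states w by rewrite -mem_flip_state flip_stateK.
have hj' : flip_state j \in states z by rewrite -mem_flip_state flip_stateK.
by rewrite ev_mirror ?d1 ?c1 // ev_mirror ?d2 ?c2 // e.
Qed.

Lemma web_rel_sound w z t u : web_rel n w z t u -> same_ev w z t u.
Proof.
elim=> {w z t u}.
- exact: same_tag_switch.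
- exact: same_tag_cancel.
- exact: same_bigon.
- exact: same_close.
- exact: same_circle.
- exact: same_assoc.
- exact: same_rung_squash.
- exact: same_rung_swap.
- by move=> w z t u _; exact: same_mirror.
- by move=> w z t u _; exact: same_bar.
Qed.

(** Apart from the defining relations and isotopy, only the bilinearity of the
    matrix product is left. *)
Theorem weq_sound w z t u : weq n w z t u -> same_ev w z t u.
Proof.
elim=> {w z t u}.
- by move=> w z t u; exact: web_rel_sound.
- exact: same_refl.
- by move=> w z t u _; exact: same_sym.
- by move=> w z t u v _ h _; exact: same_trans h.
- by move=> w x z t t' u u' _ h _; exact: same_comp h.
- by move=> w z t t' w' z' u u' _ h _; exact: same_tens h.
- move=> w z t t' u u' _ [d1 c1 d2 c2 e] _ [d3 c3 d4 c4 e']; split => // i j hi hj.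
  by rewrite ev_add ?d1 ?d3 ?c1 ?c3 // [RHS]ev_add ?d2 ?d4 ?c2 ?c4 // e // e'.
- move=> w z c t t' _ [d1 c1 d2 c2 e]; split => // i j hi hj.
  by rewrite !ev_scale e.
- exact: same_compl.
- exact: same_compr.
- exact: same_compA.
- exact: same_tensl.
- exact: same_tensr.
- exact: same_tensA.
- by move=> w w' _ _; exact: same_tens_id.
- exact: same_interchange.
- move=> w z t u v /is_homP[d1 c1] /is_homP[d2 c2] /is_homP[d3 c3].
  by split=> //= i j hi hj; rewrite !ev_add ?d1 ?d2 ?d3 ?c1 ?c2 ?c3 //= ?d2 ?c2 // addrA.
- move=> w z t u /is_homP[d1 c1] /is_homP[d2 c2].
  by split=> //= i j hi hj; rewrite !ev_add ?d1 ?d2 ?c1 ?c2 // addrC.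
- move=> w z t /is_homP[d1 c1].
  by split=> //= i j hi hj; rewrite ev_add ?d1 ?c1 //= ev_zero add0r.
- move=> w z t /is_homP[d1 c1]; split=> //= i j hi hj.
  by rewrite ev_add // ev_scale ev_zero qevalN qeval1 mulN1r addNr.
- move=> w z t /is_homP[d1 c1]; split=> //= i j hi hj.
  by rewrite ev_scale qeval1 mul1r.
- move=> w z b c t /is_homP[d1 c1]; split=> //= i j hi hj.
  by rewrite !ev_scale qevalM mulrA.
- move=> w z b c t /is_homP[d1 c1]; split=> //= i j hi hj.
  by rewrite ev_add // !ev_scale qevalD mulrDl.
- move=> w z c t u /is_homP[d1 c1] /is_homP[d2 c2]; split=> //= i j hi hj.
  by rewrite ev_add /= ?d1 ?d2 ?c1 ?c2 // !ev_scale ev_add ?d1 ?d2 ?c1 ?c2 // mulrDr.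
- move=> w x z t u v /is_homP[d1 c1] /is_homP[d2 c2] /is_homP[d3 c3]; split=> //= i j hi hj.
  rewrite ev_add /= ?c2 ?c3 // !ev_comp /= ?c1 ?d2 ?d3 // -big_split /=.
  by apply: eq_bigr => k _; rewrite ev_add ?d2 ?d3 ?c2 ?c3 // mulrDr.
- move=> w x z t u v /is_homP[d1 c1] /is_homP[d2 c2] /is_homP[d3 c3]; split=> //= i j hi hj.
  rewrite ev_add /= ?d1 ?d2 // !ev_comp /= ?c1 ?c2 ?d3 // -big_split /=.
  by apply: eq_bigr => k _; rewrite ev_add ?d1 ?d2 ?c1 ?c2 // mulrDl.
- move=> w x z c t u /is_homP[d1 c1] /is_homP[d2 c2]; split=> //= i j hi hj.
  rewrite ev_scale !ev_comp /= ?c1 ?d2 // big_distrr /=.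
  by apply: eq_bigr => k _; rewrite ev_scale mulrCA.
- move=> w x z c t u /is_homP[d1 c1] /is_homP[d2 c2]; split=> //= i j hi hj.
  rewrite ev_scale !ev_comp /= ?c1 ?d2 // big_distrr /=.
  by apply: eq_bigr => k _; rewrite ev_scale mulrA.
- move=> w z t u w' z' v /is_homP[d1 c1] /is_homP[d2 c2] /is_homP[d3 c3].
  split; rewrite /= ?d1 ?c1 ?d3 ?c3 // => i j /split_states[i1 i2 hi1 hi2] /split_states[j1 j2 hj1 hj2].
  rewrite ev_add /= ?d1 ?d2 ?c1 ?c2 //.
  rewrite !ev_tens /= ?d1 ?c1 ?d2 ?c2 ?(size_states hi1) ?(size_states hj1) //.
  by rewrite ev_add ?d1 ?d2 ?c1 ?c2 // mulrDl.
- move=> w z t w' z' u v /is_homP[d1 c1] /is_homP[d2 c2] /is_homP[d3 c3].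
  split; rewrite /= ?d1 ?c1 ?d2 ?c2 // => i j /split_states[i1 i2 hi1 hi2] /split_states[j1 j2 hj1 hj2].
  rewrite ev_add /= ?d2 ?d3 ?c2 ?c3 //.
  rewrite !ev_tens /= ?d1 ?c1 ?(size_states hi1) ?(size_states hj1) //.
  by rewrite ev_add ?d2 ?d3 ?c2 ?c3 // mulrDr.
- move=> w z c t w' z' u /is_homP[d1 c1] /is_homP[d2 c2].
  split; rewrite /= ?d1 ?c1 ?d2 ?c2 // => i j /split_states[i1 i2 hi1 hi2] /split_states[j1 j2 hj1 hj2].
  by rewrite ev_scale !ev_tens /= ?d1 ?c1 ?(size_states hi1) ?(size_states hj1) // ev_scale mulrA.
- move=> w z t w' z' c u /is_homP[d1 c1] /is_homP[d2 c2].
  split; rewrite /= ?d1 ?c1 ?d2 ?c2 // => i j /split_states[i1 i2 hi1 hi2] /split_states[j1 j2 hj1 hj2].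
  by rewrite ev_scale !ev_tens /= ?d1 ?c1 ?(size_states hi1) ?(size_states hj1) // ev_scale mulrCA.
- by move=> x _; exact: same_zigzag_right.
- by move=> x _; exact: same_zigzag_left.
- by move=> v _; exact: same_rotate.
Qed.

End Functor.

(** * Ladders on extended states *)

Definition state_height (i : seq bits) : int := \sum_(T <- i) height T.

Lemma state_height_cons T i : state_height (T :: i) = height T + state_height i.
Proof. exact: big_cons. Qed.

Lemma state_height_nil : state_height [::] = 0.
Proof. exact: big_nil. Qed.

Lemma state_height_cat i j : state_height (i ++ j) = state_height i + state_height j.
Proof. exact: big_cat. Qed.

(** The tensor product of the highest weight vectors of the factors. *)
Definition highest (n : nat) (a : seq int) : seq bits := [seq top n (absz k) | k <- a].

Lemma highest_rcons n b k : highest n (rcons b k) = rcons (highest n b) (top n (absz k)).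
Proof. exact: map_rcons. Qed.

Section Highest.

Variable n : nat.
Notation states := (states n).
Notation slice := (slice n).
Notation highest := (highest n).

Lemma state_height_vis k i : i \in states (upobj k) -> state_height (vis_state n i) = state_height i.
Proof.
elim: k i => [|k ks IH] i; first by rewrite mem_states0 => /eqP ->.
rewrite mem_states_cons; case: i => // T i /andP[hT hi].
rewrite vis_state_cons state_height_cat state_height_cons (IH _ hi) -(in_I_slice hT); congr (_ + _).
case: ifPn => Ik; rewrite ?state_height_cons state_height_nil ?addr0 //.
by have [e|e] := hat_cases (slice_hat hT) Ik; move: hT;
  rewrite e ?slice0 ?slicen => /eqP ->; rewrite height_nseq.
Qed.

Lemma top_slice k : in_hatI n k -> top n (absz k) \in slice k.
Proof.
move=> hk; have le : (absz k <= n)%N by move: hk; rewrite /in_hatI; lia.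
rewrite mem_slice size_top // ones_top // eqxx /=.
by apply/eqP; move: hk; rewrite /in_hatI; lia.
Qed.

Lemma highest_states b : all (in_hatI n) b -> highest b \in states (upobj b).
Proof.
elim: b => [|k b IH] //= /andP[hk hb].
by rewrite mem_states_cons top_slice // IH.
Qed.

Lemma height_le k T : T \in slice k -> height T <= height (top n (absz k)).
Proof.
move=> hT; have := height_top_le T; have := top_slice (slice_hat hT).
have := slice_size hT; have := ones_slice hT; have := ones_size T.
move=> h1 h2 h3 _ h5; rewrite height_top; last by rewrite -h2 absz_nat -h3.
by move: h5; rewrite h3 h2; lia.
Qed.

Lemma height_eq k T : T \in slice k -> height T = height (top n (absz k)) -> T = top n (absz k).
Proof.
move=> hT; have := ones_slice hT; have := slice_size hT; have := ones_size T.
move=> h1 h2 h3; rewrite height_top; last by rewrite -h3 absz_nat -h2.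
rewrite -h3 absz_nat -h2 => e; exact: height_top_eq.
Qed.

(** Together with the next lemma this lets the highest weight vector be
    recognised by its height alone, which webs preserve. *)
Lemma state_height_le b i : i \in states (upobj b) -> state_height i <= state_height (highest b).
Proof.
elim: b i => [|k b IH] i; first by rewrite mem_states0 => /eqP ->.
rewrite mem_states_cons; case: i => // T i /andP[/= /height_le le1 /IH le2].
by rewrite !state_height_cons lerD.
Qed.

Lemma state_height_eq b i : i \in states (upobj b) -> state_height i = state_height (highest b) -> i = highest b.
Proof.
elim: b i => [|k b IH] i; first by rewrite mem_states0 => /eqP ->.
rewrite mem_states_cons; case: i => // T i /andP[/= hT hi].
rewrite !state_height_cons => e; have le1 := height_le hT; have le2 := state_height_le hi.
have e1 : height T = height (top n (absz k)).
  by apply/eqP; rewrite eq_le le1 /= -(lerD2r (state_height i)) e lerD2l.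
have e2 : state_height i = state_height (highest b) by move: e; rewrite e1 => /addrI.
by rewrite {1}(height_eq hT e1) {1}(IH i hi e2).
Qed.

Lemma vis_state_highest b : all (in_hatI n) b -> vis_state n (highest b) = highest (strip n b).
Proof.
elim: b => [|k b IH] //= /andP[hk hb].
rewrite vis_state_cons -(in_I_slice (top_slice hk)) IH //.
by case: ifP.
Qed.

End Highest.

Section Coefficients.

Variables (R : realFieldType) (th : param R) (n : nat).
Notation rung_coef := (rung_coef th).
Notation ev := (ev th n).
Notation states := (states n).
Notation slice := (slice n).
Notation vis_state := (vis_state n).
Notation highest := (highest n).

Lemma sum_neq0 (I : eqType) (r : seq I) (G : I -> R) :
  \sum_(i <- r) G i != 0 -> exists2 i, i \in r & G i != 0.
Proof.
move=> nz; apply/hasP; apply: contraNT nz => /hasPn h.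
by rewrite big_seq big1 // => i /h; rewrite negbK => /eqP.
Qed.

Definition tilted_coef (r : rung) (T V T' V' : bits) : R :=
  if northeast r then rung_coef T V T' V' else rung_coef T' V' T V.

Definition step_coef (r : rung) (i j : seq bits) : R :=
  let p := pos r in
  (take p i == take p j)%:R *
  (tilted_coef r (nth [::] i p) (nth [::] i p.+1) (nth [::] j p) (nth [::] j p.+1) *
   (drop p.+2 i == drop p.+2 j)%:R).

(** The matrix of a ladder before the labels 0 and n are erased. *)
Fixpoint ladder_coef (L : ladder) (b : seq int) (i j : seq bits) : R :=
  if L is r :: L' then
    \sum_(k <- states (upobj (rung_top r b))) step_coef r i k * ladder_coef L' (rung_top r b) k j
  else (i == j)%:R.

Lemma split_at (T : Type) (x0 : T) (b : seq T) p : (p.+1 < size b)%N ->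
  b = take p b ++ [:: nth x0 b p; nth x0 b p.+1] ++ drop p.+2 b.
Proof.
move=> lt; rewrite -{1}(cat_take_drop p b); congr (_ ++ _).
by rewrite (drop_nth x0 (ltnW lt)) (drop_nth x0 lt).
Qed.

Lemma take_mid (T : Type) (x0 : T) p (k1 k2 : seq T) A B : size k1 = p ->
  [/\ take p (k1 ++ [:: A; B] ++ k2) = k1, nth x0 (k1 ++ [:: A; B] ++ k2) p = A,
      nth x0 (k1 ++ [:: A; B] ++ k2) p.+1 = B & drop p.+2 (k1 ++ [:: A; B] ++ k2) = k2].
Proof.
move=> <-; split; first exact: take_size_cat.
- by rewrite nth_cat ltnn subnn.
- by rewrite nth_cat ltnNge leqnSn subSnn.
by elim: k1 {p} => [|C k1 IH] /=; rewrite ?drop0.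
Qed.

Lemma size_upobj b : size (upobj b) = size b.
Proof. exact: size_map. Qed.

Lemma upobj_cat b c : upobj (b ++ c) = upobj b ++ upobj c.
Proof. exact: map_cat. Qed.

Lemma step_coef_mid r i1 T V i2 j1 T' V' j2 : size i1 = pos r -> size j1 = pos r ->
  step_coef r (i1 ++ [:: T; V] ++ i2) (j1 ++ [:: T'; V'] ++ j2) =
  (i1 == j1)%:R * (tilted_coef r T V T' V' * (i2 == j2)%:R).
Proof.
move=> si sj; rewrite /step_coef /=.
have [-> -> -> ->] := take_mid [::] i2 T V si.
by have [-> -> -> ->] := take_mid [::] j2 T' V' sj.
Qed.

Lemma rung_top_mid r b1 k l b2 : size b1 = pos r ->
  rung_top r (b1 ++ [:: k; l] ++ b2) =
  b1 ++ [:: if northeast r then k - (crossbar r)%:Z else k + (crossbar r)%:Z;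
            if northeast r then l + (crossbar r)%:Z else l - (crossbar r)%:Z] ++ b2.
Proof.
move=> sb; rewrite /rung_top /rung_left /rung_right.
by have [-> -> -> ->] := take_mid 0 b2 k l sb.
Qed.

Lemma rung_web_mid r b1 k l b2 : size b1 = pos r ->
  rung_web n r (b1 ++ [:: k; l] ++ b2) =
  Tens (Id (vis n b1))
    (Tens ((if northeast r then rungF else rungE) n (crossbar r) k l) (Id (vis n b2))).
Proof.
move=> sb; rewrite /rung_web.
by have [-> -> -> ->] := take_mid 0 b2 k l sb.
Qed.

Lemma rung_mid r (b : seq int) : ((pos r).+1 < size b)%N ->
  exists b1 k l b2, size b1 = pos r /\ b = b1 ++ [:: k; l] ++ b2.
Proof.
move=> lt; exists (take (pos r) b), b`_(pos r), b`_(pos r).+1, (drop (pos r).+2 b).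
by split; [rewrite size_take; case: ltnP => //; lia | exact: split_at].
Qed.

Variant mid_state_spec b1 (k l : int) b2 : seq bits -> Prop :=
  MidState i1 T V i2 of i1 \in states (upobj b1) & T \in slice k & V \in slice l
    & i2 \in states (upobj b2) : mid_state_spec b1 k l b2 (i1 ++ [:: T; V] ++ i2).

Lemma mid_stateP b1 k l b2 i : i \in states (upobj (b1 ++ [:: k; l] ++ b2)) ->
  mid_state_spec b1 k l b2 i.
Proof.
rewrite !upobj_cat => /split_states[i1 _ h1 /split_states[_ i2 /states2P[T [V [hT hV ->]]] h2]].
by constructor.
Qed.

Lemma ends_rung r b : ((pos r).+1 < size b)%N ->
  dom (rung_web n r b) = vis n b /\ cod (rung_web n r b) = vis n (rung_top r b).
Proof.
move=> /rung_mid[b1 [k [l [b2 [sb ->]]]]].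
rewrite rung_web_mid // rung_top_mid // !vis_cat /=.
by case: (northeast r); rewrite ?dom_rungF ?cod_rungF ?dom_rungE ?cod_rungE.
Qed.

Lemma ev_rung r b i j : ((pos r).+1 < size b)%N ->
  i \in states (upobj b) -> j \in states (upobj (rung_top r b)) ->
  ev (rung_web n r b) (vis_state i) (vis_state j) = step_coef r i j.
Proof.
move=> /rung_mid[b1 [k [l [b2 [sb ->]]]]]; rewrite rung_top_mid //.
move=> /mid_stateP[i1 T V i2 hi1 hT hV hi2] /mid_stateP[j1 T' V' j2 hj1 hT' hV' hj2].
rewrite rung_web_mid // step_coef_mid; first last.
- by rewrite (size_states hj1) size_upobj.
- by rewrite (size_states hi1) size_upobj.
rewrite !vis_state_cat ev_tens /= ?(size_vis_state hi1) ?(size_vis_state hj1) //.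
rewrite ev_id (vis_state_inj hi1 hj1) ev_tens; first last.
- move: hT' hV'; case: (northeast r) => hT' hV'; rewrite ?cod_rungF ?cod_rungE.
    by rewrite (@size_vis_state _ [:: k - (crossbar r)%:Z; l + (crossbar r)%:Z]) ?mem_states2.
  by rewrite (@size_vis_state _ [:: k + (crossbar r)%:Z; l - (crossbar r)%:Z]) ?mem_states2.
- rewrite (@size_vis_state _ [:: k; l]) ?mem_states2 //.
  by case: (northeast r); rewrite ?dom_rungF ?dom_rungE.
rewrite ev_id (vis_state_inj hi2 hj2) /tilted_coef; congr (_ * (_ * _)).
by move: hT' hV'; case: (northeast r) => hT' hV'; rewrite ?ev_rungF ?ev_rungE.
Qed.

Lemma is_ladder_hat L b : is_ladder n L b -> all (in_hatI n) b.
Proof. by case: L => [|r L] /andP[]. Qed.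

Lemma is_ladder_top L b : is_ladder n L b -> all (in_hatI n) (ladder_top L b).
Proof.
by elim: L b => [|r L IH] b /= /andP[// hb /andP[_ /IH]].
Qed.

Lemma ends_ladder L b : is_ladder n L b ->
  dom (ladder_web n L b) = vis n b /\ cod (ladder_web n L b) = vis n (ladder_top L b).
Proof.
elim: L b => [|r L IH] b //= /andP[hb /andP[lt /IH[_ ->]]].
by split => //; have [] := ends_rung lt.
Qed.

Lemma ev_ladder L b i j : is_ladder n L b ->
  i \in states (upobj b) -> j \in states (upobj (ladder_top L b)) ->
  ev (ladder_web n L b) (vis_state i) (vis_state j) = ladder_coef L b i j.
Proof.
elim: L b i => [|r L IH] b i.
  by move=> _ hi hj; rewrite /= ev_id (vis_state_inj hi hj).
move=> /andP[hb /andP[lt hL]] hi hj.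
have [dr cr] := ends_rung lt; have [dl cl] := ends_ladder hL.
rewrite [ladder_web _ _ _]/= ev_comp ?dl ?cr // big_vis ?(is_ladder_hat hL) //.
by apply: eq_big_seq => k hk; rewrite IH // ev_rung.
Qed.

Lemma step_coef_height r b i j : ((pos r).+1 < size b)%N ->
  i \in states (upobj b) -> j \in states (upobj (rung_top r b)) ->
  step_coef r i j != 0 -> state_height i = state_height j.
Proof.
move=> /rung_mid[b1 [k [l [b2 [sb ->]]]]]; rewrite rung_top_mid //.
move=> /mid_stateP[i1 T V i2 hi1 hT hV hi2] /mid_stateP[j1 T' V' j2 hj1 hT' hV' hj2].
rewrite step_coef_mid; first last.
- by rewrite (size_states hj1) size_upobj.
- by rewrite (size_states hi1) size_upobj.
case: (i1 =P j1) => [->|_]; last by rewrite mul0r eqxx.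
case: (i2 =P j2) => [->|_]; last by rewrite !mulr0 eqxx.
rewrite mul1r mulr1 => nz; rewrite !state_height_cat !state_height_cons state_height_nil !addr0.
have -> // : height T + height V = height T' + height V'.
by move: nz; rewrite /tilted_coef; case: ifP => _ /rung_coef_height.
Qed.

Lemma ladder_coef_height L b i j : is_ladder n L b ->
  i \in states (upobj b) -> j \in states (upobj (ladder_top L b)) ->
  ladder_coef L b i j != 0 -> state_height i = state_height j.
Proof.
elim: L b i => [|r L IH] b i.
  by move=> _ _ _ /=; case: (i =P j) => [->//|_]; rewrite eqxx.
move=> /andP[hb /andP[lt hL]] hi hj /sum_neq0[k hk].
rewrite mulf_eq0 => /norP[nz1 nz2].
by rewrite (step_coef_height lt hi hk nz1) (IH _ _ hL hk hj nz2).
Qed.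

(** * Neutral ladders *)

Lemma rung_coef_diag T V : size T = n -> size V = n -> rung_coef T V T V != 0.
Proof.
move: n => m; elim: m T V => [|m IH] [|b T] [|c V] //.
  by move=> _ _; rewrite rung_coef_nil oner_eq0.
by move=> [e1] [e2]; rewrite rung_coef_cons_neq0 IH // /rung_ok !eqxx.
Qed.

Lemma rung_coef_cat_neq0 S1 S2 T1 T2 S1' S2' T1' T2' :
  size S1 = size T1 -> size S1 = size S1' -> size S1 = size T1' ->
  (rung_coef (S1 ++ S2) (T1 ++ T2) (S1' ++ S2') (T1' ++ T2') != 0) =
  (rung_coef S1 T1 S1' T1' != 0) && (rung_coef S2 T2 S2' T2' != 0).
Proof.
elim: S1 T1 S1' T1' => [|b S1 IH] [|c T1] [|b' S1'] [|c' T1'] //.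
  by rewrite rung_coef_nil oner_eq0.
by move=> [e1] [e2] [e3]; rewrite !cat_cons !rung_coef_cons_neq0 IH // andbA.
Qed.

Lemma rung_coef_const_neq0 m b c b' c' :
  (rung_coef (nseq m b) (nseq m c) (nseq m b') (nseq m c') != 0) = (m == 0)%N || rung_ok b c b' c'.
Proof.
elim: m => [|m IH]; first by rewrite rung_coef_nil oner_eq0.
by rewrite rung_coef_cons_neq0 IH /=; case: rung_ok; rewrite ?orbT.
Qed.

(** The crossbar moves exactly the elements in which the two strings differ. *)
Lemma rung_coef_top_swap k l : (l <= k <= n)%N ->
  rung_coef (top n k) (top n l) (top n l) (top n k) != 0.
Proof.
move=> /andP[le1 le2].
have tk : top n k = nseq l true ++ nseq (k - l) true ++ nseq (n - k) false.
  by rewrite /top catA -nseqD subnKC.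
have tl : top n l = nseq l true ++ nseq (k - l) false ++ nseq (n - k) false.
  by rewrite /top -nseqD; congr (_ ++ nseq _ _); lia.
by rewrite tk tl !rung_coef_cat_neq0 ?size_nseq // !rung_coef_const_neq0 !orbT.
Qed.

Lemma state_height_perm i j : perm_eq i j -> state_height i = state_height j.
Proof. by move=> e; apply: perm_big. Qed.

Lemma highest_cat b c : highest (b ++ c) = highest b ++ highest c.
Proof. exact: map_cat. Qed.

Lemma size_highest b : size (highest b) = size b.
Proof. exact: size_map. Qed.

Lemma perm_pair (T : eqType) (x y x' y' : T) : perm_eq [:: x; y] [:: x'; y'] ->
  (x' = x /\ y' = y) \/ (x' = y /\ y' = x).
Proof.
move=> e; have := perm_mem e x'; have := perm_mem e x; rewrite !inE !eqxx /= => h1 h2.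
have [ex|nx] := eqVneq x' x.
  by left; split => //; move: e; rewrite ex perm_cons => /perm_mem/(_ y'); rewrite !inE eqxx => /eqP.
right; move: h2; rewrite (negPf nx) /= => /eqP ey; split => //.
have e' : perm_eq [:: y; x] [:: x'; y'].
  by apply: perm_trans e; rewrite -[[:: y; x]]/([:: y] ++ [:: x]) perm_catC.
by move: e'; rewrite ey perm_cons => /perm_mem/(_ y'); rewrite !inE eqxx => /eqP.
Qed.

Lemma step_coef_neutral r b : ((pos r).+1 < size b)%N -> all (in_hatI n) b ->
  neutral_rung r b -> step_coef r (highest b) (highest (rung_top r b)) != 0 /\ state_height (highest b) = state_height (highest (rung_top r b)).
Proof.
move=> lt hb; have eb := split_at 0 lt; rewrite /neutral_rung.
have -> : rung_top r b = take (pos r) b ++ [:: rung_left r b; rung_right r b] ++ drop (pos r).+2 b by [].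
set k := b`_(pos r) in eb *; set l := b`_(pos r).+1 in eb *.
have kE : rung_left r b = if northeast r then k - (crossbar r)%:Z else k + (crossbar r)%:Z by [].
have lE : rung_right r b = if northeast r then l + (crossbar r)%:Z else l - (crossbar r)%:Z by [].
move: kE lE; set k' := rung_left r b; set l' := rung_right r b => kE lE perm.
have st : size (take (pos r) b) = pos r by rewrite size_take; case: ltnP => //; lia.
split; last first.
  rewrite {1}eb !highest_cat !state_height_cat; congr (_ + (_ + _)).
  by apply: state_height_perm; apply: perm_map.
rewrite {1}eb !highest_cat step_coef_mid ?size_highest // !eqxx mul1r mulr1 /tilted_coef.
have [hk hl] : in_hatI n k /\ in_hatI n l.
  by move: hb; rewrite eb !all_cat /= => /and3P[_ /and3P[-> -> _] _].
have [sk sl] := (slice_size (top_slice hk), slice_size (top_slice hl)).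
move: kE lE; have [[-> ->]|[-> ->]] := perm_pair perm.
  by case: ifP => _ _ _; exact: rung_coef_diag.
move: hk hl; rewrite /in_hatI => hk hl.
by case: ifP => _ ek el; apply: rung_coef_top_swap; lia.
Qed.

(** All the intermediate sequences of labels of a neutral ladder are
    permutations of each other, so their highest states have the same height.
    By conservation of the height the only path between highest states passes
    through highest states, and each of its steps is nonzero. *)
Lemma ladder_coef_neutral L b : is_ladder n L b -> neutral L b ->
  ladder_coef L b (highest b) (highest (ladder_top L b)) != 0.
Proof.
elim: L b => [|r L IH] b; first by rewrite /= eqxx oner_eq0.
move=> /andP[hb /andP[lt hL]] /andP[nr nL].
have [nz eH] := step_coef_neutral lt hb nr.
have hh := highest_states (is_ladder_hat hL).
rewrite [ladder_coef _ _ _ _]/= (bigD1_seq (highest (rung_top r b))) ?states_uniq //=.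
rewrite big1_seq => [|k /andP[ne hk]]; first by rewrite addr0 mulf_neq0 // IH.
have [->|nz'] := eqVneq (step_coef r (highest b) k) 0; first by rewrite mul0r.
have e := step_coef_height lt (highest_states hb) hk nz'.
by case/eqP: ne; apply: state_height_eq hk _; rewrite -e.
Qed.

Lemma neutral_ends w z N : neutral_ladder n w z N -> dom N = upobj w /\ cod N = upobj z.
Proof.
by move=> [b [L [hL _ <- <- ->]]]; have [-> ->] := ends_ladder hL.
Qed.

Lemma neutral_height w z N i j : neutral_ladder n w z N ->
  i \in states (upobj w) -> j \in states (upobj z) -> ev N i j != 0 -> state_height i = state_height j.
Proof.
move=> [b [L [hL _ <- <- ->]]].
move=> /(vis_state_surj (is_ladder_hat hL))[i' hi <-] /(vis_state_surj (is_ladder_top hL))[j' hj <-].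
by rewrite ev_ladder // (state_height_vis hi) (state_height_vis hj) => nz; apply: ladder_coef_height nz.
Qed.

Lemma neutral_highest w z N : neutral_ladder n w z N -> ev N (highest w) (highest z) != 0.
Proof.
move=> [b [L [hL nL <- <- ->]]].
have hb := is_ladder_hat hL; have ht := is_ladder_top hL.
by rewrite -!vis_state_highest // ev_ladder ?highest_states // ladder_coef_neutral.
Qed.

(** * Idle strands *)

Lemma rung_top_cat r b c : ((pos r).+1 < size b)%N ->
  rung_top r (b ++ c) = rung_top r b ++ c.
Proof.
move=> /rung_mid[b1 [k [l [b2 [sb ->]]]]].
by rewrite [X in _ = X ++ _]rung_top_mid // -!catA rung_top_mid.
Qed.

Lemma is_ladder_cat L b c : all (in_hatI n) c -> is_ladder n L b -> is_ladder n L (b ++ c).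
Proof.
move=> hc; elim: L b => [|r L IH] b /=; first by rewrite all_cat hc => /andP[->].
move=> /andP[hb /andP[lt hL]]; by rewrite all_cat hb hc rung_top_cat // IH // size_cat ltn_addr.
Qed.

Lemma ladder_top_cat L b c : is_ladder n L b -> ladder_top L (b ++ c) = ladder_top L b ++ c.
Proof.
elim: L b => [|r L IH] b //= /andP[hb /andP[lt hL]].
by rewrite rung_top_cat // IH.
Qed.

Lemma step_coef_cat r b i j i' j' : ((pos r).+1 < size b)%N ->
  i \in states (upobj b) -> j \in states (upobj (rung_top r b)) ->
  step_coef r (i ++ i') (j ++ j') = step_coef r i j * (i' == j')%:R.
Proof.
move=> /rung_mid[b1 [k [l [b2 [sb ->]]]]]; rewrite rung_top_mid //.
move=> /mid_stateP[i1 T V i2 hi1 hT hV hi2] /mid_stateP[j1 T' V' j2 hj1 hT' hV' hj2].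
have si : size i1 = pos r by rewrite (size_states hi1) size_upobj.
have sj : size j1 = pos r by rewrite (size_states hj1) size_upobj.
rewrite -!catA !step_coef_mid // eqseq_cat; last by rewrite (size_states hi2) (size_states hj2).
by rewrite -mulnb natrM; ring.
Qed.

Lemma ladder_coef_cat L b c i i' j j' : is_ladder n L b ->
  i \in states (upobj b) -> j \in states (upobj (ladder_top L b)) ->
  i' \in states (upobj c) ->
  ladder_coef L (b ++ c) (i ++ i') (j ++ j') = ladder_coef L b i j * (i' == j')%:R.
Proof.
elim: L b i i' => [|r L IH] b i i'.
  move=> _ hi hj _; rewrite /= eqseq_cat; last by rewrite (size_states hi) (size_states hj).
  by rewrite -mulnb natrM.
move=> /andP[hb /andP[lt hL]] hi hj hi'.
rewrite /= rung_top_cat // upobj_cat big_states_cat big_distrl; apply: eq_big_seq => k hk.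
transitivity (\sum_(k' <- states (upobj c)) (i' == k')%:R *
   (step_coef r i k * (ladder_coef L (rung_top r b) k j * (k' == j')%:R))).
  by apply: eq_big_seq => k' hk'; rewrite (step_coef_cat _ _ lt hi hk) IH //; ring.
by rewrite big_delta ?states_uniq //= mulrA.
Qed.

End Coefficients.

(** * Elementary light ladders *)

(** The structure of a 01-sequence as a string of ones and then blocks of zeros
    followed by ones; xs and ys list the ends of the strings of zeros and of
    ones.  Elementary light ladders are analysed by induction on it, one rung
    for each block. *)
Inductive runs : bits -> seq nat -> seq nat -> Prop :=
  | runs_ones y : runs (nseq y true) [::] [:: y]
  | runs_zero mu xs ys : runs mu xs ys -> runs (rcons mu false) xs ys
  | runs_block mu xs ys r : runs mu xs ys -> ~~ last true mu ->
      runs (mu ++ nseq r.+1 true) (rcons xs (size mu)) (rcons ys (size mu + r.+1)%N).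

(** Only the position at which mu ends can become the end of a string of
    zeros. *)
Lemma zero_ends_rcons mu b :
  zero_ends (rcons mu b) =
  zero_ends mu ++ (if b && ~~ last true mu then [:: size mu] else [::]).
Proof.
(* Beyond the end the default entry is 0, so the range can be enlarged. *)
have zE m nu : (size nu <= m)%N ->
    zero_ends nu = [seq x <- iota 1 m | ~~ nth false nu x.-1 && nth false nu x].
  move=> le; rewrite /zero_ends.
  have -> : m = ((size nu).-1 + (m - (size nu).-1))%N by lia.
  rewrite iotaD filter_cat [X in _ = _ ++ X](@eq_in_filter _ _ pred0) ?filter_pred0 ?cats0 // => x.
  by rewrite mem_iota => h; rewrite [nth false nu x]nth_default ?andbF //; lia.
case: (lastP mu) => [|{}mu c]; first by case: b.
rewrite [in RHS](zE (size mu).+1) ?size_rcons // /zero_ends !size_rcons last_rcons.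
rewrite -[(size mu).+1]addn1 iotaD !filter_cat -catA add1n; congr (_ ++ _).
  apply: eq_in_filter => x; rewrite mem_iota => h.
  by rewrite ![nth _ (rcons (rcons _ _) _) _]nth_rcons !size_rcons !ifT //; lia.
rewrite /= !nth_rcons !size_rcons ltnn eqxx ltnSn ltnn eqxx addn1.
have -> : ((size mu).+1 < size mu)%N = false by lia.
have -> : ((size mu).+1 == size mu)%N = false by lia.
by case: b; case: c.
Qed.

Lemma one_ends_rcons mu b :
  one_ends (rcons mu b) =
  if b then rcons (if last true mu then take (size (one_ends mu)).-1 (one_ends mu)
                   else one_ends mu) (size mu).+1
  else one_ends mu.
Proof.
case: (lastP mu) => [|{}mu c]; first by case: b.
have n0 : nth false (rcons (rcons mu c) b) 0 = nth false (rcons mu c) 0.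
  by rewrite [LHS]nth_rcons size_rcons.
rewrite /one_ends n0 !size_rcons last_rcons; set pre := if _ then _ else _.
rewrite -[(size mu).+2]addn1 iotaD -[(size mu).+1]addn1 iotaD !filter_cat !add1n.
have -> : [seq y <- iota 1 (size mu) | nth false (rcons (rcons mu c) b) y.-1
     && ~~ nth false (rcons (rcons mu c) b) y]
   = [seq y <- iota 1 (size mu) | nth false (rcons mu c) y.-1 && ~~ nth false (rcons mu c) y].
  apply: eq_in_filter => x; rewrite mem_iota => h.
  by rewrite ![nth _ (rcons (rcons _ _) _) _]nth_rcons !size_rcons !ifT //; lia.
set s := [seq y <- iota 1 (size mu) | _].
rewrite /= !addn1 !nth_rcons !size_rcons ?ltnn ?eqxx ?ltnSn ?ltnn ?eqxx.
have -> : ((size mu).+1 < size mu)%N = false by lia.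
have -> : ((size mu).+1 == size mu)%N = false by lia.
have -> : ((size mu).+2 < (size mu).+1)%N = false by lia.
have -> : ((size mu).+2 == (size mu).+1)%N = false by lia.
clearbody pre s; case: b {n0}; case: c => /=; rewrite ?cats0 //.
- by rewrite !catA size_cat addn1 take_size_cat // cats1.
- by rewrite cats1 rcons_cat.
Qed.

(** Induction on the last entry.  A one may prolong the last string of ones,
    which is why the induction carries the runs of all the prolongations of mu
    by ones. *)
Lemma runs_ends mu : runs mu (zero_ends mu) (one_ends mu).
Proof.
suff [] : runs mu (zero_ends mu) (one_ends mu) /\
  (last true mu -> exists ys, one_ends mu = rcons ys (size mu) /\
     forall q, runs (mu ++ nseq q true) (zero_ends mu) (rcons ys (size mu + q)%N)) by [].
elim/last_ind: mu => [|mu b [IH1 IH2]].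
  by split; [exact: (runs_ones 0) | exists [::]; split=> // q; exact: (runs_ones q)].
rewrite zero_ends_rcons one_ends_rcons size_rcons last_rcons.
case: b => /=; last by rewrite cats0; split=> //; exact: runs_zero.
have [l1|l0] := boolP (last true mu); last first.
  have h q : runs (rcons mu true ++ nseq q true)
      (zero_ends mu ++ [:: size mu]) (rcons (one_ends mu) ((size mu).+1 + q)%N).
    by rewrite cat_rcons cats1 addSnnS; exact: runs_block.
  split; last by exists (one_ends mu).
  by have := h 0%N; rewrite /= cats0 addn0.
have [ys [e h]] := IH2 l1; rewrite /= cats0 e size_rcons -[rcons ys _]cats1 take_size_cat //.
have h' q : runs (rcons mu true ++ nseq q true) (zero_ends mu) (rcons ys ((size mu).+1 + q)%N).
  by rewrite cat_rcons addSnnS; exact: (h q.+1).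
split; last by exists ys.
by have := h' 0%N; rewrite /= cats0 addn0.
Qed.

Section Elementary.

Variables (R : realFieldType) (th : param R) (n : nat).
Notation rung_coef := (rung_coef th).
Notation states := (states n).
Notation slice := (slice n).
Notation highest := (highest n).
Notation ladder_coef := (ladder_coef th n).

Definition pad (mu : bits) : bits := mu ++ nseq (n - size mu) false.

(** The rungs of E_mu for a sequence mu that is shorter than n: the crossbars
    depend only on the entries up to the last x_i, and this lets the blocks be
    removed one by one. *)
Definition block_ladder (mu : bits) (xs : seq nat) : ladder :=
  rev [seq Rung true i (beta mu (nth 0%N xs i)) | i <- iota 0 (size xs)].

Lemma runs_bounds mu xs ys : runs mu xs ys ->
  [/\ size ys = (size xs).+1, all (fun x => (x <= size mu)%N) xs &
      all (fun y => (y <= size mu)%N) ys].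
Proof.
elim=> {mu xs ys} [y|mu xs ys _ [e h1 h2]|mu xs ys r _ [e h1 h2] _].
- by rewrite /= size_nseq leqnn.
- rewrite size_rcons; split=> //; [move: h1|move: h2]; apply: sub_all => x; lia.
rewrite size_cat size_nseq !size_rcons !all_rcons e leq_addr leqnn /=; split=> //.
  by apply: sub_all h1 => x; lia.
by apply: sub_all h2 => x; lia.
Qed.

Lemma beta_cat mu nu x : (x <= size mu)%N -> beta (mu ++ nu) x = beta mu x.
Proof. by move=> le; rewrite /beta takel_cat. Qed.

Lemma block_ladder_cat mu nu xs : all (fun x => (x <= size mu)%N) xs ->
  block_ladder (mu ++ nu) xs = block_ladder mu xs.
Proof.
move=> /allP h; rewrite /block_ladder; congr rev; apply/eq_in_map => i.
by rewrite mem_iota => /andP[_ lt]; rewrite beta_cat // h // mem_nth.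
Qed.

Lemma block_ladder_rcons mu xs x :
  block_ladder mu (rcons xs x) = Rung true (size xs) (beta mu x) :: block_ladder mu xs.
Proof.
rewrite /block_ladder size_rcons -[(size xs).+1]addn1 iotaD map_cat rev_cat.
rewrite /= add0n nth_rcons ltnn eqxx; congr (_ :: rev _).
by apply/eq_in_map => i; rewrite mem_iota nth_rcons => /andP[_ ->].
Qed.

Lemma ones_zeros mu : (ones mu + count negb mu)%N = size mu.
Proof. by rewrite -(count_predC id mu) /ones; congr (_ + _)%N; apply: eq_count. Qed.

Lemma rung_coef_ones_neq0 m T mu : size T = m -> size mu = m ->
  (rung_coef (nseq m true) T mu (nseq m true) != 0) = (T == mu).
Proof.
elim: m T mu => [|m IH] [|c T] [|b mu] //; first by rewrite rung_coef_nil oner_eq0.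
by move=> [eT] [em]; rewrite /= rung_coef_cons_neq0 IH // eqseq_cons; case: b; case: c.
Qed.

Lemma rung_coef_zeros_neq0 m T c : size T = m ->
  (rung_coef (nseq m false) T (nseq m false) (nseq m c) != 0) = (T == nseq m c).
Proof.
elim: m T => [|m IH] [|b T] //; first by rewrite rung_coef_nil oner_eq0.
by move=> [eT]; rewrite /= rung_coef_cons_neq0 IH // eqseq_cons; case: b; case: c.
Qed.

(** Inside mu the left strand starts full and the right one has to end full, so
    T is what is left behind; in the new block T has to be full; and beyond it
    T has to be empty. *)
Lemma rung_coef_block mu r T : (size mu + r.+1 <= n)%N -> size T = n ->
  (rung_coef (top n (size mu)) T (pad mu) (top n (size mu + r.+1)) != 0) =
  (T == pad (mu ++ nseq r.+1 true)).
Proof.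
move=> le sT; set m := size mu.
have e1 : top n m = nseq m true ++ nseq r.+1 false ++ nseq (n - (m + r.+1)) false.
  by rewrite /top -nseqD; congr (_ ++ nseq _ _); lia.
have e2 : top n (m + r.+1) = nseq m true ++ nseq r.+1 true ++ nseq (n - (m + r.+1)) false.
  by rewrite /top nseqD catA.
have e3 : pad mu = mu ++ nseq r.+1 false ++ nseq (n - (m + r.+1)) false.
  by rewrite /pad -nseqD; congr (_ ++ nseq _ _); lia.
have e4 : pad (mu ++ nseq r.+1 true) = mu ++ nseq r.+1 true ++ nseq (n - (m + r.+1)) false.
  by rewrite /pad size_cat size_nseq catA.
rewrite e1 e2 e3 e4 -[T](cat_take_drop m) -[drop m T](cat_take_drop r.+1).
have s1 : size (take m T) = m by rewrite size_takel // sT; lia.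
have s2 : size (take r.+1 (drop m T)) = r.+1 by rewrite size_takel // size_drop sT; lia.
have s3 : size (drop r.+1 (drop m T)) = (n - (m + r.+1))%N by rewrite !size_drop sT; lia.
rewrite !rung_coef_cat_neq0 ?size_nseq ?s1 ?s2 //.
rewrite rung_coef_ones_neq0 // !rung_coef_zeros_neq0 //.
by rewrite !eqseq_cat ?s1 ?s2 ?size_nseq.
Qed.

Lemma size_pad mu : (size mu <= n)%N -> size (pad mu) = n.
Proof. by move=> le; rewrite size_cat size_nseq; lia. Qed.

Lemma ones_pad mu : ones (pad mu) = ones mu.
Proof. by rewrite /ones count_cat count_nseq mul0n addn0. Qed.

(** The bottom rung is the one of the last block, and its right upright is idle
    afterwards.  Hence its state at the top is already highest when the rung
    ends, while by induction the left upright has to carry mu without the last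
    block.  By [rung_coef_block] this forces T. *)
Lemma block_ladderP mu xs ys : runs mu xs ys -> (size mu <= n)%N ->
  let b := rcons (map Posz xs) (ones mu)%:Z in
  [/\ is_ladder n (block_ladder mu xs) b,
      ladder_top (block_ladder mu xs) b = map Posz ys &
      forall T, T \in slice (ones mu) ->
        (ladder_coef (block_ladder mu xs) b (rcons (highest (map Posz xs)) T) (highest (map Posz ys)) != 0)
        = (T == pad mu)].
Proof.
elim=> {mu xs ys} [y|mu xs ys hr IH|mu xs ys r hr IH _].
- rewrite size_nseq => le /=; have oy : ones (nseq y true) = y by rewrite /ones count_nseq mul1n.
  rewrite oy; split => //; first by rewrite /in_hatI; lia.
  move=> T hT; rewrite /= eqseq_cons andbT /pad size_nseq -/(top n y).
  by case: (T == _); rewrite ?oner_eq0 ?eqxx.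
- rewrite size_rcons => lt; have [h1 h2 h3] := runs_bounds hr.
  have o0 : ones (rcons mu false) = ones mu by rewrite /ones -cats1 count_cat addn0.
  have p0 : pad (rcons mu false) = pad mu.
    rewrite /pad size_rcons cat_rcons -[false :: _]/(nseq 1 false ++ _) -nseqD.
    by congr (_ ++ nseq _ _); lia.
  rewrite o0 p0 -[rcons mu false]cats1 block_ladder_cat //; apply: IH; exact: ltnW.
rewrite size_cat size_nseq => le; have [h1 h2 h3] := runs_bounds hr.
have [|hL hT IH'] := IH; first by lia.
set m := size mu in le *.
have oz := ones_zeros mu.
have oc : ones (mu ++ nseq r.+1 true) = (ones mu + r.+1)%N.
  by rewrite /ones count_cat count_nseq mul1n.
have bm : beta (mu ++ nseq r.+1 true) m = count negb mu.
  by rewrite beta_cat // /beta take_size.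
rewrite block_ladder_rcons block_ladder_cat // bm oc.
set b := rcons (map Posz xs) _ in hL hT IH'.
set y := (m + r.+1)%N.
have topE : rung_top (Rung true (size xs) (count negb mu))
    (rcons (map Posz (rcons xs m)) (ones mu + r.+1)%N%:Z) = b ++ [:: y%:Z].
  rewrite map_rcons -!cats1 -catA (@rung_top_mid _ _ _ _ [::]) ?size_map //=.
  rewrite /b -cats1 -catA /=; congr (_ ++ [:: _; _]); rewrite /y /m; lia.
have hy : all (in_hatI n) [:: y%:Z] by rewrite /= /in_hatI andbT; lia.
have hxs : all (in_hatI n) (map Posz (rcons xs m)).
  rewrite all_map all_rcons; apply/andP; split; first by rewrite /= /in_hatI; lia.
  by apply: sub_all h2 => x /=; rewrite /in_hatI; lia.
split.
- rewrite /= topE is_ladder_cat // andbT size_rcons size_map size_rcons ltnSn andbT.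
  by rewrite all_rcons hxs andbT /in_hatI; have := ones_size mu; lia.
- by rewrite /= topE (ladder_top_cat _ hL) hT map_rcons cats1.
move=> T hTs.
have hy1 : [:: top n y] \in states (upobj [:: y%:Z]).
  by rewrite mem_states1 //; apply: (@top_slice n y%:Z); case/andP: hy.
have hys : highest (map Posz ys) \in states (upobj (ladder_top (block_ladder mu xs) b)).
  by rewrite hT; apply: highest_states; rewrite -hT; exact: is_ladder_top hL.
have hhx : highest (map Posz xs) \in states (upobj (map Posz xs)).
  by apply: highest_states; move: hxs; rewrite map_rcons all_rcons => /andP[].
have sT := slice_size hTs.
have ub : upobj b = upobj (map Posz xs) ++ [:: up (ones mu)] by rewrite /b -cats1 upobj_cat.
rewrite [ladder_coef _ _ _ _]/= topE upobj_cat big_states_cat ub big_states_cat.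
have -> : highest (map Posz (rcons ys y)) = highest (map Posz ys) ++ [:: top n y].
  by rewrite map_rcons highest_rcons cats1.
have -> : rcons (highest (map Posz (rcons xs m))) T = highest (map Posz xs) ++ [:: top n m; T] ++ [::].
  by rewrite map_rcons highest_rcons cats0 -!cats1 -catA.
set c1 := rung_coef (top n m) T (pad mu) (top n y) * ladder_coef (block_ladder mu xs) b
  (rcons (highest (map Posz xs)) (pad mu)) (highest (map Posz ys)).
have hpad : pad mu \in slice (ones mu).
  by rewrite mem_slice size_pad ?ones_pad ?eqxx //; lia.
have nz : ladder_coef (block_ladder mu xs) b (rcons (highest (map Posz xs)) (pad mu)) (highest (map Posz ys)) != 0.
  by rewrite IH' ?eqxx.
transitivity (c1 != 0); last by rewrite mulf_eq0 (negPf nz) orbF rung_coef_block.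
congr (_ != 0); rewrite /c1.
transitivity (\sum_(q1 <- states (upobj (map Posz xs))) (highest (map Posz xs) == q1)%:R *
  \sum_(Q <- slice (ones mu)) (pad mu == Q)%:R *
  \sum_(Y <- slice y) (top n y == Y)%:R *
    (rung_coef (top n m) T Q Y * ladder_coef (block_ladder mu xs) b (rcons q1 Q) (highest (map Posz ys)))).
  apply: eq_big_seq => q1 h1q; rewrite big_states1 big_distrr; apply: eq_big_seq => Q hQ.
  rewrite big_states0 big_states1 !big_distrr; apply: eq_big_seq => Y hY; rewrite big_states0.
  have hq : q1 ++ [:: Q] \in states (upobj b).
    rewrite ub mem_states_cat ?h1q ?mem_states1 //.
    exact: size_states h1q.
  rewrite (ladder_coef_cat th _ hL hq hys) ?mem_states1 //.
  rewrite -catA -[[:: Q] ++ [:: Y]]/([:: Q; Y] ++ [::]) step_coef_mid; first last.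
  - by rewrite (size_states h1q) size_upobj size_map.
  - by rewrite size_highest size_map.
  rewrite /tilted_coef /= eqseq_cons andbT cats1 [Y == _]eq_sym mulr1.
  have [_|ne] := eqVneq (pad mu) Q; first by rewrite /=; ring.
  case: (highest (map Posz xs) =P q1) => [<-|_]; last by rewrite !mul0r.
  have -> : ladder_coef (block_ladder mu xs) b (rcons (highest (map Posz xs)) Q) (highest (map Posz ys)) = 0.
    by apply/eqP; rewrite -[_ == 0]negbK IH' // eq_sym.
  by rewrite /=; ring.
rewrite big_delta ?states_uniq // big_delta ?slice_uniq // big_delta ?slice_uniq //.
by move: hy1; rewrite mem_states_cons => /andP[].
Qed.

End Elementary.

(** * Light ladders are triangular *)

Section Profile.

Variable n : nat.

Definition wt_bits (T : bits) : weight n :=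
  [ffun i : 'I_n.-1 =>
     (nth false T i : nat)%:Z - (nth false T i.+1 : nat)%:Z].

Definition partial_weights (s : seq bits) : seq (weight n) :=
  foldl (fun e T => rcons e (last 0 e + wt_bits T)) [:: 0] s.

Lemma partial_weights_rcons s T : partial_weights (rcons s T) = rcons (partial_weights s) (last 0 (partial_weights s) + wt_bits T).
Proof. by rewrite /partial_weights -cats1 foldl_cat. Qed.

End Profile.

Fixpoint partial_heights (r : seq bits) : seq int :=
  state_height r :: (if r is _ :: r' then partial_heights r' else [::]).

(** The heights of the initial parts, that of the whole state first.  In the
    lexicographic order it is compared first; then the last factor is dropped,
    as in the recursive construction of light ladders. *)
Definition profile (s : seq bits) : seqlexi int := partial_heights (rev s).

Lemma state_height_rev s : state_height (rev s) = state_height s.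
Proof. by apply: state_height_perm; rewrite perm_rev. Qed.

Lemma state_height_rcons s T : state_height (rcons s T) = state_height s + height T.
Proof. by rewrite -cats1 state_height_cat state_height_cons state_height_nil addr0. Qed.

Lemma profile_head s : exists r, profile s = state_height s :: r.
Proof.
by rewrite /profile -(state_height_rev s); case: (rev s) => [|T r] /=; eexists.
Qed.

Lemma profile_rcons s T : profile (rcons s T) = state_height (rcons s T) :: profile s.
Proof.
by rewrite /profile rev_rcons /= -(state_height_rev (rcons s T)) rev_rcons.
Qed.

Lemma profile_lt s t : state_height s < state_height t -> (profile s < profile t)%O.
Proof.
have [r ->] := profile_head s; have [r' ->] := profile_head t => lt.
by rewrite Order.SeqLexiOrder.ltEseqlexi (ltW lt) leNgt lt.
Qed.

Lemma profile_lt_rcons s t T V : state_height (rcons s T) = state_height (rcons t V) ->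
  (profile s < profile t)%O -> (profile (rcons s T) < profile (rcons t V))%O.
Proof.
move=> e lt; rewrite !profile_rcons Order.SeqLexiOrder.ltEseqlexi e lexx.
exact: lt.
Qed.

Section Light.

Variables (R : realFieldType) (th : param R) (n : nat).
Notation ev := (ev th n).
Notation states := (states n).
Notation slice := (slice n).
Notation highest := (highest n).
Notation vis_state := (vis_state n).

Lemma I_hat b : all (in_I n) b -> all (in_hatI n) b.
Proof. by apply: sub_all => k; rewrite /in_I /in_hatI; lia. Qed.

Lemma strip_all b : all (in_I n) (strip n b).
Proof. exact: filter_all. Qed.

Lemma strip_id b : all (in_I n) b -> strip n b = b.
Proof. by move=> h; apply/all_filterP. Qed.

Lemma zero_ends_I (mu : n.-tuple bool) : all (in_I n) (map Posz (zero_ends mu)).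
Proof.
apply/allP => _ /mapP[x h ->]; move: h.
by rewrite mem_filter mem_iota size_tuple /in_I; lia.
Qed.

(** The labels x_i lie strictly between 0 and n; at the top y_1 = 0 and
    y_(k+1) = n may have to be erased. *)
Lemma E_webP (mu : n.-tuple bool) a : Omega a mu -> in_I n a ->
  let X := map Posz (zero_ends mu) in
  let Y := strip n (map Posz (one_ends mu)) in
  [/\ dom (E_web n mu) = upobj X ++ [:: up a], cod (E_web n mu) = upobj Y,
    (forall i j, i \in states (upobj X ++ [:: up a]) -> j \in states (upobj Y) ->
       ev (E_web n mu) i j != 0 -> state_height i = state_height j) &
    (forall T, T \in slice a -> (ev (E_web n mu) (highest X ++ [:: T]) (highest Y) != 0) = (T == mu))].
Proof.
move=> /eqP Oa Ia X Y.
have [|hL hT hP] := block_ladderP th (runs_ends mu) _ (n := n); first by rewrite size_tuple.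
have src : E_source mu = X ++ [:: a] by rewrite /E_source Oa cats1.
have srcE : rcons (map Posz (zero_ends mu)) (ones mu)%:Z = E_source mu by [].
rewrite srcE in hL hT hP.
have XI : all (in_I n) X := zero_ends_I mu.
have sI : strip n (E_source mu) = X ++ [:: a].
  by rewrite src strip_id // all_cat XI /= Ia.
have [de ce] := ends_ladder hL.
have de' : vis n (E_source mu) = upobj X ++ [:: up a] by rewrite /vis sI upobj_cat.
have pm : pad n mu = mu :> bits by rewrite /pad size_tuple subnn cats0.
split.
- by rewrite [LHS]de de'.
- by rewrite [LHS]ce hT.
- move=> i j; rewrite -de' => /(vis_state_surj (is_ladder_hat hL))[i' hi <-].
  rewrite /Y -hT => /(vis_state_surj (is_ladder_top hL))[j' hj <-].
  by rewrite [ev _ _ _](ev_ladder th hL hi hj) (state_height_vis hi) (state_height_vis hj); exact: ladder_coef_height.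
move=> T hTa; have hTa' : T \in slice (ones mu)%:Z by rewrite [(ones mu)%:Z]Oa.
have hx : highest X \in states (upobj X) by apply: highest_states; exact: I_hat.
have hi : rcons (highest X) T \in states (upobj (E_source mu)).
  by rewrite src -cats1 upobj_cat mem_states_cat ?hx ?mem_states1 ?size_highest ?size_upobj.
have hj : highest (map Posz (one_ends mu)) \in states (upobj (ladder_top (block_ladder mu (zero_ends mu)) (E_source mu))).
  by rewrite hT; apply: highest_states; rewrite -hT; exact: is_ladder_top hL.
rewrite -{2}pm -(hP T hTa') -(ev_ladder th hL hi hj).
have -> : vis_state (rcons (highest X) T) = highest X ++ [:: T].
  rewrite -cats1 vis_state_cat vis_state_highest ?I_hat // strip_id // vis_state_cons -(in_I_slice hTa) Ia.
  by [].
by rewrite vis_state_highest // -hT; exact: is_ladder_top hL.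
Qed.

(** A sum over states that only involves states of maximal height has a single
    term. *)
Lemma sum_highest b (G : seq bits -> R) : all (in_hatI n) b ->
  (forall k, k \in states (upobj b) -> G k != 0 -> state_height k = state_height (highest b)) ->
  \sum_(k <- states (upobj b)) G k = G (highest b).
Proof.
move=> hb h; rewrite (bigD1_seq (highest b)) ?states_uniq ?highest_states //= big1_seq ?addr0 //.
move=> k /andP[ne hk]; apply/eqP; apply: contraNT ne => nz.
by apply/eqP/state_height_eq => //; exact: h.
Qed.

(** Triangularity: s is the state whose partial weights are e, and it is the
    largest one with a nonzero coefficient to the highest state.  As different
    states may have the same profile, the other ones are required to be strictly
    smaller. *)
Record light_spec (w : seq int) (e : seq (weight n)) (x : seq int) (L : term)
    (s : seq bits) : Prop := LightSpec {
  light_w : all (in_I n) w;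
  light_x : all (in_I n) x;
  light_dom : dom L = upobj w;
  light_cod : cod L = upobj x;
  light_s : s \in states (upobj w);
  light_e : e = partial_weights n s;
  light_neq0 : ev L s (highest x) != 0;
  light_height : forall t j, t \in states (upobj w) -> j \in states (upobj x) ->
    ev L t j != 0 -> state_height t = state_height j;
  light_tri : forall t, t \in states (upobj w) -> ev L t (highest x) != 0 ->
    t = s \/ (profile t < profile s)%O }.

(** A path from (t', T) to the highest state passes through a state p on top of
    N.  If p is highest, then T = mu, and t' is s or smaller by induction.  If
    not, then t' has the height of p, which is less than that of s, although the
    whole states have the same height. *)
Lemma light_ladder_rcons_spec w e x L s a (mu : n.-tuple bool) u N x' N' :
  light_spec w e x L s -> in_I n a -> Omega a mu ->
  neutral_ladder n x (u ++ map Posz (zero_ends mu)) N ->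
  neutral_ladder n (u ++ strip n (map Posz (one_ends mu))) x' N' ->
  light_spec (rcons w a) (rcons e (last 0 e + wt01 mu)) x'
    (Comp N' (Comp (Tens (Id (upobj u)) (E_web n mu))
       (Comp (Tens N (Id [:: up a])) (Tens L (Id [:: up a])))))
    (rcons s (mu : bits)).
Proof.
move=> [wI xI dL cL sw eE nz0 L_height tri] aI Oa hN hN'.
have [dE cE E_height EP] := E_webP Oa aI.
set X := map Posz (zero_ends mu) in hN dE cE E_height EP *.
set Y := strip n _ in hN' cE E_height EP *.
have [dN cN] := neutral_ends hN; have [dN' cN'] := neutral_ends hN'.
have XI : all (in_I n) X := zero_ends_I mu.
have YI : all (in_I n) Y := strip_all _.
have uI : all (in_I n) u.
  case: hN => b [l [_ _ _ e' _]]; have : all (in_I n) (u ++ X) by rewrite -e' strip_all.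
  by rewrite all_cat => /andP[].
have x'I : all (in_I n) x' by case: hN' => b [l [_ _ _ <- _]]; exact: strip_all.
have uXI : all (in_hatI n) (u ++ X) by apply: I_hat; rewrite all_cat uI.
have uYI : all (in_hatI n) (u ++ Y) by apply: I_hat; rewrite all_cat uI.
set LE := Comp (Tens (Id (upobj u)) (E_web n mu)) _.
have dLE : dom LE = upobj (rcons w a) by rewrite /= dL -cats1 upobj_cat.
have cLE : cod LE = upobj (u ++ Y) by rewrite /= cE upobj_cat.
have upc b : upobj (rcons b a) = upobj b ++ [:: up a] by rewrite -cats1 upobj_cat.
have muS : (mu : bits) \in slice a.
  by rewrite mem_slice size_tuple eqxx; exact: Oa.
pose K t p := \sum_(i <- states (upobj x)) ev L t i * ev N i p.
have K_height t p : t \in states (upobj w) -> p \in states (upobj (u ++ X)) -> K t p != 0 -> state_height t = state_height p.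
  move=> ht hp /sum_neq0[i hi]; rewrite mulf_eq0 => /norP[n1 n2].
  by rewrite (L_height t i) // (neutral_height hN hi hp n2).
have N_height : state_height (highest x) = state_height (highest (u ++ X)).
  by apply: (neutral_height hN) (neutral_highest th hN); rewrite ?highest_states // I_hat.
have N'_height : state_height (highest (u ++ Y)) = state_height (highest x').
  by apply: (neutral_height hN') (neutral_highest th hN'); rewrite ?highest_states // I_hat.
have K_highest t : t \in states (upobj w) ->
    K t (highest (u ++ X)) = ev L t (highest x) * ev N (highest x) (highest (u ++ X)).
  move=> ht; rewrite /K (sum_highest (I_hat xI)) // => k hk; rewrite mulf_eq0 => /norP[_ n2].
  by rewrite N_height; apply: (neutral_height hN) n2; rewrite ?highest_states.
have LEE t T q : t \in states (upobj w) -> T \in slice a -> q \in states (upobj (u ++ Y)) ->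
    ev LE (rcons t T) q = \sum_(p <- states (upobj (u ++ X)))
      K t p * ev (Tens (Id (upobj u)) (E_web n mu)) (rcons p T) q.
  move=> ht hT hq; rewrite /LE ev_comp; last by rewrite /= cN dE upobj_cat catA.
  rewrite [cod _]/= cN big_states_cat; apply: eq_big_seq => p hp.
  transitivity (\sum_(j <- states [:: up a]) ([:: T] == j)%:R * (K t p *
     ev (Tens (Id (upobj u)) (E_web n mu)) (p ++ j) q)); last first.
    by rewrite big_delta ?states_uniq ?mem_states1 // cats1.
  apply: eq_big_seq => j hj; rewrite ev_comp; last by rewrite /= cL dN.
  rewrite [cod _]/= cL big_states_cat mulrA; congr (_ * _); rewrite /K big_distrr.
  apply: eq_big_seq => i hi /=.
  transitivity (\sum_(k <- states [:: up a]) ([:: T] == k)%:R * (ev L t i * ev N i p * (k == j)%:R)).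
    apply: eq_big_seq => k hk; rewrite -cats1.
    rewrite ev_tens ?dL ?cL ?(size_states ht) ?(size_states hi) //.
    rewrite ev_tens ?dN ?cN ?(size_states hp) ?(size_states hi) // !ev_id.
    by ring.
  by rewrite big_delta ?states_uniq ?mem_states1 //; ring.
have TE p T q : p \in states (upobj (u ++ X)) -> T \in slice a -> q \in states (upobj (u ++ Y)) ->
    ev (Tens (Id (upobj u)) (E_web n mu)) (rcons p T) q != 0 -> state_height p + height T = state_height q.
  rewrite !upobj_cat => /split_states[p1 p2 hp1 hp2] hT /split_states[q1 q2 hq1 hq2].
  rewrite -cats1 -catA ev_tens /= ?(size_states hp1) ?(size_states hq1) //.
  rewrite ev_id mulf_eq0 => /norP[n1 n2].
  have -> : p1 = q1 by apply/eqP; move: n1; case: (p1 == q1) => //; rewrite eqxx.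
  have e1 : state_height (p2 ++ [:: T]) = state_height q2.
    by apply: E_height n2; rewrite // mem_states_cat ?hp2 ?mem_states1 // (size_states hp2).
  by move: e1; rewrite !state_height_cat state_height_cons state_height_nil addr0 => <-; rewrite addrA.
have TE_highest T : T \in slice a ->
   ev (Tens (Id (upobj u)) (E_web n mu)) (rcons (highest (u ++ X)) T) (highest (u ++ Y)) =
   ev (E_web n mu) (highest X ++ [:: T]) (highest Y).
  move=> hT; rewrite !highest_cat -cats1 -catA ev_tens /= ?size_highest ?size_upobj //.
  by rewrite ev_id eqxx mul1r.
have LE_height t T q : t \in states (upobj w) -> T \in slice a -> q \in states (upobj (u ++ Y)) ->
    ev LE (rcons t T) q != 0 -> state_height (rcons t T) = state_height q.
  move=> ht hT hq; rewrite LEE // => /sum_neq0[p hp]; rewrite mulf_eq0 => /norP[n1 n2].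
  by rewrite state_height_rcons (K_height t p) // (TE p T q).
have fullE t T : t \in states (upobj w) -> T \in slice a ->
    ev (Comp N' LE) (rcons t T) (highest x') = ev LE (rcons t T) (highest (u ++ Y)) * ev N' (highest (u ++ Y)) (highest x').
  move=> ht hT; rewrite ev_comp ?cLE ?dN' //.
  rewrite sum_highest // => q hq; rewrite mulf_eq0 => /norP[_ n2].
  by rewrite N'_height; apply: (neutral_height hN') n2; rewrite ?highest_states ?I_hat.
have splitS t : t \in states (upobj (rcons w a)) ->
    exists t' T, [/\ t' \in states (upobj w), T \in slice a & t = rcons t' T].
  rewrite upc => /split_states[t' _ ht' /states1P[T hT ->]]; exists t', T.
  by rewrite cats1.
have s_height : state_height s = state_height (highest (u ++ X)).
  by rewrite -N_height; apply: L_height nz0; rewrite ?highest_states // I_hat.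
have nzs : ev (Comp N' LE) (rcons s (mu : bits)) (highest x') != 0.
  rewrite fullE // mulf_neq0 ?neutral_highest // LEE ?highest_states //.
  rewrite sum_highest // => [|p hp]; last first.
    by rewrite mulf_eq0 => /norP[n1 _]; rewrite -s_height (K_height s p).
  by rewrite mulf_neq0 ?TE_highest ?EP ?K_highest // mulf_neq0 // neutral_highest.
have all_height t j : t \in states (upobj (rcons w a)) -> j \in states (upobj x') ->
    ev (Comp N' LE) t j != 0 -> state_height t = state_height j.
  move=> /splitS[t' [T [ht hT ->]]] hj; rewrite ev_comp ?cLE ?dN' // => /sum_neq0[q hq].
  rewrite mulf_eq0 => /norP[n1 n2].
  by rewrite (LE_height t' T q) // (neutral_height hN' hq hj n2).
have ss : rcons s (mu : bits) \in states (upobj (rcons w a)).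
  by rewrite upc -cats1 mem_states_cat ?sw ?mem_states1 // (size_states sw).
have hx' : highest x' \in states (upobj x') by rewrite highest_states // I_hat.
split => //.
- by rewrite all_rcons aI.
- by rewrite partial_weights_rcons -eE.
move=> t ht nz; have e_height : state_height t = state_height (rcons s (mu : bits)).
  by rewrite (all_height _ _ ht hx' nz) (all_height _ _ ss hx' nzs).
move: ht nz e_height => /splitS[t' [T [ht hT ->]]].
rewrite fullE // mulf_eq0 => /norP[n1 _] e_height; move: n1; rewrite LEE ?highest_states //.
move=> /sum_neq0[p hp]; rewrite mulf_eq0 => /norP[n1 n2].
have [ep|np] := eqVneq p (highest (u ++ X)).
  move: n1 n2; rewrite ep K_highest // TE_highest // EP // mulf_eq0 => /norP[n1 _] /eqP eT.
  move: e_height; rewrite eT => e_height.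
  by have [->|lt] := tri t' ht n1; [left | right; exact: profile_lt_rcons].
right; apply: profile_lt_rcons => //; apply: profile_lt.
rewrite (K_height _ _ ht hp n1) s_height lt_neqAle state_height_le // andbT.
by apply: contra np => /eqP h; apply/eqP; exact: state_height_eq.
Qed.

Lemma light_ladder_spec w e x L : light_ladder w e x L -> exists s, light_spec w e x L s.
Proof.
elim=> {w e x L} [|w e x L a mu u N x' N' _ [s spec_s] _ aI Oa _ hN hN'].
  exists [::]; split => //.
  - by rewrite ev_id eqxx oner_eq0.
  - by move=> t j; rewrite !mem_states0 => /eqP -> /eqP ->.
  by move=> t; rewrite mem_states0 => /eqP ->; left.
by exists (rcons s (mu : bits)); exact: light_ladder_rcons_spec spec_s aI Oa hN hN'.
Qed.

End Light.

(** * Linear independence *)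

Lemma exists_maximal (T : eqType) (r : rel T) (s : seq T) x0 :
  irreflexive r -> transitive r -> x0 \in s ->
  exists2 x, x \in s & forall y, y \in s -> ~~ r x y.
Proof.
move=> irr tr; elim: s x0 => // x s IH x0 _.
case: s IH => [|x1 s] IH; first by exists x; rewrite ?mem_head // => y; rewrite inE => /eqP ->; rewrite irr.
have [m ms mmax] := IH x1 (mem_head _ _).
have [rmx|nmx] := boolP (r m x).
  exists x; first exact: mem_head.
  move=> y; rewrite inE => /orP[/eqP ->|ys]; first by rewrite irr.
  by apply: contra (mmax y ys); exact: tr.
exists m; first by rewrite inE ms orbT.
by move=> y; rewrite inE => /orP[/eqP ->|/mmax].
Qed.

Lemma finite_choice (I : eqType) (T : Type) (t0 : T) (P : I -> T -> Prop) (s : seq I) :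
  (forall i, i \in s -> exists t, P i t) -> exists g : I -> T, forall i, i \in s -> P i (g i).
Proof.
elim: s => [|i s IH] h; first by exists (fun=> t0).
have [t Pt] := h i (mem_head _ _).
have [|g hg] := IH; first by move=> j js; apply: h; rewrite inE js orbT.
exists (fun j => if j == i then t else g j) => j.
by rewrite inE; case: eqP => [-> //|_] /=; exact: hg.
Qed.

Lemma In_map_in (I : eqType) (F : I -> term) (s : seq I) (Q : term -> Prop) :
  (forall i, i \in s -> Q (F i)) -> forall t, List.In t (map F s) -> Q t.
Proof.
elim: s => //= i s IH h t [<-|]; first by apply: h; exact: mem_head.
by apply: IH => j js; apply: h; rewrite inE js orbT.
Qed.

Definition int_param (m : nat) : param rat :=
  Param (R := rat) (sqrt_q := m.+2%:R) (ltac:(by rewrite ltr1n)).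

(** The values q + 1/q are pairwise distinct for q > 1, so c has infinitely many
    zeros. *)
Lemma poly_eq0_params (c : {poly int}) : (forall m, qeval (int_param m) c = 0) -> c = 0.
Proof.
move=> h; pose p : {poly rat} := map_poly intr c.
have p0 : p = 0.
  apply/eqP; apply: contraT => nz.
  pose rs := [seq (m.+2%:R ^ 2 + m.+2%:R ^ (-2) : rat) | m <- iota 0 (size p)].
  have := max_poly_roots nz (rs := rs); rewrite size_map size_iota ltnn; apply.
    by apply/allP => _ /mapP[m _ ->]; rewrite rootE; apply/eqP; exact: h.
  rewrite map_inj_in_uniq ?iota_uniq // => k l _ _.
  have key (x y : rat) : x != 0 -> y != 0 -> 1 < x * y -> x + x^-1 = y + y^-1 -> x = y.
    move=> x0 y0 xy e; have : (x - y) * (1 - (x * y)^-1) = 0.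
      rewrite invfM mulrBr mulr1 mulrBl mulrA divff // mul1r [y * _]mulrC -mulrA mulVf // mulr1.
      by move: e => /eqP; rewrite -subr_eq0 => /eqP <-; ring.
    move/eqP; rewrite mulf_eq0 !subr_eq0 => /orP[/eqP //|/eqP e1].
    by move: xy; rewrite -[x * y]invrK -e1 invr1 ltxx.
  have pos (j : nat) : 1 < (j.+2%:R : rat) ^+ 2 by rewrite exprn_egt1 // ltr1n.
  have eE (j : nat) : (j.+2%:R : rat) ^ 2 + j.+2%:R ^ (-2) = j.+2%:R ^+ 2 + (j.+2%:R ^+ 2)^-1 by [].
  rewrite !eE => /key e; have : (k.+2%:R : rat) ^+ 2 = l.+2%:R ^+ 2.
    apply: e; rewrite ?expf_neq0 ?pnatr_eq0 //.
    exact: mulr_egt1 (pos k) (pos l).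
  by move/eqP; rewrite eqrXn2 ?ler0n // eqr_nat => /eqP[].
apply/polyP => i; move/polyP/(_ i): p0; rewrite coef_map !coef0 => /eqP.
by rewrite intr_eq0 => /eqP.
Qed.

Section Independence.

Variables (n : nat) (w z : seq int).
Let I : eqType := (weight n * seq (weight n) * seq (weight n))%type.
Variables (xs : weight n -> seq int) (LL : seq int -> seq (weight n) -> term).
Variables (th : param rat) (s : seq I) (c : I -> {poly int}) (sig tau : I -> seq bits).
Hypothesis s_uniq : uniq s.
Hypothesis specs : forall i, i \in s ->
  let: (lam, e, f) := i in
  [/\ light_spec th w e (xs lam) (LL w e) (sig i),
      light_spec th z f (xs lam) (LL z f) (tau i) & lam = last 0 e].

Let F (i : I) := let: (lam, e, f) := i in double_ladder w z LL e f.

Hypothesis rel0 : weq n (upobj w) (upobj z)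
  (lsum (upobj w) (upobj z) [seq Scale (c i) (F i) | i <- s]) (Zero (upobj w) (upobj z)).

(** Comparing the states of e first, and those of f only among the terms with
    the same e. *)
Let before (i j : I) : bool :=
  (profile (sig i) < profile (sig j))%O ||
  (sig i == sig j) && (profile (tau i) < profile (tau j))%O.

Lemma before_irr : irreflexive before.
Proof. by move=> i; rewrite /before !ltxx andbF. Qed.

Lemma before_trans : transitive before.
Proof.
move=> j i k /orP[h1|/andP[/eqP e1 h1]] /orP[h2|/andP[/eqP e2 h2]]; rewrite /before.
- by rewrite (lt_trans h1 h2).
- by rewrite -e2 h1.
- by rewrite e1 h2.
- by rewrite e1 e2 eqxx (lt_trans h1 h2) orbT.
Qed.

(** If a term (e', f') has a nonzero coefficient from sig m to tau m, then sig m
    is at most the state of e' and tau m at most that of f', by triangularity.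
    If m is maximal, both are equal; since the state of e' determines e', this
    is the term m itself. *)
Lemma coef_zero i : i \in s -> qeval th (c i) = 0.
Proof.
move=> si; apply/eqP; apply: contraT => nzi.
pose bad := [seq i <- s | qeval th (c i) != 0].
have : i \in bad by rewrite mem_filter nzi.
move=> /(exists_maximal before_irr before_trans)[m mbad mmax].
move: mbad; rewrite mem_filter => /andP[nzm sm] {i si nzi}.
have [_ _ _ _ evE] := weq_sound th rel0.
have ends t : List.In t [seq Scale (c i) (F i) | i <- s] -> dom t = upobj w /\ cod t = upobj z.
  move: t; apply: (In_map_in (Q := fun t => dom t = upobj w /\ cod t = upobj z)).
  move=> [[lam e] f] si; have [h1 h2 _] := specs si.
  by rewrite /= cod_bar (light_dom h1) (light_dom h2).
have valE i : i \in s -> ev th n (Scale (c i) (F i)) (sig m) (tau m) =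
    qeval th (c i) * \sum_(j <- states n (upobj (xs i.1.1)))
       ev th n (LL w i.1.2) (sig m) j * ev th n (LL z i.2) (tau m) j.
  case: i => [[lam e] f] si; have [h1 h2 _] := specs si.
  rewrite ev_scale /F /double_ladder ev_comp ?dom_bar ?(light_cod h1) ?(light_cod h2) //=.
  by congr (_ * _); apply: eq_bigr => j _; rewrite ev_bar.
have [hsig htau] : sig m \in states n (upobj w) /\ tau m \in states n (upobj z).
  by case: m {nzm mmax valE} sm => [[lam e] f] sm; have [h1 h2 _] := specs sm;
     split; [exact: light_s h1 | exact: light_s h2].
have := evE _ _ hsig htau; rewrite ev_zero ev_lsum // big_map.
have main i : i \in s -> i != m -> ev th n (Scale (c i) (F i)) (sig m) (tau m) = 0.
  move=> si ne; rewrite valE //; have [->|nzi] := eqVneq (qeval th (c i)) 0; first by rewrite mul0r.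
  have : ~~ before m i by apply: mmax; rewrite mem_filter nzi.
  rewrite negb_or negb_and => /andP[nlt1 nlt2].
  rewrite big1_seq ?mulr0 // => j /= hj; apply/eqP; apply: contraNT ne.
  rewrite mulf_eq0 => /norP[n1 n2].
  have := specs sm; have := specs si.
  case: i si nzi nlt1 nlt2 hj n1 n2 => [[lam' e'] f'] /= si nzi nlt1 nlt2 hj n1 n2.
  case: m sm nzm mmax valE hsig htau nlt1 nlt2 n1 n2 => [[lam e] f] /= sm _ _ _ hsig htau nlt1 nlt2 n1 n2.
  move=> [h1' h2' l'] [h1 h2 l].
  have hh : highest n (xs lam') \in states n (upobj (xs lam')).
    by rewrite highest_states // I_hat // (light_x h1').
  (* The middle state j is highest: otherwise sig m would have a smaller height
     than the state of e', and m would not be maximal. *)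
  have e1 := light_height h1' hsig hj n1.
  have e2 := light_height h1' (light_s h1') hh (light_neq0 h1').
  have ej : j = highest n (xs lam').
    have le := state_height_le hj; apply: state_height_eq hj _; move: le; rewrite -e2 -e1 => le.
    by apply/eqP; rewrite eq_le le leNgt; apply: contra nlt1; exact: profile_lt.
  rewrite ej in n1 n2.
  have es : sig (lam, e, f) = sig (lam', e', f').
    by have [//|lt] := light_tri h1' hsig n1; rewrite lt in nlt1.
  have et : tau (lam, e, f) = tau (lam', e', f').
    have [//|lt] := light_tri h2' htau n2.
    by move: nlt2; rewrite es eqxx lt.
  have ee : e = e' by rewrite (light_e h1) (light_e h1') es.
  have ef : f = f' by rewrite (light_e h2) (light_e h2') et.
  by rewrite l' l ee ef.
rewrite (bigD1_seq m) //= big1_seq ?addr0 => [|i /andP[ne si]]; last exact: main.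
rewrite valE // => /eqP; rewrite mulf_eq0 (negPf nzm) /=.
case: m sm {nzm mmax valE main} hsig htau => [[lam e] f] sm hsig htau.
have [h1 h2 _] := specs sm.
have hx : all (in_hatI n) (xs lam) by apply: I_hat (light_x h1).
rewrite /= (sum_highest hx) => [|k hk]; last first.
  rewrite mulf_eq0 => /norP[n1 _]; rewrite -(light_height h1 hsig hk n1).
  by rewrite (light_height h1 hsig _ (light_neq0 h1)) // highest_states.
by rewrite mulf_eq0 (negPf (light_neq0 h1)) (negPf (light_neq0 h2)).
Qed.

End Independence.

Theorem theorem2p57 (n : nat) (hn : (2 <= n)%N)
    (xs : weight n -> seq int)
    (LL : seq int -> seq (weight n) -> term)
    (hxs : forall lam : weight n, dominant lam -> in_P lam (xs lam))
    (hLL : forall (w : seq int) (lam : weight n) (e : seq (weight n)),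
       is_upobj n w -> dominant lam -> in_E w lam e ->
       light_ladder w e (xs lam) (LL w e))
    (hid : forall lam : weight n, dominant lam ->
       weq n (upobj (xs lam)) (upobj (xs lam))
         (LL (xs lam) (full_subseq n (xs lam))) (Id (upobj (xs lam))))
    (w z : seq int) (hw : is_upobj n w) (hz : is_upobj n z) :
  lin_indep n (upobj w) (upobj z)
    (fun i : weight n * seq (weight n) * seq (weight n) =>
       let: (lam, e, f) := i in
       [/\ dominant lam, in_E w lam e & in_E z lam f])
    (fun i : weight n * seq (weight n) * seq (weight n) =>
       let: (lam, e, f) := i in double_ladder w z LL e f).
Proof.
move=> s c s_uniq valid rel0 i si; apply: poly_eq0_params => m; set th := int_param m.
have [g hg] : exists g, forall i, i \in s -> let: (lam, e, f) := i in
   [/\ light_spec th w e (xs lam) (LL w e) (g i).1,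
       light_spec th z f (xs lam) (LL z f) (g i).2 & lam = last 0 e].
  apply: (finite_choice ([::], [::]) (P := fun i t => let: (lam, e, f) := i in
    [/\ light_spec th w e (xs lam) (LL w e) t.1,
        light_spec th z f (xs lam) (LL z f) t.2 & lam = last 0 e])).
  move=> [[lam e] f] /valid[dl he hf].
  have [st hst] := light_ladder_spec th (hLL _ _ _ hw dl he).
  have [t ht] := light_ladder_spec th (hLL _ _ _ hz dl hf).
  exists (st, t); split => //.
  by case/andP: he => _ /eqP.
exact: (coef_zero (sig := fun i => (g i).1) (tau := fun i => (g i).2) s_uniq hg rel0 si).
Qed.
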